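(* Let $n\ge1$ and let $(X^1(t),\dots,X^n(t))_{t=0,1,2,\dots}$ be the Aztec diamond particle process on $n$ lines. For $N\ge1$ let $$\tilde X^k_i=\frac{X^k_i(N)-\frac12N}{\frac12\sqrt N},\qquad 1\le i\le k\le n.$$ As $N\to\infty$, $\tilde X=(\tilde X^1,\dots,\tilde X^n)\to\Lambda$ weakly, where the $\mathbb R^{n(n+1)/2}$-valued random variable $\Lambda$ has density at $(x^1,\dots,x^n)$, $x^k\in\mathbb R^k$, $x^n_1<\dots<x^n_n$, equal to $$\mu^n_1(x^n)\,\frac{\chi(x^1,x^2)\cdots\chi(x^{n-1},x^n)}{\mathrm{vol}(\mathbf K(x^n))}.$$
   Context: Aztec diamond particle process on $n$ lines: $(X^1(t),\dots,X^n(t))_{t=0,1,2,\dots}$ with $X^k(t)=(X^k_1(t),\dots,X^k_k(t))\in\mathbb Z^k$. Let $\beta^j_i(t)$ ($1\le i\le j\le n$, $t\ge1$) be i.i.d. with $\mathbb P[\beta^j_i(t)=0]=\mathbb P[\beta^j_i(t)=1]=\frac12$. Initial condition: $X^j_i(0)=i$ for $1\le i\le j\le n$. For $t=1,2,\dots$: - $X^1_1(t)=X^1_1(t-1)+\beta^1_1(t)$; - for $j\ge2$: $X^j_1(t)=X^j_1(t-1)+\beta^j_1(t)-\mathbf 1\{X^j_1(t-1)+\beta^j_1(t)=X^{j-1}_1(t)+1\}$; - for $j\ge2$: $X^j_j(t)=X^j_j(t-1)+\beta^j_j(t)+\mathbf 1\{X^j_j(t-1)+\beta^j_j(t)=X^{j-1}_{j-1}(t)\}$;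 - for $j\ge3$, $1<i<j$: $X^j_i(t)=X^j_i(t-1)+\beta^j_i(t)-\mathbf 1\{X^j_i(t-1)+\beta^j_i(t)=X^{j-1}_i(t)+1\}+\mathbf 1\{X^j_i(t-1)+\beta^j_i(t)=X^{j-1}_{i-1}(t)\}$. Notation: $\mu^n_1(y)=\frac1{Z_n}\exp\{-\sum_i y_i^2/2\}\prod_{i<j}(y_j-y_i)^2$ on $\{y\in\mathbb R^n: y_1<\dots<y_n\}$, with $Z_n=(2\pi)^{n/2}\prod_{j<n}j!$. $\chi(x^k,x^{k+1})=1$ if $x^{k+1}_i\le x^k_i\le x^{k+1}_{i+1}$ for all $i=1,\dots,k$, and $0$ otherwise. $\mathbf K(x^n)$ is the set of $(x^1,\dots,x^{n-1})$, $x^k\in\mathbb R^k$, with $x^{k+1}_i\le x^k_i\le x^{k+1}_{i+1}$ for all $1\le i\le k\le n-1$; $\mathrm{vol}$ is its $n(n-1)/2$-dimensional volume, which equals $\prod_{i<j}(x^n_j-x^n_i)/\prod_{k<n}k!$. For $n=1$ the factor $\chi\cdots\chi/\mathrm{vol}$ is $1$. *)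

(* Defs.v *)
From HB Require Import structures.
From mathcomp Require Import all_boot all_order all_algebra.
From mathcomp Require Import all_classical all_reals all_analysis.

Set Implicit Arguments.
Unset Strict Implicit.
Unset Printing Implicit Defensive.

Import Order.TTheory GRing.Theory Num.Theory.
Import numFieldNormedType.Exports.

Local Open Scope classical_set_scope.
Local Open Scope ring_scope.

(* Lebesgue measure on R^m, as a measure on [m.-tuple R] with its product
   sigma-algebra: the point mass on R^0, and lambda_1 x lambda_m transported
   along (a, z) |-> a :: z on R^(m+1).  It is a sigma-finite measure (instances
   below). *)
Definition tcons (T : Type) (m : nat) (p : T * m.-tuple T) : m.+1.-tuple T :=
  [tuple of p.1 :: p.2].

Fixpoint lebesgue_tuple (R : realType) (m : nat) :
    set (m.-tuple R) -> \bar R :=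
  match m with
  | 0 => @dirac _ (0.-tuple R) [tuple] R
  | m'.+1 => pushforward
      (product_measure1 (@lebesgue_measure R) (@lebesgue_tuple R m'))
      (@tcons R m')
  end.

Section lebesgue_tuple_measure.
Context (R : realType).

Lemma measurable_tcons m :
  measurable_fun [set: R * m.-tuple R] (@tcons R m).
Proof. exact: (measurable_cons measurable_fst measurable_snd). Qed.

Let lebesgue_tuple_ex m :
  exists mu : {sigma_finite_measure set (m.-tuple R) -> \bar R},
    @lebesgue_tuple R m = mu :> (set (m.-tuple R) -> \bar R).
Proof.
elim: m => [|m [mu mE]] /=.
  pose D : {measure set (0.-tuple R) -> \bar R} :=
    @dirac _ (0.-tuple R) [tuple] R.
  have sD : sigma_finite setT D.
    apply: fin_num_fun_sigma_finite; first by rewrite measure0.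
    by move=> A mA; rewrite /D /= diracE.
  pose b := Measure_isSigmaFinite.Build _ _ _ D sD.
  pose S : {sigma_finite_measure set (0.-tuple R) -> \bar R} :=
    HB.pack (D : set _ -> _) (Measure.on D) b.
  by exists S.
rewrite mE.
pose D' : {measure set (m.+1.-tuple R) -> \bar R} :=
  pushforward (product_measure1 (@lebesgue_measure R) mu) (@tcons R m).
pose D := D' (@measurable_tcons m).
have sD : sigma_finite setT D.
  have /sigma_finiteP[F [TF ndF Foo]] := sigma_finiteT (@lebesgue_measure R).
  have /sigma_finiteP[G [TG ndG Goo]] := sigma_finiteT mu.
  pose g (z : m.+1.-tuple R) : R * m.-tuple R := (thead z, [tuple of behead z]).
  have mg : measurable_fun setT g.
    by apply/measurable_fun_pair;
      [exact: measurable_tnth | exact: measurable_behead].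
  have gK : cancel g (@tcons R m).
    by move=> z; rewrite /tcons /g /= -tuple_eta.
  have tK : cancel (@tcons R m) g.
    move=> [a z]; rewrite /g /tcons; congr pair => /=.
    by apply/val_inj.
  exists (fun i => g @^-1` (F i `*` G i)).
    apply/esym; rewrite -subTset => z _.
    have [i _ Fi] : (\bigcup_i F i) (g z).1 by rewrite -TF.
    have [j _ Gj] : (\bigcup_i G i) (g z).2 by rewrite -TG.
    exists (maxn i j) => //; split.
    - by move: Fi; exact/subsetPset/ndF/leq_maxl.
    - by move: Gj; exact/subsetPset/ndG/leq_maxr.
  move=> i; have [mF Fi] := Foo i; have [mG Gi] := Goo i.
  split.
    by rewrite -[X in measurable X]setTI; apply: mg => //; exact: measurableX.
  rewrite /D /= /pushforward -comp_preimage.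
  rewrite (_ : g \o _ = id) ?preimage_id; last exact/funext.
  by rewrite product_measure1E// lte_mul_pinfty// ge0_fin_numE.
pose b := Measure_isSigmaFinite.Build _ _ _ D sD.
pose S : {sigma_finite_measure set (m.+1.-tuple R) -> \bar R} :=
  HB.pack (D : set _ -> _) (Measure.on D) b.
by exists S.
Qed.

Context (m : nat).
Local Notation mu := (@lebesgue_tuple R m).

Let lebesgue_tuple0 : mu set0 = 0%E.
Proof. by have [nu ->] := lebesgue_tuple_ex m; rewrite measure0. Qed.

Let lebesgue_tuple_ge0 A : (0 <= mu A)%E.
Proof. by have [nu ->] := lebesgue_tuple_ex m. Qed.

Let lebesgue_tuple_sigma_additive : semi_sigma_additive mu.
Proof.
by have [nu ->] := lebesgue_tuple_ex m; exact: measure_semi_sigma_additive.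
Qed.

HB.instance Definition _ := isMeasure.Build _ _ _ mu
  lebesgue_tuple0 lebesgue_tuple_ge0 lebesgue_tuple_sigma_additive.

Let lebesgue_tuple_sigma_finite : sigma_finite setT mu.
Proof. by have [nu ->] := lebesgue_tuple_ex m; exact: sigma_finiteT. Qed.

HB.instance Definition _ := Measure_isSigmaFinite.Build _ _ _ mu
  lebesgue_tuple_sigma_finite.

End lebesgue_tuple_measure.

(* A point (x^1, ..., x^n) of R^(n(n+1)/2), x^k in R^k, is listed as
   x^1_1, x^2_1, x^2_2, x^3_1, ...; all indices are 1-based, and a vector of R^k
   is given by a function of which only the values at 1, ..., k matter.
   [pattern n x] is the list and [entry z k i] reads x^k_i in it
   (lemma [entry_pattern]). *)
Definition pattern_seq (T : Type) (n : nat) (x : nat -> nat -> T) : seq T :=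
  [seq x k i | k <- iota 1 n, i <- iota 1 k].

Lemma pattern_seqS (T : Type) n (x : nat -> nat -> T) :
  pattern_seq n.+1 x = pattern_seq n x ++ [seq x n.+1 i | i <- iota 1 n.+1].
Proof.
have E : iota 1 n.+1 = iota 1 n ++ [:: n.+1] by rewrite -(addn1 n) iotaD addnC.
by rewrite /pattern_seq {1}E allpairs_cat /= cats0.
Qed.

Lemma size_pattern_seq (T : Type) n (x : nat -> nat -> T) :
  size (pattern_seq n x) == 'C(n.+1, 2).
Proof.
elim: n => [//|n /eqP IHn].
by rewrite pattern_seqS size_cat IHn size_map size_iota (binS n.+1) bin1.
Qed.

Definition pattern (T : Type) (n : nat) (x : nat -> nat -> T) :
  'C(n.+1, 2).-tuple T := Tuple (size_pattern_seq n x).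

Definition entry (R : realType) (z : seq R) (k i : nat) : R :=
  nth 0 z ('C(k, 2) + i.-1).

Lemma entry_pattern (R : realType) n (x : nat -> nat -> R) k i :
  (1 <= i <= k)%N -> (k <= n)%N -> entry (pattern n x) k i = x k i.
Proof.
rewrite /entry /= => /andP[i1 ik]; elim: n => [|n IHn].
  by rewrite leqn0 => /eqP k0; move: i1; rewrite k0 in ik; case: i ik.
rewrite leq_eqVlt ltnS pattern_seqS nth_cat (eqP (size_pattern_seq _ _)).
have i1k : (i.-1 < k)%N by rewrite prednK.
move=> /orP[/eqP kn|kn].
  rewrite kn in i1k *; rewrite ifF; last by rewrite ltnNge leq_addr.
  by rewrite addKn (nth_map 0%N) ?size_iota// nth_iota// add1n prednK.
rewrite ifT ?IHn//; apply: (@leq_trans 'C(k.+1, 2)).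
  by rewrite binS bin1 ltn_add2l.
by apply: leq_bin2l.
Qed.

Section random_vectors.
Local Open Scope ereal_scope.
Context (R : realType).

(* Mutual independence of the family (X i), i in D. *)
Definition mutually_independent d d' (T : measurableType d)
    (S : measurableType d') (P : probability T R)
    (I : choiceType) (D : set I) (X : I -> {RV P >-> S}) : Prop :=
  forall (s : seq I) (B : I -> set S),
    uniq s -> (forall i, i \in s -> D i) -> (forall i, measurable (B i)) ->
    P (\bigcap_(i in [set` s]) (X i @^-1` B i)) =
    \prod_(i <- s) P (X i @^-1` B i).

(* Tuples carry no topology in the library, row vectors do. *)
Definition row_of_tuple (m : nat) (z : m.-tuple R) : 'rV[R]_m :=
  \row_(i < m) tnth z i.

Definition converges_weakly d d' (T : measurableType d) (T' : measurableType d')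
    (P : probability T R) (Q : probability T' R) (m : nat)
    (Y : nat -> T -> m.-tuple R) (L : T' -> m.-tuple R) : Prop :=
  forall f : 'rV[R]_m -> R,
    continuous f -> (exists M : R, forall v, (`|f v| <= M)%R) ->
    'E_P[fun w => f (row_of_tuple (Y N w))] @[N --> \oo]
      --> 'E_Q[fun w => f (row_of_tuple (L w))].

Definition has_density d (T : measurableType d) (Q : probability T R) (m : nat)
    (L : {RV Q >-> m.-tuple R}) (g : m.-tuple R -> R) : Prop :=
  forall A : set (m.-tuple R), measurable A ->
    distribution Q L A = \int[@lebesgue_tuple R m]_(z in A) (g z)%:E.

End random_vectors.

Section aztec.
Context (R : realType) d (T : measurableType d) (P : probability T R).
Implicit Types (n : nat) (beta : nat -> nat -> nat -> {RV P >-> nat})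
  (X : nat -> nat -> nat -> T -> int).

(* [beta j i t] is beta^j_i(t). *)
Definition iid_fair_bits n beta : Prop :=
  mutually_independent
    [set p : nat * nat * nat | (1 <= p.1.2 <= p.1.1)%N /\ (p.1.1 <= n)%N /\
                               (1 <= p.2)%N]
    (fun p => beta p.1.1 p.1.2 p.2) /\
  forall j i t, (1 <= i <= j)%N -> (j <= n)%N -> (1 <= t)%N ->
    P (beta j i t @^-1` [set 0%N]) = (2^-1)%:E /\
    P (beta j i t @^-1` [set 1%N]) = (2^-1)%:E.

(* [X j i t] is X^j_i(t). *)
Definition aztec_process n beta X : Prop :=
  forall w : T,
  [/\ forall j i, (1 <= i <= j)%N -> (j <= n)%N -> X j i 0%N w = i%:Z,
      forall t, (1 <= n)%N ->
        X 1%N 1%N t.+1 w = X 1%N 1%N t w + (beta 1%N 1%N t.+1 w)%:Z,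
      forall t j, (2 <= j <= n)%N ->
        let y := X j 1%N t w + (beta j 1%N t.+1 w)%:Z in
        X j 1%N t.+1 w = y - (y == X j.-1 1%N t.+1 w + 1)%:R,
      forall t j, (2 <= j <= n)%N ->
        let y := X j j t w + (beta j j t.+1 w)%:Z in
        X j j t.+1 w = y + (y == X j.-1 j.-1 t.+1 w)%:R
    & forall t j i, (3 <= j <= n)%N -> (1 < i < j)%N ->
        let y := X j i t w + (beta j i t.+1 w)%:Z in
        X j i t.+1 w = y - (y == X j.-1 i t.+1 w + 1)%:R
                         + (y == X j.-1 i.-1 t.+1 w)%:R].

Definition rescaled n X (N : nat) (w : T) : 'C(n.+1, 2).-tuple R :=
  pattern n (fun k i =>
    ((X k i N w)%:~R - 2^-1 * N%:R) / (2^-1 * Num.sqrt N%:R)).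

End aztec.

Section limit_density.
Context (R : realType).
Implicit Types (n k : nat) (x y : nat -> R).

Definition Zn n : R :=
  ((2 * pi) `^ (n%:R / 2)) * \prod_(1 <= j < n) (j`!)%:R.

(* extended by 0 outside y_1 < ... < y_n *)
Definition mu1 n y : R :=
  if `[< forall i, (1 <= i < n)%N -> y i < y i.+1 >] then
    (Zn n)^-1 * expR (- \sum_(1 <= i < n.+1) (y i ^+ 2 / 2)) *
    \prod_(1 <= j < n.+1) \prod_(1 <= i < j) (y j - y i) ^+ 2
  else 0.

Definition chi k x y : R :=
  (`[< forall i, (1 <= i <= k)%N -> y i <= x i <= y i.+1 >])%:R.

(* K(y), y in R^n: the point (x^1, ..., x^(n-1)) is w, and x^n = y *)
Definition Kset n y : set ('C(n, 2).-tuple R) :=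
  [set w : 'C(n, 2).-tuple R | let x k := if k == n then y else entry w k in
     forall k i, (1 <= i <= k)%N -> (k < n)%N ->
       x k.+1 i <= x k i <= x k.+1 i.+1].

Definition volK n y : R := fine (@lebesgue_tuple R 'C(n, 2) (@Kset n y)).

Definition limit_density n (z : 'C(n.+1, 2).-tuple R) : R :=
  let x := entry z in
  mu1 n (x n) * ((\prod_(1 <= k < n) chi k (x k) (x k.+1)) / volK n (x n)).

End limit_density.

(* Main.v *)
(* At every time, given its last line, the pattern (X^1, ..., X^n) is uniform
   among the interlacing integer patterns, and the last line follows a
   Krawtchouk ensemble: binomial weights times a squared Vandermonde product.
   Laws of this form are preserved by one step of the dynamics, because summing
   over the bits of one line acts triangularly on Vandermonde determinants.
   After rescaling, the probability of a lattice point divided by the volume of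
   its cell converges to the limit density, by the local limit theorem for
   binomial coefficients, and is dominated by a Gaussian uniformly in N.
   Expectations are thus integrals of step functions, and dominated convergence
   applies.  The constant sqrt(2 pi) comes out of the same argument for a single
   binomial variable, and the total mass 1 of the limit out of the test function
   1; vol(K) is computed line by line by integrating Vandermonde products. *)
Require Import Defs.
From HB Require Import structures.
From mathcomp Require Import all_boot all_order all_algebra.
From mathcomp Require Import all_classical all_reals all_analysis.
From mathcomp Require Import perm measurable_realfun.
From mathcomp Require Import zify ring lra.

Set Implicit Arguments.
Unset Strict Implicit.
Unset Printing Implicit Defensive.

Import Order.TTheory GRing.Theory Num.Theory.
Import numFieldNormedType.Exports.

Local Open Scope classical_set_scope.
Local Open Scope ring_scope.

(** * Vandermonde products *)

(** Within one time step row [k.+1] reads the already moved row [k], so the induction passes through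
    mixed states: rows up to [k] at the new time, rows from [k] on at the old one, with row [k]
    occurring twice. Uniformity survives because of a counting identity. Given its new position,
    each particle of row [k] has two possible old positions, except where the old row [k.+1] leaves
    only one; precisely there a particle of row [k.+1] is blocked or pushed, and both values of its
    bit have the same effect. On admissible configurations the two counts multiply to a constant
    power of 2. To exploit independence, the law at time [t] is stated jointly with an arbitrary
    event on bits not yet read. The weight of a single pattern carries one Vandermonde factor; the
    other one in the law of the last line comes from the number of patterns with that last line.
    Discrete interlacing is strict on one side and the limiting one weak on both; they agree in the
    limit at points with pairwise distinct coordinates, hence almost everywhere. *)

Definition vdm (K : comPzRingType) n (y : nat -> K) : K :=
  \prod_(1 <= j < n.+1) \prod_(1 <= i < j) (y j - y i).

Lemma vdm_ord (K : comPzRingType) n (y : nat -> K) :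
  vdm n y = \prod_(j < n) \prod_(i < j) (y j.+1 - y i.+1).
Proof.
rewrite /vdm big_add1 big_mkord; apply: eq_bigr => j _.
by rewrite big_add1 big_mkord.
Qed.

Lemma vdm_det (K : comPzRingType) n (y : nat -> K) :
  vdm n y = \det (\matrix_(i < n, j < n) y i.+1 ^+ j).
Proof.
rewrite -det_tr.
have -> : (\matrix_(i < n, j < n) y i.+1 ^+ j)^T
    = Vandermonde n (\row_(i < n) y i.+1).
  by apply/matrixP => i j; rewrite !mxE.
rewrite det_Vandermonde vdm_ord (exchange_big_dep xpredT)//=.
apply: eq_bigr => j _.
rewrite (big_ord_widen n (fun i => y j.+1 - y i.+1)); last exact: ltnW.
by apply: eq_bigr => i _; rewrite !mxE.
Qed.

Lemma vdm_coincide (K : comPzRingType) n (y : nat -> K) i j :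
  (1 <= i < j)%N -> (j <= n)%N -> y i = y j -> vdm n y = 0.
Proof.
move=> /andP[i1 ij] jn yij.
rewrite /vdm (bigD1_seq j) ?mem_index_iota ?iota_uniq//=; last first.
  by rewrite (leq_trans _ ij).
rewrite (bigD1_seq i) ?mem_index_iota ?iota_uniq//=; last by rewrite i1.
by rewrite yij subrr !mul0r.
Qed.

Lemma eq_vdm (K : comPzRingType) n (y y' : nat -> K) :
  (forall i, (1 <= i <= n)%N -> y i = y' i) -> vdm n y = vdm n y'.
Proof.
move=> yy; apply: eq_big_nat => j /andP[j1 jn]; apply: eq_big_nat => i /andP[i1 ij].
by rewrite (yy j) ?j1// (yy i)// i1 (leq_trans (ltnW ij)).
Qed.

Lemma vdm_ge0 (K : numDomainType) n (y : nat -> K) :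
  (forall i, (1 <= i < n)%N -> y i <= y i.+1) -> 0 <= vdm n y.
Proof.
move=> yh; rewrite /vdm big_nat_cond; apply: prodr_ge0 => j /andP[/andP[j1 jn] _].
rewrite big_nat_cond; apply: prodr_ge0 => i /andP[/andP[i1 ij] _].
rewrite subr_ge0; elim: j ij {j1} jn => // j IHj; rewrite ltnS leq_eqVlt.
move=> /orP[/eqP<- jn|ij jn]; first by apply: yh; rewrite i1.
rewrite (le_trans (IHj ij _))// ?(ltnW jn)// yh// (leq_trans i1 (ltnW ij))//.
Qed.

Lemma vdm_gt0 (K : numDomainType) n (y : nat -> K) :
  (forall i, (1 <= i < n)%N -> y i < y i.+1) -> 0 < vdm n y.
Proof.
move=> yh; rewrite /vdm big_nat_cond; apply: prodr_gt0 => j /andP[/andP[j1 jn] _].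
rewrite big_nat_cond; apply: prodr_gt0 => i /andP[/andP[i1 ij] _].
rewrite subr_gt0; elim: j ij {j1} jn => // j IHj; rewrite ltnS leq_eqVlt.
move=> /orP[/eqP<- jn|ij jn]; first by apply: yh; rewrite i1.
rewrite (lt_trans (IHj ij _))// ?(ltnW jn)// yh// (leq_trans i1 (ltnW ij))//.
Qed.

(** Subtracting from each row of the Vandermonde matrix of size [n.+1] the preceding one is
    multiplication by a unitriangular matrix. The constant column then vanishes below its first
    entry, and expanding along it leaves the matrix of differences. *)
Lemma det_diff_vdm (K : comPzRingType) n (y : nat -> K) :
  \det (\matrix_(i < n, j < n) (y i.+2 ^+ j.+1 - y i.+1 ^+ j.+1)) = vdm n.+1 y.
Proof.
pose L : 'M[K]_n.+1 := \matrix_(i, j) ((i == j)%:R - (i == j.+1 :> nat)%:R).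
pose V : 'M[K]_n.+1 := \matrix_(i, j) y i.+1 ^+ j.
have dL : \det L = 1.
  rewrite det_trig; last first.
    apply/is_trig_mxP => i j ij; rewrite mxE -val_eqE/= (ltn_eqF ij).
    by rewrite ltn_eqF ?subrr// ltnS ltnW.
  apply: big1 => i _; rewrite mxE eqxx/= ltn_eqF ?subr0//.
rewrite vdm_det -[RHS]mul1r -dL -det_mulmx -/V.
have LV0 j : (L *m V) ord0 j = V ord0 j.
  rewrite mxE (bigD1 ord0)//= big1 ?addr0 => [|i i0].
    by rewrite mxE/= subr0 mul1r.
  by rewrite mxE eq_sym (negbTE i0)/= subr0 mul0r.
have LVS (i : 'I_n) j : (L *m V) (lift ord0 i) j =
    y i.+2 ^+ j - y i.+1 ^+ j.
  rewrite mxE (bigD1 (lift ord0 i))//= (bigD1 (widen_ord (leqnSn n) i))/=; last first.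
    by rewrite -val_eqE/= /bump/= ltn_eqF.
  rewrite big1 ?addr0 => [|k /andP[k1 k2]].
    rewrite !mxE eqxx/= /bump/= add1n eqxx ltn_eqF// subr0 mul1r.
    by rewrite -val_eqE/= /bump/= add1n gtn_eqF// sub0r mulN1r.
  rewrite !mxE eq_sym (negbTE k1)/= /bump/= add1n eqSS eq_sym.
  by move: k2; rewrite -val_eqE/= => /negbTE->; rewrite subr0 mul0r.
rewrite (expand_det_col _ ord0) big_ord_recl LV0 mxE expr0 mul1r.
rewrite big1 ?addr0 => [|i _]; last by rewrite LVS !expr0 subrr mul0r.
rewrite /cofactor expr0 mul1r; congr (\det _); apply/matrixP => i j.
by rewrite mxE [RHS]mxE [RHS]mxE LVS /= /bump/= add1n.
Qed.

Section vandermonde_recursion.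
Context (K : comNzRingType).

(** Multilinearity in the rows: the bit [e i] affects row [i] only, so the sum over bit vectors
    distributes over each term of the Leibniz formula. *)
Lemma det_sum_bits n (w : 'I_n -> bool -> K) (a : 'I_n -> bool -> 'I_n -> K) :
  \sum_(e : {ffun 'I_n -> bool})
    (\prod_(i < n) w i (e i)) * \det (\matrix_(i, j) a i (e i) j) =
  \det (\matrix_(i, j) \sum_(b : bool) w i b * a i b j).
Proof.
rewrite /determinant.
under eq_bigr do rewrite mulr_sumr.
rewrite exchange_big/=; apply: eq_bigr => s _.
under [X in _ = _ * X]eq_bigr do rewrite mxE.
rewrite bigA_distr_bigA mulr_sumr; apply: eq_bigr => e _.
rewrite mulrCA -big_split/=; congr (_ * _); apply: eq_bigr => i _.
by rewrite mxE.
Qed.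

(** Only two coefficients matter: the leading one will cancel, the next one produces an
    eigenvalue. *)
Lemma expXsub1_top j : exists2 r : {poly K}, (size r <= j)%N &
  ('X - 1) ^+ j.+1 = 'X^(j.+1) - j.+1%:R *: 'X^j + r.
Proof.
elim: j => [|j [r rj IH]].
  by exists 0; rewrite ?size_poly0// expr1 addr0 scale1r expr0.
exists (r * 'X + j.+1%:R *: 'X^j - r).
  rewrite (leq_trans (size_polyD _ _))// geq_max size_polyN; apply/andP; split.
    rewrite (leq_trans (size_polyD _ _))// geq_max; apply/andP; split.
      by rewrite (leq_trans (size_polyMleq _ _))// size_polyX addn2/=.
    by rewrite (leq_trans (size_scale_leq _ _))// size_polyXn.
  exact: leqW.
by rewrite exprSr IH -[j.+2%:R]natr1 -!mul_polyC polyCD !exprS; ring.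
Qed.

(* On [y ^ j] the operator below acts triangularly, with eigenvalue
   [s - j.+1]. *)
Lemma vdm_bit_recursion n (s : K) (y : nat -> K) :
  \sum_(e : {ffun 'I_n -> bool})
    (\prod_(i < n) (if e i then y i.+1 - 1 else s - y i.+1)) *
    \det (\matrix_(i < n, j < n) (y i.+1 - (e i)%:R) ^+ j) =
  (\prod_(j < n) (s - j.+1%:R)) * vdm n y.
Proof.
rewrite (det_sum_bits
  (fun i (b : bool) => if b then y i.+1 - 1 else s - y i.+1)
  (fun i b j => (y i.+1 - (b : bool)%:R) ^+ j)).
(* The image of ['X^j] under the sum over one bit. Its terms of degree [j.+1] cancel, so the matrix
   [T] of coefficients is upper triangular with diagonal entries [s - j.+1]. *)
pose p j : {poly K} := ('X - 1) ^+ j.+1 + (s%:P - 'X) * 'X^j.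
have pE j : exists2 r : {poly K}, (size r <= j)%N &
    p j = (s - j.+1%:R) *: 'X^j + r.
  have [r rj E] := expXsub1_top j; exists r => //.
  by rewrite /p E -!mul_polyC polyCB !exprS; ring.
pose T : 'M[K]_n := \matrix_(k, j) (p j)`_k.
have -> : \matrix_(i < n, j < n) \sum_(b : bool)
    (if b then y i.+1 - 1 else s - y i.+1) * (y i.+1 - b%:R) ^+ j =
    (\matrix_(i < n, j < n) y i.+1 ^+ j) *m T.
  apply/matrixP => i j; rewrite !mxE big_bool /= subr0 -exprS.
  have -> : (y i.+1 - 1) ^+ j.+1 + (s - y i.+1) * y i.+1 ^+ j = (p j).[y i.+1].
    by rewrite /p !hornerE.
  rewrite (@horner_coef_wide _ n).
    by apply: eq_bigr => k _; rewrite !mxE mulrC.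
  have [r rj ->] := pE j.
  rewrite (leq_trans (size_polyD _ _))// geq_max (leq_trans rj (ltnW _))// andbT.
  by rewrite (leq_trans (size_scale_leq _ _))// size_polyXn.
rewrite det_mulmx -vdm_det mulrC -[\det T]det_tr det_trig; last first.
  apply/is_trig_mxP => j k jk; rewrite !mxE; have [r rj ->] := pE j.
  rewrite coefD coefZ coefXn gtn_eqF// mulr0 add0r nth_default//.
  exact: leq_trans rj (ltnW jk).
congr (_ * _); apply: eq_bigr => j _; rewrite !mxE.
have [r rj ->] := pE j.
by rewrite coefD coefZ coefXn eqxx mulr1 nth_default ?addr0.
Qed.

End vandermonde_recursion.

(** * Krawtchouk weights and their one-step recursion *)

Section krawtchouk.
Context (R : realFieldType).
Implicit Types (n t M : nat) (y : nat -> int).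

(** Extended by 0 to negative arguments, so that the two absorption identities below hold for every
    integer. *)
Definition binz M (k : int) : R := if 0 <= k then 'C(M, `|k|%N)%:R else 0.

Lemma binz_down M k : binz M k = binz M.+1 k * ((M.+1%:R - k%:~R) / M.+1%:R).
Proof.
rewrite /binz; case: k => [m|m] /=; last by rewrite mul0r.
rewrite mulrA; apply: (canRL (mulfK _)); first by rewrite pnatr_eq0.
rewrite -natrM mulnC (mul_bin_down M.+1 m) natrM mulrC.
have [mM|Mm] := leqP m M.+1; first by rewrite natrB.
by rewrite bin_small// !mul0r.
Qed.

Lemma binz_diag M k : binz M (k - 1) = binz M.+1 k * (k%:~R / M.+1%:R).
Proof.
case: k => [[|m]|m]; rewrite /binz/= ?mulr0 ?mul0r ?mulr0//.
rewrite subn1/=.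
rewrite mulrA; apply: (canRL (mulfK _)); first by rewrite pnatr_eq0.
by rewrite -natrM mulnC (mul_bin_diag M.+1 m) natrM mulrC.
Qed.

(* The probability, at time [t], of each single pattern with [n]-th line [y]. *)
Definition krawt n t y : R :=
  (\prod_(i < n) ((t + n - i.+1)`!%:R / (t + n.-1)`!%:R * 2 ^- t *
                  binz (t + n.-1) (y i.+1 - 1))) *
  vdm n (fun i => (y i)%:~R).

(** Shifts bits, indexed from 0, to the 1-based indexing of rows. *)
Definition ffun_nat n (e : {ffun 'I_n -> bool}) (i : nat) : nat :=
  if insub i.-1 is Some j then e j else 0%N.

Lemma ffun_natE n (e : {ffun 'I_n -> bool}) (i : 'I_n) : ffun_nat e i.+1 = e i.
Proof. by rewrite /ffun_nat/= valK. Qed.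

(** Either value of a bit turns [binz M] into [binz M.+1] at the undisplaced point, times a factor
    affine in [y]: [y - 1] for a move and [M.+2 - y] for a rest. These are the weights of the bit
    recursion with [s = M.+2], and its eigenvalues turn the factorials at time [t] into those at
    time [t.+1]. *)
Lemma krawt_recursion n t y : (1 <= n)%N ->
  2 ^- n * \sum_(e : {ffun 'I_n -> bool})
    krawt n t (fun i => y i - (ffun_nat e i)%:Z) = krawt n t.+1 y.
Proof.
move=> n1; pose M := (t + n.-1)%N; have ME : M.+1 = (t + n)%N by rewrite /M; lia.
pose yR i : R := (y i)%:~R.
pose c (i : 'I_n) : R := (t + n - i.+1)`!%:R / M`!%:R * 2 ^- t *
  (binz M.+1 (y i.+1 - 1) / M.+1%:R).
have E (e : {ffun 'I_n -> bool}) :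
    krawt n t (fun i => y i - (ffun_nat e i)%:Z) =
    (\prod_i c i) * ((\prod_(i < n) (if e i then yR i.+1 - 1 else M.+2%:R - yR i.+1)) *
      \det (\matrix_(i < n, j < n) (yR i.+1 - (e i)%:R) ^+ j)).
  rewrite /krawt vdm_det [RHS]mulrA -[in RHS]big_split/=; congr (_ * _); last first.
    by congr (\det _); apply/matrixP => i j; rewrite !mxE ffun_natE rmorphB.
  apply: eq_bigr => i _; rewrite ffun_natE /c -!mulrA; congr (_ * (_ * (_ * _))).
  case: (e i) => /=.
    rewrite (_ : y i.+1 - 1 - 1 = (y i.+1 - 1) - 1) 1?binz_diag//.
    by rewrite rmorphB/= mulrA -mulrA [_^-1 * _]mulrC.
  rewrite subr0 binz_down -[in RHS](natr1 M.+1) rmorphB/= /yR.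
  by rewrite -/M; congr (_ * _); rewrite mulrC; congr (_ * _); ring.
under eq_bigr do rewrite E.
rewrite -mulr_sumr vdm_bit_recursion !mulrA; congr (_ * _).
have -> : 2 ^- n = \prod_(i < n) (2^-1 : R) by rewrite prodr_const card_ord exprVn.
rewrite -!big_split/=; apply: eq_bigr => i _.
rewrite /c -ME addSn -ME.
have iM : (i <= M)%N by have := ltn_ord i; lia.
rewrite (_ : (t.+1 + n.-1)%N = M.+1)//.
have -> : M.+2%:R - i.+1%:R = (M.+1 - i.+1).+1%:R :> R.
  by rewrite -natrB; [congr _%:R; lia|lia].
rewrite (_ : (M.+2 - i.+1)%N = (M.+1 - i.+1).+1); last by lia.
rewrite !factS !natrM exprS; field.
by rewrite nat1r !pnatr_eq0 -lt0n fact_gt0 expf_neq0// pnatr_eq0.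
Qed.

(** This discards the backward moves that make two neighbours collide. *)
Lemma krawt_coincide n t y i : (1 <= i < n)%N -> y i = y i.+1 -> krawt n t y = 0.
Proof.
move=> /andP[i1 iN] yi; rewrite /krawt (@vdm_coincide _ n _ i i.+1) ?mulr0//.
- by rewrite i1 leqnn.
- by rewrite yi.
Qed.

Lemma krawt_ge0 n t y : (forall i, (1 <= i < n)%N -> y i < y i.+1) ->
  0 <= krawt n t y.
Proof.
move=> yh; rewrite mulr_ge0//; last first.
  by apply: vdm_ge0 => i iN; rewrite ler_int ltW// yh.
apply: prodr_ge0 => i _; rewrite !mulr_ge0// ?invr_ge0 ?exprn_ge0//.
by rewrite /binz; case: ifP.
Qed.

(** At time 0 the coefficients ['C(n.-1, y i - 1)] confine [n] strictly increasing integers to 1,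
    ..., n, so only the packed configuration has a nonzero weight; there the factorials cancel. *)
Lemma krawt0 n y : (1 <= n)%N -> (forall i, (1 <= i < n)%N -> y i < y i.+1) ->
  krawt n 0 y = `[< forall i, (1 <= i <= n)%N -> y i = i%:Z >]%:R.
Proof.
move=> n1 yh; case: asboolP => [yE|yE]; last first.
  have [i [iN yi]] : exists i, (1 <= i <= n)%N /\ ~ (1 <= y i <= n%:Z).
    apply: contrapT => h; apply: yE.
    have yb i : (1 <= i <= n)%N -> 1 <= y i <= n%:Z.
      by move=> iN; apply: contrapT => ?; apply: h; exists i.
    have lo i : (1 <= i <= n)%N -> i%:Z <= y i.
      elim: i => // i IHi iN; case: i => [|i] in IHi iN *.
        by have /andP[] := yb 1%N iN.
      by have := yh i.+1; have := IHi; lia.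
    have hi k : (k < n)%N -> y (n - k)%N <= (n - k)%N%:Z.
      elim: k => [|k IHk] kn; first by rewrite subn0; have := yb n; lia.
      have := IHk (ltnW kn); have := yh (n - k.+1)%N.
      by rewrite (_ : (n - k.+1).+1 = (n - k)%N); lia.
    move=> i iN; apply/eqP; rewrite eq_le lo// andbT.
    have := hi (n - i)%N; rewrite subKn; last by lia.
    by apply; lia.
  have i1n : (i.-1 < n)%N by lia.
  rewrite /krawt (bigD1 (Ordinal i1n))//= prednK; last by lia.
  rewrite add0n (_ : binz _ _ = 0) ?mulr0 ?mul0r//.
  rewrite /binz; case: ifPn => // y1; rewrite bin_small//; lia.
rewrite /krawt vdm_ord -big_split/=.
apply: big1 => i _; have := ltn_ord i => iN.
rewrite !add0n expr0 invr1 mulr1 yE; last by rewrite iN.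
rewrite /binz (_ : i.+1%:Z - 1 = i) ?absz_nat; last by lia.
rewrite (_ : \prod_(i0 < i) _ = i`!%:R).
  have F0 : n.-1`!%:R != 0 :> R by rewrite pnatr_eq0 -lt0n fact_gt0.
  rewrite le0z_nat mulrAC -mulrA mulrAC; apply: (canLR (mulfK F0)).
  rewrite mul1r -!natrM; congr _%:R.
  rewrite -(@bin_fact n.-1 i); last by lia.
  by rewrite (_ : (n - i.+1 = n.-1 - i)%N); lia.
rewrite fact_prod natr_prod big_add1 big_mkord (reindex_inj rev_ord_inj)/=.
apply: eq_bigr => j _; have := ltn_ord j => ji.
rewrite yE; last by lia.
rewrite -rmorphB/= (_ : i.+1%:Z - (i - j.+1).+1%:Z = j.+1%:Z)//.
lia.
Qed.

End krawtchouk.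

(** * The dynamics of one particle *)

(** All four rules in one, with [y] the already moved row [j.-1]: the guards [i < j] and [1 < i]
    switch off blocking for the last particle of a row and pushing for the first. *)
Definition upd (j i : nat) (p : int) (y : nat -> int) (b : nat) : int :=
  let z := p + b%:Z in
  z - ((i < j)%N && (z == y i + 1))%:R + ((1 < i)%N && (z == y i.-1))%:R.

Lemma eq_upd j i p (y y' : nat -> int) b :
  ((i < j)%N -> y i = y' i) -> ((1 < i)%N -> y i.-1 = y' i.-1) ->
  upd j i p y b = upd j i p y' b.
Proof.
rewrite /upd; case: (ltnP i j) => [_ /(_ isT) ->|_ _];
  by case: (ltnP 1 i) => [_ /(_ isT) ->|].
Qed.

(** The half-strict interlacing kept by the dynamics; in the packed initial pattern it reads
    [i <= i < i.+1]. *)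
Definition gt_rel k (a b : nat -> int) : Prop :=
  forall i, (1 <= i <= k)%N -> b i <= a i < b i.+1.

Definition increasing_upto k (a : nat -> int) : Prop :=
  forall i, (1 <= i < k)%N -> a i < a i.+1.

Lemma gt_rel_increasing_above k a b : gt_rel k a b -> increasing_upto k.+1 b.
Proof. by move=> ab i ik; have := ab i; lia. Qed.

Lemma gt_rel_increasing_below k a b : gt_rel k a b -> increasing_upto k a.
Proof. by move=> ab i ik; have := ab i; have := ab i.+1; lia. Qed.

(** The bounds assumed on [p] are what remains of the old interlacing after row [y] has moved by at
    most 1, hence both are weak; pushing restores the strict one. *)
Lemma updP j i (p : nat -> int) (y : nat -> int) (b : nat) :
  (1 <= i <= j)%N -> (b <= 1)%N -> increasing_upto j.-1 y ->
  ((i < j)%N -> p i <= y i) -> ((1 < i)%N -> y i.-1 <= p i) ->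
  let x := upd j i (p i) y b in
  [/\ p i <= x <= p i + 1, (i < j)%N -> x <= y i & (1 < i)%N -> y i.-1 < x].
Proof.
move=> ij b1 yh pr pl; rewrite /upd /=; have := yh i.-1.
case: (p i + b%:Z =P y i + 1) => h1; case: (p i + b%:Z =P y i.-1) => h2;
  case: (ltnP i j) => ilj; case: (ltnP 1 i) => i1; rewrite ?prednK /=;
  try (by lia); by move=> h3; split; lia.
Qed.

(** * Counting old positions and bits *)

Section update_count.
Context (K : realFieldType).

Lemma gt_relE k (a b : nat -> int) :
  `[< gt_rel k a b >]%:R = \prod_(i < k) (b i.+1 <= a i.+1 < b i.+2)%R%:R :> K.
Proof.
case: asboolP => [ab|ab].
  by rewrite big1// => i _; rewrite ab//= ltn_ord.
have [i [ik abi]] : exists i, (1 <= i <= k)%N /\ ~~ (b i <= a i < b i.+1).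
  apply: contrapT => h; apply: ab => i ik; apply: contrapT => /negP abi.
  by apply: h; exists i.
have i1k : (i.-1 < k)%N by lia.
rewrite (bigD1 (Ordinal i1k))//= prednK; last by lia.
by rewrite (negbTE abi) mul0r.
Qed.

(** Correction at a coincidence of positions. The same corrections appear in the two counts below,
    on opposite sides. *)
Let half (b : bool) : K := if b then 2^-1 else 1.

(** Strictly between [p] and [q] both bits are possible, at either end only one; since [p < q] the
    two ends do not interfere. *)
Lemma interlace_choices (p q y : int) : p < q ->
  \sum_(b : bool) (p <= y - b%:Z < q)%R%:R =
  2 * (p <= y <= q)%R%:R * half (y == p) * half (y == q) :> K.
Proof.
move=> pq; rewrite big_bool /= subr0 /half.
have [->|yp] := eqVneq y p.
  rewrite (_ : p <= p - 1 < q = false); last by lia.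
  rewrite (_ : p <= p < q = true); last by lia.
  rewrite (_ : p <= p <= q = true); last by lia.
  by rewrite (lt_eqF pq) /=; field.
have [->|yq] := eqVneq y q.
  rewrite (_ : p <= q - 1 < q = true); last by lia.
  rewrite (_ : p <= q < q = false); last by lia.
  rewrite (_ : p <= q <= q = true); last by lia.
  by rewrite /=; field.
have [py|py] := boolP (p <= y <= q).
  rewrite (_ : p <= y - 1 < q = true); last by lia.
  rewrite (_ : p <= y < q = true); last by lia.
  by rewrite /=; ring.
rewrite (_ : p <= y - 1 < q = false); last by lia.
rewrite (_ : p <= y < q = false); last by lia.
by rewrite /=; ring.
Qed.

(** At its right barrier [y i] the particle is blocked, at its left barrier [y i.-1] it is pushed.
    In both cases the two bits give the same [x], which is counted twice and halved. The barriers
    differ because [y] increases. Elsewhere [p] and [p + 1] are reached by one bit each. *)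
Lemma upd_choices j i (p : int) (x : int) (y : nat -> int) :
  (1 <= i <= j)%N -> increasing_upto j.-1 y ->
  ((i < j)%N -> p <= y i) -> ((1 < i)%N -> y i.-1 <= p) ->
  (\sum_(b : bool) (x == upd j i p y b)%:R) *
    half ((i < j)%N && (y i == p)) * half ((1 < i)%N && (y i.-1 == p)) =
  [&& (p <= x <= p + 1), (i < j)%N ==> (x <= y i) & (1 < i)%N ==> (y i.-1 < x)]%:R :> K.
Proof.
move=> ij yh pr pl; rewrite big_bool/= /half.
have yi : (1 < i)%N -> (i < j)%N -> y i.-1 < y i.
  by move=> i1 ilj; have := yh i.-1; rewrite prednK; lia.
have xp : ((x == p) && (x == p + 1)) = false by lia.
have [/andP[ilj /eqP yp]|h1] := boolP ((i < j)%N && (y i == p)).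
  have u0 : upd j i p y 0 = p.
    rewrite /upd ilj/= addr0 yp; have -> : (p == p + 1) = false by lia.
    case: (ltnP 1 i) => i1/=; last by rewrite subr0 addr0.
    have -> : (p == y i.-1) = false by have := yi i1 ilj; lia.
    by rewrite subr0 addr0.
  have u1 : upd j i p y 1 = p.
    rewrite /upd ilj/= yp eqxx; case: (ltnP 1 i) => i1/=; last by lia.
    have -> : (p + 1 == y i.-1) = false by have := pl i1; lia.
    by lia.
  rewrite u0 u1 ilj/=.
  have -> : ((1 < i)%N && (y i.-1 == p)) = false.
    by case: (ltnP 1 i) => i1//=; have := yi i1 ilj; lia.
  have [->|xnp] := eqVneq x p.
    have -> : [&& p <= p <= p + 1, p <= y i & (1 < i)%N ==> (y i.-1 < p)] = true.
      by case: (ltnP 1 i) => i1/=; [have := yi i1 ilj|]; lia.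
    by rewrite /=; field.
  have -> : [&& p <= x <= p + 1, x <= y i & (1 < i)%N ==> (y i.-1 < x)] = false.
    by lia.
  by rewrite /=; ring.
have [/andP[i1 /eqP yp]|h2] := boolP ((1 < i)%N && (y i.-1 == p)).
  have u0 : upd j i p y 0 = p + 1.
    rewrite /upd i1/= addr0 yp eqxx; case: (ltnP i j) => ilj/=; last by lia.
    have -> : (p == y i + 1) = false by have := yi i1 ilj; lia.
    by lia.
  have u1 : upd j i p y 1 = p + 1.
    rewrite /upd i1/= yp; have -> : (p + 1 == p) = false by lia.
    case: (ltnP i j) => ilj/=; last by lia.
    have -> : (p + 1 == y i + 1) = false by have := yi i1 ilj; lia.
    by lia.
  rewrite u0 u1 i1/=.
  have [->|xnp] := eqVneq x (p + 1).
    have -> : [&& p <= p + 1 <= p + 1, (i < j)%N ==> (p + 1 <= y i) & y i.-1 < p + 1] = true.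
      by case: (ltnP i j) => ilj/=; [have := yi i1 ilj|]; lia.
    by rewrite /=; field.
  have -> : [&& p <= x <= p + 1, (i < j)%N ==> (x <= y i) & y i.-1 < x] = false.
    by case: (ltnP i j) => ilj/=; lia.
  by rewrite /=; ring.
have u0 : upd j i p y 0 = p.
  rewrite /upd addr0; have -> : ((i < j)%N && (p == y i + 1)) = false.
    by case: (ltnP i j) => ilj//=; have := pr ilj; lia.
  rewrite (_ : ((1 < i)%N && (p == y i.-1)) = false) ?subr0 ?addr0//.
  by rewrite [p == _]eq_sym (negbTE h2).
have u1 : upd j i p y 1 = p + 1.
  rewrite /upd; have -> : ((i < j)%N && (p + 1 == y i + 1)) = false.
    by rewrite (inj_eq (addIr _)) eq_sym (negbTE h1).
  rewrite (_ : ((1 < i)%N && (p + 1 == y i.-1)) = false) ?subr0 ?addr0//.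
  by case: (ltnP 1 i) => i1//=; have := pl i1; lia.
rewrite u0 u1 !mulr1.
have [->|xnp] := eqVneq x p.
  have -> : [&& p <= p <= p + 1, (i < j)%N ==> (p <= y i) & (1 < i)%N ==> (y i.-1 < p)] = true.
    case: (ltnP i j) h1 pr => /= ilj h1 pr; case: (ltnP 1 i) h2 pl => /= i1 h2 pl; lia.
  have -> : (p == p + 1) = false by lia.
  by rewrite /=; ring.
have [->|xnp1] := eqVneq x (p + 1).
  have -> : [&& p <= p + 1 <= p + 1, (i < j)%N ==> (p + 1 <= y i) & (1 < i)%N ==> (y i.-1 < p + 1)] = true.
    case: (ltnP i j) h1 pr => /= ilj h1 pr; case: (ltnP 1 i) h2 pl => /= i1 h2 pl; lia.
  by rewrite /=; ring.
have -> : (p <= x <= p + 1) = false by lia.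
by rewrite /= addr0.
Qed.

Lemma asbool_forall_ord m (Q : 'I_m -> bool) :
  [forall i, Q i]%:R = \prod_(i < m) (Q i)%:R :> K.
Proof.
case: forallP => [h|h]; first by rewrite big1// => i _; rewrite h.
have /forallPn[i Qi] : ~~ [forall i, Q i] by apply/forallP.
by rewrite (bigD1 i)//= (negbTE Qi) mul0r.
Qed.

(** Here [p] and [x] are the old and the new row of length [k.+1], and [y] is the new row of length
    [k]. The first sum counts the old positions of the shorter row, the second the bits of the
    longer one. Neither is constant, but the halves at [y i = p i] and [y i = p i.+1] enter the
    first sum and compensate the doublings in the second. *)
Lemma upd_count k (p y x : nat -> int) :
  increasing_upto k.+1 p -> increasing_upto k y ->
  (\sum_(e : {ffun 'I_k -> bool})
     `[< gt_rel k (fun i => y i - (ffun_nat e i)%:Z) p >]%:R) *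
  (\sum_(c : {ffun 'I_k.+1 -> bool})
     [forall i : 'I_k.+1, x i.+1 == upd k.+1 i.+1 (p i.+1) y (c i)]%:R) =
  2 ^+ k * (`[< gt_rel k y x >]%:R *
            [forall i : 'I_k.+1, p i.+1 <= x i.+1 <= p i.+1 + 1]%:R) :> K.
Proof.
move=> ph yh.
under eq_bigr do rewrite gt_relE.
under [X in _ * X = _]eq_bigr do rewrite asbool_forall_ord.
have -> : \sum_(e : {ffun 'I_k -> bool})
      \prod_(i < k) (p i.+1 <= y i.+1 - (ffun_nat e i.+1)%:Z < p i.+2)%R%:R
    = \prod_(i < k) \sum_(b : bool) (p i.+1 <= y i.+1 - b%:Z < p i.+2)%R%:R :> K.
  rewrite bigA_distr_bigA; apply: eq_bigr => e _; apply: eq_bigr => i _.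
  by rewrite ffun_natE.
rewrite -(bigA_distr_bigA (fun (i : 'I_k.+1) (b : bool) =>
  (x i.+1 == upd k.+1 i.+1 (p i.+1) y b)%:R)).
have -> : \prod_(i < k) \sum_(b : bool) (p i.+1 <= y i.+1 - b%:Z < p i.+2)%R%:R
    = \prod_(i < k) (2 * (p i.+1 <= y i.+1 <= p i.+2)%R%:R *
        half (y i.+1 == p i.+1) * half (y i.+1 == p i.+2)).
  apply: eq_bigr => i _; apply: interlace_choices.
  by apply: ph; rewrite /= ltnS ltn_ord.
(* If [y] does not weakly interlace with [p], the first sum vanishes; so does the right side,
   because [x] would interlace with [y] while staying within 1 above [p]. *)
have [pyp|pyp] := boolP [forall i : 'I_k, p i.+1 <= y i.+1 <= p i.+2]; last first.
  have /forallPn[i pyi] := pyp.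
  rewrite (bigD1 i)//= (negbTE pyi) mulr0 !mul0r.
  rewrite gt_relE asbool_forall_ord (bigD1 i)//=.
  rewrite (bigD1 (widen_ord (leqnSn k) i))//= (bigD1 (lift ord0 i)) /=; last first.
    by rewrite -val_eqE/= /bump/= gtn_eqF.
  rewrite /bump/= add1n.
  move: pyi; case: (x i.+1 <= y i.+1 < x i.+2) / boolP => h1; last by rewrite !(mul0r, mulr0).
  case: (p i.+1 <= x i.+1 <= p i.+1 + 1) / boolP => h2; last by rewrite !(mul0r, mulr0).
  case: (p i.+2 <= x i.+2 <= p i.+2 + 1) / boolP => h3; last by rewrite !(mul0r, mulr0).
  by lia.
have pyb (i : 'I_k.+1) : (i.+1 < k.+1)%N -> p i.+1 <= y i.+1 <= p i.+2.
  by rewrite ltnS => ik; exact: (forallP pyp (Ordinal ik)).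
have pyb' (i : 'I_k.+1) : (1 < i.+1)%N -> p i <= y i <= p i.+1.
  rewrite ltnS => i0; have ik : (i.-1 < k)%N by have := ltn_ord i; lia.
  by have := forallP pyp (Ordinal ik); rewrite /= prednK.
have main : \prod_(i < k.+1) (\sum_(b : bool) (x i.+1 == upd k.+1 i.+1 (p i.+1) y b)%:R) *
   (\prod_(i < k.+1) half ((i.+1 < k.+1)%N && (y i.+1 == p i.+1))) *
   (\prod_(i < k.+1) half ((1 < i.+1)%N && (y i == p i.+1))) =
   `[< gt_rel k y x >]%:R * [forall i : 'I_k.+1, p i.+1 <= x i.+1 <= p i.+1 + 1]%:R.
  rewrite -!big_split/=.
  have U (i : 'I_k.+1) := @upd_choices k.+1 i.+1 (p i.+1) (x i.+1) y (ltn_ord i) yh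
    (fun h => proj1 (andP (pyb i h))) (fun h => proj2 (andP (pyb' i h))).
  rewrite (eq_bigr _ (fun i _ => U i)).
  rewrite gt_relE -!asbool_forall_ord -natrM mulnb; congr (_%:R); congr nat_of_bool.
  apply/forallP/andP => [h|[/forallP h1 /forallP h2] i].
    split; apply/forallP => i; last by have /and3P[] := h i.
    have /and3P[_ + _] := h (widen_ord (leqnSn k) i).
    have /and3P[_ _] := h (lift ord0 i).
    by rewrite /= /bump/= add1n ltnS ltn_ord/= => -> ->.
  rewrite h2/=; apply/andP; split; apply/implyP => hi.
    by have /andP[] := h1 (Ordinal (hi : (i < k)%N)).
  have ik : (i.-1 < k)%N by have := ltn_ord i; lia.
  by have /andP[] := h1 (Ordinal ik); rewrite /= prednK; lia.
(* The halves are indexed by the particles of the longer row; its last particle has no right barrier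
   and its first no left one. *)
have e1 : \prod_(i < k.+1) half ((i.+1 < k.+1)%N && (y i.+1 == p i.+1)) =
    \prod_(i < k) half (y i.+1 == p i.+1).
  rewrite big_ord_recr/= ltnn mulr1; apply: eq_bigr => i _.
  by rewrite ltnS ltn_ord.
have e2 : \prod_(i < k.+1) half ((1 < i.+1)%N && (y i == p i.+1)) =
    \prod_(i < k) half (y i.+1 == p i.+2).
  by rewrite big_ord_recl/= mul1r; apply: eq_bigr.
rewrite -main e1 e2 !big_split/= prodr_const card_ord.
rewrite (_ : \prod_(i < k) (p i.+1 <= y i.+1 <= p i.+2)%R%:R = 1); last first.
  by apply: big1 => i _; rewrite (forallP pyp).
ring.
Qed.

End update_count.

(** * Interlacing along the dynamics *)

Section aztec_invariants.
Context (R : realType) d (T : measurableType d) (P : probability T R).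
Context (n : nat) (beta : nat -> nat -> nat -> {RV P >-> nat})
  (X : nat -> nat -> nat -> T -> int).
Hypothesis process : aztec_process n beta X.

Lemma aztec_upd w j i t : (1 <= i <= j)%N -> (j <= n)%N ->
  X j i t.+1 w =
  upd j i (X j i t w) (fun l => X j.-1 l t.+1 w) (beta j i t.+1 w).
Proof.
move=> ij jn; have [_ h1 h2 h3 h4] := process w; rewrite /upd.
have [i1|i1] := leqP i 1.
  have i_1 : i = 1%N by lia.
  subst i; have [j1|j1] := leqP j 1.
    have j_1 : j = 1%N by lia.
    by subst j; rewrite h1//= subr0 addr0.
  by rewrite h2 ?j1//= addr0.
have [jlei|ilj] := leqP j i.
  have i_j : i = j by lia.
  by subst i; rewrite h3 ?i1//= subr0.
by rewrite h4 ?i1//; lia.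
Qed.

(** The bits have values in [nat] and are at most 1 only almost surely; pathwise statements are made
    on this event. *)
Definition bits_ok w := forall j i t, (1 <= i <= j)%N -> (j <= n)%N ->
  (1 <= t)%N -> (beta j i t w <= 1)%N.

Let row j t w := X j ^~ t ^~ w.

(** Induction on time and, inside, on the row: once row [j] is known to move by at most 1, its old
    interlacing with row [j.+1] yields the weak bounds under which [updP] controls row [j.+1]. *)
Lemma aztec_invariants w : bits_ok w -> forall t,
  (forall k, (1 <= k < n)%N -> gt_rel k (row k t w) (row k.+1 t w)) /\
  (forall j i, (1 <= i <= j)%N -> (j <= n)%N ->
     X j i t w <= X j i t.+1 w <= X j i t w + 1).
Proof.
move=> ok.
have step t : (forall k, (1 <= k < n)%N -> gt_rel k (row k t w) (row k.+1 t w)) ->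
  forall j, (j <= n)%N -> [/\ forall i, (1 <= i <= j)%N ->
      X j i t w <= X j i t.+1 w <= X j i t w + 1,
    increasing_upto j (row j t.+1 w) &
    (1 < j)%N -> gt_rel j.-1 (row j.-1 t.+1 w) (row j t.+1 w)].
  move=> gt; elim=> [_|j IHj jn]; first by split => // i; lia.
  have [st inc _] := IHj (ltnW jn).
  have U i : (1 <= i <= j.+1)%N -> [/\ X j.+1 i t w <= X j.+1 i t.+1 w <= X j.+1 i t w + 1,
      (i < j.+1)%N -> X j.+1 i t.+1 w <= X j i t.+1 w &
      (1 < i)%N -> X j i.-1 t.+1 w < X j.+1 i t.+1 w].
    move=> ij; rewrite (aztec_upd w t ij)//.
    apply: (updP (p := fun i => X j.+1 i t w)) => //.
    - exact: ok.
    - move=> ilj; have ij' : (1 <= i <= j)%N by lia.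
      have jn' : (1 <= j < n)%N by lia.
      by have := gt j jn' i ij'; have := st i ij'; rewrite /row/=; lia.
    - move=> i1; have ij' : (1 <= i.-1 <= j)%N by lia.
      have jn' : (1 <= j < n)%N by lia.
      have := gt j jn' i.-1 ij'; have := st i.-1 ij'; rewrite /row/= prednK; last by lia.
      by lia.
  have g : gt_rel j (row j t.+1 w) (row j.+1 t.+1 w).
    move=> i ij; have i1 : (1 <= i <= j.+1)%N by lia.
    have i2 : (1 <= i.+1 <= j.+1)%N by lia.
    have [_ h1 _] := U i i1; have [_ _ h2] := U i.+1 i2.
    by rewrite /row h1 ?h2//; lia.
  split => //; first by move=> i ij; have [] := U i ij.
  exact: gt_rel_increasing_above g.
have gt t : forall k, (1 <= k < n)%N -> gt_rel k (row k t w) (row k.+1 t w).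
  elim: t => [|t IHt] k kn.
    have [h0 _ _ _ _] := process w; move=> i ik.
    by rewrite /row !h0; lia.
  have /andP[k1 kn'] := kn.
  by have [_ _] := step t IHt k.+1 kn'; apply; rewrite ltnS.
move=> t; split; first exact: gt.
by move=> j i ij jn; have [+ _ _] := step t (gt t) j jn; apply.
Qed.

Lemma aztec_bounds w : bits_ok w -> forall t j i,
  (1 <= i <= j)%N -> (j <= n)%N -> i%:Z <= X j i t w <= (i + t)%:Z.
Proof.
move=> ok; elim=> [|t IHt] j i ij jn.
  by have [-> // _ _ _ _] := process w; lia.
have [_ /(_ j i ij jn)] := aztec_invariants ok t.
by have := IHt j i ij jn; lia.
Qed.

End aztec_invariants.

(** * The law of the process at a fixed time *)

Section discrete_variables.
Context d (T : measurableType d).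

(** For a variable with countably many values, measurable fibres suffice and no sigma-algebra on the
    target has to be chosen. *)
Definition discrete_measurable (U : Type) (Z : T -> U) :=
  forall u, measurable (Z @^-1` [set u]).

Lemma discrete_preimage (U : countType) (Z : T -> U) (A : set U) :
  discrete_measurable Z -> measurable (Z @^-1` A).
Proof.
move=> mZ; pose F k := if @unpickle U k is Some u then
  (if `[< A u >] then Z @^-1` [set u] else set0) else set0.
rewrite (_ : Z @^-1` A = \bigcup_k F k).
  apply: bigcupT_measurable => k; rewrite /F; case: unpickle => [u|//].
  by case: asboolP => // _; exact: mZ.
apply/seteqP; split=> [w Aw|w [k _]].
  by exists (pickle (Z w)) => //; rewrite /F pickleK asboolT.
by rewrite /F; case: unpickle => [u|//]; case: asboolP => // Au /= ->.
Qed.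

Lemma discrete_comp (U V : countType) (g : U -> V) (Z : T -> U) :
  discrete_measurable Z -> discrete_measurable (g \o Z).
Proof. by move=> mZ v; rewrite comp_preimage; exact: discrete_preimage. Qed.

Lemma discrete_pair (U V : Type) (Z : T -> U) (W : T -> V) :
  discrete_measurable Z -> discrete_measurable W ->
  discrete_measurable (fun w => (Z w, W w)).
Proof.
move=> mZ mW [u v].
rewrite (_ : _ @^-1` _ = Z @^-1` [set u] `&` W @^-1` [set v]).
  exact: measurableI.
by apply/seteqP; split => w /=; [case=> -> ->|case=> -> ->].
Qed.

Lemma discrete_comp2 (U V W : countType) (g : U -> V -> W) (Z : T -> U) (Y : T -> V) :
  discrete_measurable Z -> discrete_measurable Y ->
  discrete_measurable (fun w => g (Z w) (Y w)).
Proof.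
move=> mZ mY; exact: (discrete_comp (fun q => g q.1 q.2) (discrete_pair mZ mY)).
Qed.

Lemma discrete_cst (U : Type) (u : U) : discrete_measurable (fun=> u).
Proof.
move=> v; have [->|uv] := pselect (u = v).
  by rewrite (_ : _ @^-1` _ = setT)//; apply/seteqP; split.
by rewrite (_ : _ @^-1` _ = set0)//; apply/seteqP; split.
Qed.

Lemma discrete_map (I : eqType) (U : countType) (Z : I -> T -> U) (s : seq I) :
  (forall i, i \in s -> discrete_measurable (Z i)) ->
  discrete_measurable (fun w => [seq Z i w | i <- s]).
Proof.
elim: s => [|i s IHs] mZ; first exact: discrete_cst.
apply: (@discrete_comp2 _ _ _ cons); first by apply: mZ; rewrite mem_head.
by apply: IHs => j js; apply: mZ; rewrite inE js orbT.
Qed.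

Context (R : realType) (P : probability T R).

(** The pieces cover [A] only almost surely, as bits are 0 or 1 only almost surely. *)
Lemma probability_split (I : finType) (D : I -> set T) (A : set T) :
  measurable A -> (forall i, measurable (D i)) ->
  (forall i j w, D i w -> D j w -> i = j) ->
  {ae P, forall w, A w -> exists i, D i w} ->
  P A = (\sum_i P (A `&` D i))%E.
Proof.
move=> mA mD disj [N [mN PN0 sub]].
have mB : measurable (\bigcup_(i in [set` index_enum I]) D i).
  by apply: fin_bigcup_measurable => // i _; exact: mD.
rewrite (measureDI P mA mB)//.
rewrite [X in (X + _)%E](_ : _ = 0%E); last first.
  apply/eqP; rewrite eq_le measure_ge0 andbT -PN0; apply: le_measure.
  - by rewrite inE; exact: measurableD.
  - by rewrite inE.
  - move=> w [Aw nD]; apply: sub => h; apply: nD; have [i Di] := h Aw.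
    by exists i => //=; exact: mem_index_enum.
rewrite add0e setI_bigcupr measure_fin_bigcup//; last 2 first.
- by move=> i j _ _ [w [[_ Di] [_ Dj]]]; exact: disj Di Dj.
- by move=> i _; exact: measurableI.
by rewrite -fsbig_seq// index_enum_uniq.
Qed.

End discrete_variables.

(** * One sweep of the dynamics and the law at a fixed time *)

Section aztec_law.
Context (R : realType) d (T : measurableType d) (P : probability T R).
Context (n : nat) (beta : nat -> nat -> nat -> {RV P >-> nat})
  (X : nat -> nat -> nat -> T -> int).
Hypothesis n1 : (1 <= n)%N.
Hypothesis iid : iid_fair_bits n beta.
Hypothesis process : aztec_process n beta X.

Lemma discrete_beta j i t : discrete_measurable (beta j i t : T -> nat).
Proof.
by move=> k; rewrite -[X in measurable X]setTI; exact: measurable_funP.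
Qed.

Lemma discrete_X t j i : (1 <= i <= j)%N -> (j <= n)%N ->
  discrete_measurable (X j i t).
Proof.
elim: t j i => [|t IHt]; elim=> [|j IHj] i ij jn; try by lia.
  rewrite (_ : X _ _ _ = fun=> i%:Z); first exact: discrete_cst.
  by apply/funext => w; have [-> //] := process w.
(* The two barriers, from the row moved just before. The guards of the update repeat these tests, so
   the default 0 is never read. *)
pose l w := if (1 < i)%N then X j i.-1 t.+1 w else 0.
pose r w := if (i < j.+1)%N then X j i t.+1 w else 0.
have ml : discrete_measurable l.
  rewrite /l; case: (ltnP 1 i) => i1; last exact: discrete_cst.
  by apply: IHj; lia.
have mr : discrete_measurable r.
  rewrite /r; case: (ltnP i j.+1) => i1; last exact: discrete_cst.
  by apply: IHj; lia.
pose z w := X j.+1 i t w + (beta j.+1 i t.+1 w)%:Z.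
have mz : discrete_measurable z.
  exact: (discrete_comp2 (fun x b => x + b%:Z) (IHt _ _ ij jn) (discrete_beta _ _ _)).
rewrite (_ : X _ _ _ = fun w => z w - ((i < j.+1)%N && (z w == r w + 1))%:R +
    ((1 < i)%N && (z w == l w))%:R).
  exact: (discrete_comp2 (fun x y : int * int => x.1 - ((i < j.+1)%N && (x.1 == x.2 + 1))%:R +
    ((1 < i)%N && (y.1 == y.2))%:R) (discrete_pair mz mr) (discrete_pair mz ml)).
apply/funext => w; rewrite (aztec_upd process w t ij jn) /upd /l /r /z /=.
by case: (1 < i)%N; case: (i < j.+1)%N.
Qed.

(** A triple is (row, particle, time); the listed bits are prescribed, all others are free. *)
Definition cylinder (s : seq (nat * nat * nat)) (b : nat * nat * nat -> bool) :
    set T :=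
  \bigcap_(q in [set` s]) (beta q.1.1 q.1.2 q.2 @^-1` [set (b q : nat)]).

Let valid (q : nat * nat * nat) := [&& (1 <= q.1.2 <= q.1.1)%N,
  (q.1.1 <= n)%N & (1 <= q.2)%N].

Lemma measurable_cylinder s b : measurable (cylinder s b).
Proof.
apply: fin_bigcap_measurable => // q _; exact: discrete_beta.
Qed.

Lemma probability_cylinder s b : uniq s -> {in s, forall q, valid q} ->
  P (cylinder s b) = (2 ^- size s)%:E.
Proof.
move=> us vs; have [indep fair] := iid.
have /= -> := indep s (fun q => [set (b q : nat)]) us.
- rewrite (eq_big_seq (fun=> (2^-1 : R)%:E)) => [|q /vs /and3P[ij jn t1]].
    by rewrite prodEFin big_const_seq count_predT iter_mulr_1 exprVn.
  by have [p0 p1] := fair q.1.1 q.1.2 q.2 ij jn t1; case: (b q).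
- by move=> q /vs /and3P[ij jn t1]; split => //; split.
- by [].
Qed.

Lemma ae_bits_ok : {ae P, forall w, bits_ok n beta w}.
Proof.
apply/ae_foralln => j; apply/ae_foralln => i; apply/ae_foralln => t.
have [v|v] := boolP (valid (j, i, t)); last first.
  by apply: aeW => w /= ij jn t1; rewrite /valid/= ij jn t1 in v.
have /and3P[/= ij jn t1] := v; have [_ fair] := iid.
have [p0 p1] := fair j i t ij jn t1.
have mb k : measurable (beta j i t @^-1` [set k]) := discrete_beta j i t k.
pose B := beta j i t @^-1` [set 0%N] `|` beta j i t @^-1` [set 1%N].
have mB : measurable B by exact: measurableU.
have PB : P B = 1%E.
  rewrite measureU//; last first.
    by apply/seteqP; split => // w [/= -> ].
  have h2 : 2^-1 + 2^-1 = 1 :> R by lra.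
  by rewrite -[RHS]/(1%:E) -h2 EFinD; congr (_ + _)%E; [exact: p0|exact: p1].
exists (~` B); split; first exact: measurableC.
  by rewrite probability_setC// PB subee.
move=> w /= h [b0|b1]; apply: h => _ _ _.
  by rewrite b0.
by rewrite b1.
Qed.

Definition rows_upto k t (x : nat -> nat -> int) : set T :=
  [set w | forall j i, (1 <= i <= j)%N -> (j <= k)%N -> X j i t w = x j i].

Definition rows_from k t (x : nat -> nat -> int) : set T :=
  [set w | forall j i, (1 <= i <= j)%N -> (k <= j <= n)%N -> X j i t w = x j i].

Definition gt_upto k (x : nat -> nat -> int) : Prop :=
  forall l, (1 <= l < k)%N -> gt_rel l (x l) (x l.+1).

Definition gt_from k (x : nat -> nat -> int) : Prop :=
  forall l, (k <= l < n)%N -> gt_rel l (x l) (x l.+1).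

Lemma measurable_rows (C : nat -> bool) t (x : nat -> nat -> int) :
  (forall j, C j -> (j <= n)%N) ->
  measurable [set w | forall j i, (1 <= i <= j)%N -> C j -> X j i t w = x j i].
Proof.
move=> Cn; rewrite (_ : [set _ | _] = \bigcap_j \bigcap_i
    [set w | (1 <= i <= j)%N -> C j -> X j i t w = x j i]).
  apply: bigcapT_measurable => j; apply: bigcapT_measurable => i.
  have [/andP[ij Cj]|h] := boolP ((1 <= i <= j)%N && C j); last first.
    rewrite (_ : [set _ | _] = setT)//; apply/seteqP; split => // w _ /= ij Cj.
    by rewrite ij Cj in h.
  rewrite (_ : [set _ | _] = X j i t @^-1` [set x j i]).
    by apply: discrete_X => //; exact: Cn.
  by apply/seteqP; split => w /=; [exact|].
apply/seteqP; split => w h; first by move=> j _ i _; exact: h.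
by move=> j i; exact: (h j I i I).
Qed.

Lemma measurable_rows_upto k t x : (k <= n)%N -> measurable (rows_upto k t x).
Proof.
by move=> kn; apply: (measurable_rows (C := fun j => (j <= k)%N)) => j; lia.
Qed.

Lemma measurable_rows_from k t x : measurable (rows_from k t x).
Proof.
by apply: (measurable_rows (C := fun j => (k <= j <= n)%N)) => j; lia.
Qed.

Definition move_back k (e : {ffun 'I_k -> bool}) (y : nat -> int) (i : nat) : int :=
  y i - (ffun_nat e i)%:Z.

Definition set_row k (y : nat -> int) (x : nat -> nat -> int) : nat -> nat -> int :=
  fun j => if j == k then y else x j.

(* One sweep of the dynamics, row by row: the rows up to [k] have already been
   moved to time [t.+1]. *)
Lemma sweep_step k t (s : seq (nat * nat * nat)) b (x x' : nat -> nat -> int) :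
  (k < n)%N ->
  P (rows_upto k.+1 t.+1 x `&` rows_from k.+1 t x' `&` cylinder s b) =
  (\sum_(ec : {ffun 'I_k -> bool} * {ffun 'I_k.+1 -> bool})
    if [forall i : 'I_k.+1, x k.+1 i.+1 ==
         upd k.+1 i.+1 (x' k.+1 i.+1) (x k) (ec.2 i)] then
      P (rows_upto k t.+1 x `&`
         rows_from k t (set_row k (move_back ec.1 (x k)) x') `&`
         cylinder s b `&`
         cylinder [seq (k.+1, i.+1, t.+1) | i : 'I_k.+1 <- enum 'I_k.+1]
           (fun q => ffun_nat ec.2 q.1.2 == 1%N))
    else 0)%E.
Proof.
move=> kn.
(* A piece fixes the old position of row [k], through its displacements [ec.1], and the new bits
   [ec.2] of row [k.+1]. *)
pose D (ec : {ffun 'I_k -> bool} * {ffun 'I_k.+1 -> bool}) :=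
  [set w | forall i, (1 <= i <= k)%N -> X k i t w = move_back ec.1 (x k) i] `&`
  [set w | forall i : 'I_k.+1, beta k.+1 i.+1 t.+1 w = ec.2 i :> nat].
have mD ec : measurable (D ec).
  apply: measurableI.
    rewrite (_ : [set _ | _] = \bigcap_i [set w | (1 <= i <= k)%N ->
        X k i t w = move_back ec.1 (x k) i]).
      apply: bigcapT_measurable => i; have [ik|ik] := boolP (1 <= i <= k)%N; last first.
        by rewrite (_ : [set _ | _] = setT)//; apply/seteqP; split.
      rewrite (_ : [set _ | _] = X k i t @^-1` [set move_back ec.1 (x k) i]).
        by apply: discrete_X => //; exact: ltnW.
      by apply/seteqP; split => w /=; [apply|].
    apply/seteqP; split => w h; first by move=> i _; exact: h.
    by move=> i; exact: (h i I).
  rewrite (_ : [set _ | _] = \bigcap_(i in [set` enum 'I_k.+1])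
      (beta k.+1 i.+1 t.+1 @^-1` [set (ec.2 i : nat)])).
    by apply: fin_bigcap_measurable => // i _; exact: discrete_beta.
  apply/seteqP; split => w /= h; first by move=> i _; exact: h.
  by move=> i; apply: h; rewrite /= mem_enum.
have mA : measurable (rows_upto k.+1 t.+1 x `&` rows_from k.+1 t x' `&` cylinder s b).
  apply: measurableI; last exact: measurable_cylinder.
  by apply: measurableI; [exact: measurable_rows_upto|exact: measurable_rows_from].
rewrite (probability_split mA mD); last 2 first.
- move=> [e c] [e' c'] w [/= h1 h2] [/= h1' h2']; congr pair; apply/ffunP => i.
    have ik : (1 <= i.+1 <= k)%N by rewrite /= ltn_ord.
    have := h1 i.+1 ik; rewrite (h1' i.+1 ik) /move_back !ffun_natE.
    by case: (e i); case: (e' i) => //; lia.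
  by have := h2 i; rewrite (h2' i); case: (c i); case: (c' i).
- apply: filterS ae_bits_ok => w ok [[up fr] _].
  exists ([ffun i : 'I_k => X k i.+1 t w != x k i.+1],
          [ffun i : 'I_k.+1 => beta k.+1 i.+1 t.+1 w == 1%N]); split => /= i.
    move=> ik; have [_ /(_ k i ik (ltnW kn))] := aztec_invariants process ok t.
    have i1k : (i.-1 < k)%N by lia.
    have ii : i = (Ordinal i1k).+1 by rewrite /= prednK; lia.
    have := ffun_natE [ffun i : 'I_k => X k i.+1 t w != x k i.+1] (Ordinal i1k).
    rewrite -ii ffunE -ii /move_back => ->; rewrite (up k i) ?leqnSn//.
    by case: eqP => /= [->|]; lia.
  rewrite ffunE; have := ok k.+1 i.+1 t.+1; have := ltn_ord i.
  by case: eqP => [->//|] /=; lia.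
(* On a piece the new row [k.+1] is determined; the event is empty unless it is the prescribed
   row. *)
apply: eq_bigr => -[e c] _ /=; case: forallP => [xu|xu]; last first.
  rewrite (_ : _ `&` D _ = set0) ?measure0//; apply/seteqP; split => // w.
  move=> [[[up fr] _] [/= _ hc]]; apply: xu => i; apply/eqP.
  have ik : (1 <= i.+1 <= k.+1)%N by rewrite /= ltn_ord.
  rewrite -(up k.+1 i.+1)// (aztec_upd process)// -hc -(fr k.+1 i.+1)//; last first.
    by rewrite leqnn.
  apply: eq_upd => h; apply: up => //=; lia.
congr (P _); apply/seteqP; split => w.
  move=> [[[up fr] cy] [/= hx hc]]; split; first split; first split.
  - by move=> j i ij jk; apply: up => //; exact: leqW.
  - move=> j i ij /andP[kj jn]; rewrite /set_row; case: eqP => [jk|jk].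
      by subst j; exact: hx.
    by apply: fr => //; lia.
  - exact: cy.
  - move=> q /= /mapP[i _ ->] /=.
    by rewrite hc ffun_natE; case: (c i).
move=> [[[up fr] cy] hc].
have hc' (i : 'I_k.+1) : beta k.+1 i.+1 t.+1 w = c i :> nat.
  have /= := hc (k.+1, i.+1, t.+1); rewrite ffun_natE; case: (c i) => /=; apply.
    by apply/mapP; exists i => //; rewrite mem_enum.
  by apply/mapP; exists i => //; rewrite mem_enum.
have fr' j i : (1 <= i <= j)%N -> (k.+1 <= j <= n)%N -> X j i t w = x' j i.
  move=> ij /andP[kj jn]; rewrite fr//; last by rewrite (ltnW kj).
  by rewrite /set_row gtn_eqF.
split; last split => /=; first split; first split.
- move=> j i ij; rewrite leq_eqVlt => /predU1P[jk|jk]; last exact: up.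
  subst j; have i1k : (i.-1 < k.+1)%N by lia.
  have ii : i = (Ordinal i1k).+1 by rewrite /= prednK; lia.
  rewrite ii (eqP (xu (Ordinal i1k))) (aztec_upd process); last 2 first.
  + by rewrite /= prednK; lia.
  + exact: kn.
  rewrite hc' fr'//; last by rewrite leqnn.
  by apply: eq_upd => h; apply: up => //=; lia.
- exact: fr'.
- exact: cy.
- move=> i ik; rewrite (fr k i)//; last by rewrite leqnn (ltnW kn).
  by rewrite /set_row eqxx.
- exact: hc'.
Qed.

Lemma cylinder_cat s s' b b' : {in s, forall q, q \notin s'} ->
  cylinder s b `&` cylinder s' b' =
  cylinder (s ++ s') (fun q => if q \in s' then b' q else b q).
Proof.
move=> ss'; apply/seteqP; split => w.
  move=> [h h'] q /=; rewrite mem_cat => /orP[qs|qs']; last first.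
    by rewrite qs'; exact: h'.
  by rewrite (negbTE (ss' q qs)); exact: h.
move=> h; split => q qs.
  by have := h q; rewrite /= mem_cat qs (negbTE (ss' q qs)); apply.
by have := h q; rewrite /= mem_cat qs orbT; apply.
Qed.

Lemma gt_from_set_row k y x : (k < n)%N ->
  `[< gt_from k (set_row k y x) >] =
  `[< gt_rel k y (x k.+1) >] && `[< gt_from k.+1 x >].
Proof.
move=> kn; apply/asboolP/andP => [h|[/asboolP h1 /asboolP h2] l /andP[kl ln]].
  split; apply/asboolP.
    by have := h k; rewrite leqnn kn /set_row eqxx gtn_eqF// => /(_ isT).
  move=> l /andP[kl ln]; have := h l; rewrite (ltnW kl) ln => /(_ isT).
  by rewrite /set_row !gtn_eqF// ltnW.
rewrite /set_row; case: eqP => [->|lk]; first by rewrite gtn_eqF.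
by rewrite gtn_eqF//; apply: h2; lia.
Qed.

Lemma gt_uptoS k (x : nat -> nat -> int) :
  `[< gt_upto k.+1 x >] = `[< gt_upto k x >] && `[< gt_rel k (x k) (x k.+1) >].
Proof.
apply/asboolP/andP => [h|[/asboolP h1 /asboolP h2] l /andP[l1 lk]].
  split; apply/asboolP; first by move=> l lk; apply: h; lia.
  by case: k h => [_ i|k h]; [lia|apply: h; lia].
by move: lk; rewrite ltnS leq_eqVlt => /predU1P[->//|lk]; apply: h1; lia.
Qed.

(** The hypothesis is the law at time [t]. Bits of time [t.+1] are allowed in the cylinder only in
    rows beyond [k], which have not been read yet; this lets the induction step move the bits of row
    [k.+1] into it. The factor with [increasing_upto] follows from interlacing with the next row if
    [k < n], but not at [k = n], where [gt_from] is void. *)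
Lemma sweep_law t :
  (forall x s b, uniq s -> {in s, forall q, valid q && (t < q.2)%N} ->
    P (rows_from 0 t x `&` cylinder s b) =
    (2 ^- size s * (`[< gt_from 0 x >]%:R * krawt R n t (x n)))%:E) ->
  forall k x x' s b, (k <= n)%N -> uniq s ->
    {in s, forall q, valid q &&
       ((t.+1 < q.2) || (q.2 == t.+1) && (k < q.1.1))%N} ->
    P (rows_upto k t.+1 x `&` rows_from k t x' `&` cylinder s b) =
    (2 ^- size s * 2 ^- k * (`[< gt_upto k x >]%:R * `[< gt_from k x' >]%:R *
      `[< increasing_upto k (x' k) >]%:R *
      [forall i : 'I_k, x' k i.+1 <= x k i.+1 <= x' k i.+1 + 1]%:R *
      krawt R n t (x' n)))%:E.
Proof.
move=> H; elim=> [|k IHk] x x' s b kn us vs.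
  rewrite (_ : rows_upto 0 t.+1 x = setT) ?setTI; last first.
    by apply/seteqP; split => // w _ j i; lia.
  rewrite H//; last by move=> q /vs; lia.
  rewrite expr0 invr1 mulr1 [`[< gt_upto 0 x >]]asboolT ?mul1r; last by move=> l; lia.
  rewrite [`[< increasing_upto 0 _ >]]asboolT ?mulr1; last by move=> l; lia.
  by rewrite (_ : [forall i, _] = true) ?mulr1//; apply/forallP => -[].
(* The part common to all terms. The bits of row [k.+1] contribute the extra [k.+1] powers of 1/2,
   and [upd_count] gives back [2 ^+ k]. *)
pose A : R := 2 ^- (size s + k.+1) * 2 ^- k * (`[< gt_upto k x >]%:R *
  `[< gt_from k.+1 x' >]%:R * krawt R n t (x' n)).
pose E (e : {ffun 'I_k -> bool}) : R := `[< gt_rel k (move_back e (x k)) (x' k.+1) >]%:R.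
pose C (c : {ffun 'I_k.+1 -> bool}) : R := [forall i : 'I_k.+1,
  x k.+1 i.+1 == upd k.+1 i.+1 (x' k.+1 i.+1) (x k) (c i)]%:R.
rewrite sweep_step//.
rewrite (eq_bigr (fun ec => (A * (E ec.1 * C ec.2))%:E)); last first.
  move=> [e c] _ /=; rewrite /C; case: ifPn => _; last by rewrite !mulr0.
  rewrite mulr1 -setIA cylinder_cat; last first.
    move=> q /vs h; apply/negP => /mapP[i _ qi]; move: h; rewrite qi/= ltnn eqxx/=.
    by rewrite ltnn andbF.
  rewrite IHk ?(ltnW kn)//.
  - rewrite size_cat size_map size_enum_ord gt_from_set_row//.
    rewrite -mulnb natrM /set_row eqxx gtn_eqF//.
    rewrite (_ : [forall i, _] = true) ?mulr1; last first.
      apply/forallP => i; rewrite /move_back.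
      by case: (ffun_nat e i.+1) (ffun_natE e i) => [|[|m]] //; lia.
    congr _%:E; rewrite /A /E -[LHS]mulrA -[RHS]mulrA -[RHS]mulrA; congr (_ * (_ * _)).
    have [g|g] := pselect (gt_rel k (move_back e (x k)) (x' k.+1)); last first.
      by rewrite [`[< gt_rel _ _ _ >]]asboolF// !(mulr0, mul0r).
    rewrite [`[< increasing_upto _ _ >]]asboolT; last exact: gt_rel_increasing_below g.
    by rewrite [`[< gt_rel _ _ _ >]]asboolT//=; ring.
  - rewrite cat_uniq us map_inj_uniq ?enum_uniq ?andbT/=; last first.
      by move=> i j [ij]; exact/val_inj.
    apply/hasPn => q /mapP[i _ ->]; apply/negP => /vs /=.
    by rewrite !ltnn andbF andbF.
  - move=> q; rewrite mem_cat => /orP[/vs|/mapP[i _ ->]].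
      by move=> /andP[-> /=]; lia.
    by rewrite /valid/= eqxx ltnn ltnSn ltn_ord/= kn.
rewrite sumEFin; congr _%:E; rewrite -mulr_sumr.
rewrite -(pair_bigA _ (fun e c => E e * C c))/=.
have -> : \sum_e \sum_c E e * C c = (\sum_e E e) * (\sum_c C c).
  by rewrite big_distrlr.
rewrite gt_uptoS -mulnb natrM /A.
have [g|g] := pselect (gt_upto k x); last first.
  by rewrite [`[< gt_upto _ _ >]]asboolF// !(mulr0, mul0r).
have xk : increasing_upto k (x k).
  case: k g {IHk kn vs A E C} => [|[|k]] g; [by move=> l; lia|by move=> l; lia|].
  by apply: gt_rel_increasing_above (g k.+1 _); rewrite ltnSn.
have [p|p] := pselect (increasing_upto k.+1 (x' k.+1)); last first.
  rewrite [`[< increasing_upto _ _ >]]asboolF// (_ : \sum_e E e = 0).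
    by rewrite !(mulr0, mul0r).
  apply: big1 => e _; rewrite /E asboolF// => /gt_rel_increasing_above.
  exact: p.
have -> : (\sum_e E e) * (\sum_c C c) = 2 ^+ k * (`[< gt_rel k (x k) (x k.+1) >]%:R *
    [forall i : 'I_k.+1, x' k.+1 i.+1 <= x k.+1 i.+1 <= x' k.+1 i.+1 + 1]%:R).
  exact: upd_count.
rewrite [`[< gt_upto _ _ >]]asboolT// [`[< increasing_upto _ _ >]]asboolT//.
rewrite exprD exprS /=; field.
by rewrite !expf_neq0// pnatr_eq0.
Qed.

Lemma gt_from0 (x : nat -> nat -> int) : `[< gt_from 0 x >] = `[< gt_upto n x >].
Proof.
apply/asboolP/asboolP => h l ln; first by apply: h; lia.
by move: ln; case: l => [_ i|l ln]; [lia|apply: h; lia].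
Qed.

Lemma gt_upto_increasing (x : nat -> nat -> int) :
  gt_upto n x -> increasing_upto n (x n).
Proof.
case: n n1 => // -[_ _ i|m _ g]; first by lia.
by apply: gt_rel_increasing_above (g m.+1 _); rewrite ltnSn.
Qed.

Lemma aztec_law0 x s b : uniq s -> {in s, forall q, valid q} ->
  P (rows_from 0 0 x `&` cylinder s b) =
  (2 ^- size s * (`[< gt_from 0 x >]%:R * krawt R n 0 (x n)))%:E.
Proof.
move=> us vs; rewrite gt_from0.
have X0 w j i : (1 <= i <= j)%N -> (j <= n)%N -> X j i 0%N w = i%:Z.
  by have [+ _ _ _ _] := process w; exact.
have [xi|xi] := pselect (forall j i, (1 <= i <= j)%N -> (j <= n)%N -> x j i = i%:Z).
  have g : gt_upto n x by move=> l ln i il; rewrite !xi; lia.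
  rewrite (_ : rows_from 0 0 x = setT) ?setTI; last first.
    by apply/seteqP; split => // w _ j i ij jn; rewrite xi// X0.
  rewrite probability_cylinder// krawt0//; last exact: gt_upto_increasing.
  rewrite !asboolT// ?mulr1// => i iN.
  by rewrite xi.
rewrite (_ : rows_from 0 0 x = set0) ?set0I ?measure0; last first.
  apply/seteqP; split => // w h; apply: xi => j i ij jn.
  by rewrite -h// X0.
have [g|g] := pselect (gt_upto n x); last by rewrite asboolF// mul0r mulr0.
rewrite krawt0//; last exact: gt_upto_increasing.
rewrite [`[< forall i, _ >]]asboolF ?mulr0// => xn; apply: xi.
(* Going up from a packed last row, interlacing squeezes each shorter row between [i] and [i.+1]. *)
have lev k : forall i, (1 <= i <= n - k)%N -> x (n - k)%N i = i%:Z.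
  elim: k => [|k IHk] i ik; first by rewrite subn0 in ik *; exact: xn.
  have nk : (1 <= n - k.+1 < n)%N by lia.
  have := g _ nk i; rewrite (_ : (n - k.+1).+1 = n - k)%N; last by lia.
  by rewrite (IHk i) ?(IHk i.+1); lia.
move=> j i ij jn; have := lev (n - j)%N i.
by rewrite subKn//; apply; lia.
Qed.

(** The event on later bits is the strengthening that makes the induction work: it supplies the
    independence used when the next step reads them. *)
Lemma aztec_law t x s b : uniq s ->
  {in s, forall q, valid q && (t < q.2)%N} ->
  P (rows_from 0 t x `&` cylinder s b) =
  (2 ^- size s * (`[< gt_from 0 x >]%:R * krawt R n t (x n)))%:E.
Proof.
elim: t x s b => [|t IHt] x s b us vs.
  by apply: aztec_law0 => // q /vs /andP[].
have -> : rows_from 0 t.+1 x = rows_upto n t.+1 x.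
  by apply/seteqP; split => w h j i ij jn; apply: h; lia.
(* At [k = n] the mixed state still records the old last row. It is summed out here, and the sum is
   the one in [krawt_recursion]. *)
pose D (e : {ffun 'I_n -> bool}) := rows_from n t (set_row n (move_back e (x n)) x).
rewrite (probability_split (D := D)); last 4 first.
- apply: measurableI; [exact: measurable_rows_upto|exact: measurable_cylinder].
- by move=> e; exact: measurable_rows_from.
- move=> e e' w h h'; apply/ffunP => i.
  have iN : (1 <= i.+1 <= n)%N by rewrite /= ltn_ord.
  have nn : (n <= n <= n)%N by rewrite leqnn.
  have := h n i.+1 iN nn; rewrite (h' n i.+1 iN nn) /set_row eqxx.
  rewrite /move_back !ffun_natE.
  by case: (e i); case: (e' i) => //; lia.
- apply: filterS ae_bits_ok => w ok [up _].
  exists [ffun i : 'I_n => X n i.+1 t w != x n i.+1] => j i ij /andP[nj jn].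
  have jE : j = n by lia.
  subst j; have [_ /(_ n i ij jn)] := aztec_invariants process ok t.
  have i1n : (i.-1 < n)%N by lia.
  have ii : i = (Ordinal i1n).+1 by rewrite /= prednK; lia.
  have := ffun_natE [ffun i : 'I_n => X n i.+1 t w != x n i.+1] (Ordinal i1n).
  rewrite -ii ffunE -ii /set_row eqxx /move_back => ->; rewrite (up n i)//.
  by case: eqP => /= [->|]; lia.
pose A : R := 2 ^- size s * 2 ^- n * `[< gt_upto n x >]%:R.
rewrite (eq_bigr (fun e => (A * krawt R n t (move_back e (x n)))%:E)); last first.
  move=> e _; rewrite setIAC (sweep_law IHt)//; last by move=> q /vs; lia.
  rewrite /set_row eqxx [`[< gt_from n _ >]]asboolT ?mulr1; last by move=> l; lia.
  rewrite (_ : [forall i, _] = true) ?mulr1; last first.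
    apply/forallP => i; rewrite /move_back.
    by case: (ffun_nat e i.+1) (ffun_natE e i) => [|[|m]] //; lia.
  rewrite /A; congr _%:E.
  have [g|g] := pselect (gt_upto n x); last first.
    by rewrite [`[< gt_upto _ _ >]]asboolF// !(mul0r, mulr0).
  have [p|p] := pselect (increasing_upto n (move_back e (x n))).
    by rewrite [`[< increasing_upto _ _ >]]asboolT// mulr1 !mulrA.
  rewrite [`[< increasing_upto _ _ >]]asboolF// mulr0 mul0r mulr0.
  (* As [x n] increases strictly and particles move back by at most 1, strict increase can only fail
     through an equality of neighbours, where the Vandermonde factor vanishes. *)
  have [i iN h] : exists2 i, (1 <= i < n)%N &
      ~ (move_back e (x n) i < move_back e (x n) i.+1).
    by apply: contrapT => h; apply: p => i iN; apply: contrapT => ?; apply: h; exists i.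
  rewrite (krawt_coincide _ _ iN) ?mulr0//.
  have := gt_upto_increasing g iN; move: h; rewrite /move_back.
  have i1n : (i.-1 < n)%N by lia.
  have i2n : (i < n)%N by lia.
  have := ffun_natE e (Ordinal i1n); have := ffun_natE e (Ordinal i2n).
  rewrite /= prednK; last by lia.
  by move=> -> ->; case: (e _); case: (e _); lia.
rewrite sumEFin -mulr_sumr gt_from0 /A -mulrA -mulrA; congr (_ * _)%:E.
by rewrite mulrAC mulrC; congr (_ * _); exact: krawt_recursion.
Qed.

Lemma aztec_pmf t x : P (rows_from 0 t x) =
  (`[< gt_upto n x >]%:R * krawt R n t (x n))%:E.
Proof.
have := @aztec_law t x [::] (fun=> false) isT.
rewrite (_ : cylinder _ _ = setT) ?setIT; last first.
  by apply/seteqP; split => // w _ q.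
by rewrite expr0 invr1 mul1r gt_from0; apply.
Qed.

End aztec_law.

(** * Lebesgue measure on tuples *)

Section tuple_measure.
Context (R : realType).
Local Notation mu := (@lebesgue_measure R).
Local Notation lam m := (@lebesgue_tuple R m).

Lemma ge0_integral_tcons m (f : m.+1.-tuple R -> \bar R) :
  measurable_fun [set: m.+1.-tuple R] f -> (forall z, 0 <= f z)%E ->
  (\int[lam m.+1]_z f z = \int[mu]_a \int[lam m]_z f (tcons (a, z)))%E.
Proof.
move=> mf f0.
pose P : {measure set (measurableTypeR R * m.-tuple R) -> \bar R} :=
  product_measure1 mu (lam m).
transitivity (\int[pushforward P (@tcons R m)]_z f z)%E; first by [].
have mt : measurable_fun [set: measurableTypeR R * m.-tuple R] (@tcons R m).
  exact: measurable_tcons.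
rewrite (ge0_integral_pushforward mt P)//.
rewrite preimage_setT.
apply: (fubini_tonelli1 (m1 := mu) (m2 := lam m) (f \o @tcons R m)).
  exact: measurableT_comp mt.
by move=> x; exact: f0.
Qed.

Lemma measurable_tcons_section m (A : set (m.+1.-tuple R)) (a : R) :
  measurable A -> measurable [set z | A (tcons (a, z))].
Proof.
move=> mA; rewrite -[X in measurable X]setTI.
have mc : measurable_fun [set: m.-tuple R] (fun z => @tcons R m (a, z)).
  exact: (measurable_cons (f := cst a) (g := id)).

exact: mc.
Qed.

Lemma lebesgue_tuple_tcons m (A : set (m.+1.-tuple R)) : measurable A ->
  lam m.+1 A = (\int[mu]_a lam m [set z | A (tcons (a, z))])%E.
Proof.
move=> mA; transitivity (\int[lam m.+1]_z (\1_A z)%:E)%E.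
  by rewrite integral_indic// setIT.
rewrite ge0_integral_tcons//; last exact/measurable_EFinP/measurable_indic.
apply: eq_integral => a _.
transitivity (\int[lam m]_z (\1_[set z | A (tcons (a, z))] z)%:E)%E.
  by apply: eq_integral => z _; rewrite !indicE; congr (_%:R)%:E;
    apply/idP/idP; rewrite !inE.
by rewrite integral_indic ?setIT//; exact: measurable_tcons_section.
Qed.

Lemma measurable_tnth_set m (i : 'I_m) (A : set R) : measurable A ->
  measurable [set z : m.-tuple R | A (tnth z i)].
Proof.
move=> mA; have := @measurable_tnth _ R m i measurableT _ mA.
by rewrite setTI.
Qed.

Lemma measurable_tnth_eq m (i j : 'I_m) :
  measurable [set z : m.-tuple R | tnth z i = tnth z j].
Proof.
pose g (z : m.-tuple R) : R := tnth z i - tnth z j.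
have mg : measurable_fun [set: m.-tuple R] g.
  by apply: measurable_funB; exact: measurable_tnth.
rewrite (_ : [set _ | _] = g @^-1` [set 0]); last first.
  apply/seteqP; split => z; rewrite /g /=; first by move=> ->; rewrite subrr.
  by move/eqP; rewrite subr_eq0 => /eqP.
rewrite -[X in measurable X]setTI; apply: mg => //; exact: measurable_set1.
Qed.

Lemma lebesgue_tuple_coord m (i : 'I_m) (c : R) :
  lam m [set z | tnth z i = c] = 0%E.
Proof.
elim: m i => [[]//|m IHm] i.
rewrite lebesgue_tuple_tcons; last exact: (measurable_tnth_set i (measurable_set1 c)).
have [j ->|->] := unliftP ord0 i.
  under eq_integral => a _.
    rewrite (_ : [set _ | _] = [set z | tnth z j = c]) ?IHm.
      over.
    by apply/seteqP; split => z /=; rewrite tnthS.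
  by rewrite integral0.
transitivity (\int[mu]_a ((\1_[set c] a)%:E * lam m setT))%E.
  apply: eq_integral => a _; rewrite indicE.
  have [->|ac] := eqVneq a c.
    rewrite mem_set// mul1e; congr (lam m _).
    by apply/seteqP; split.
  rewrite memNset ?mul0e; last exact/eqP.
  rewrite (_ : [set _ | _] = set0) ?measure0//.
  by apply/seteqP; split => z //= /eqP; rewrite (negbTE ac).
rewrite ge0_integralZr//; last exact/measurable_EFinP/measurable_indic.
rewrite integral_indic// setIT; apply/eqP; rewrite mule_eq0.
by apply/orP; left; apply/eqP; exact: lebesgue_measure_set1.
Qed.

(** Slicing along the first coordinate leaves a diagonal of lower dimension or a hyperplane with one
    fixed coordinate. This makes points with pairwise distinct coordinates generic. *)
Lemma lebesgue_tuple_diag m (i j : 'I_m) : i != j ->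
  lam m [set z | tnth z i = tnth z j] = 0%E.
Proof.
elim: m i j => [[]//|m IHm] i j.
rewrite lebesgue_tuple_tcons; last exact: measurable_tnth_eq.
have [i' ->|->] := unliftP ord0 i; have [j' ->|->] := unliftP ord0 j => // ij.
- under eq_integral => a _.
    rewrite (_ : [set _ | _] = [set z | tnth z i' = tnth z j']) ?IHm.
        over.
      by apply: contraNN ij => /eqP ->.
    by apply/seteqP; split => z /=; rewrite !tnthS.
  by rewrite integral0.
- under eq_integral => a _.
    rewrite (_ : [set _ | _] = [set z | tnth z i' = a]) ?lebesgue_tuple_coord.
      over.
    by apply/seteqP; split => z /=; rewrite !tnthS.
  by rewrite integral0.
- under eq_integral => a _.
    rewrite (_ : [set _ | _] = [set z | tnth z j' = a]) ?lebesgue_tuple_coord.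
      over.
    by apply/seteqP; split => z /=; rewrite !tnthS => /esym.
  by rewrite integral0.
Qed.

Lemma measurable_tnth_prod m (f : 'I_m -> R -> R) :
  (forall i, measurable_fun [set: R] (f i)) ->
  measurable_fun [set: m.-tuple R] (fun z => \prod_(i < m) f i (tnth z i)).
Proof.
move=> mf; apply: measurable_prod => i _.
exact: (measurableT_comp (mf i) (@measurable_tnth _ R m i)).
Qed.

Lemma integral_tnth_prod m (f : 'I_m -> R -> R) :
  (forall i, measurable_fun [set: R] (f i)) -> (forall i x, 0 <= f i x) ->
  (\int[lam m]_z (\prod_(i < m) f i (tnth z i))%:E =
   \prod_(i < m) \int[mu]_x (f i x)%:E)%E.
Proof.
elim: m f => [|m IHm] f mf f0.
  under eq_integral do rewrite big_ord0.
  rewrite big_ord0 integral_cst//= mul1e /lebesgue_tuple.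
  by rewrite diracE mem_set.
rewrite ge0_integral_tcons; last 2 first.
- by apply/measurable_EFinP; exact: measurable_tnth_prod.
- by move=> z; rewrite lee_fin prodr_ge0.
rewrite big_ord_recl -ge0_integralZr//; last 3 first.
- by apply/measurable_EFinP; exact: mf.
- by move=> x _; rewrite lee_fin.
- by apply: prode_ge0 => i _; apply: integral_ge0 => x _; rewrite lee_fin.
apply: eq_integral => a _; rewrite -IHm//.
rewrite -ge0_integralZl//; last 3 first.
- apply/measurable_EFinP.
  exact: (measurable_tnth_prod (f := fun i => f (lift ord0 i))).
- by move=> z _; rewrite lee_fin prodr_ge0.
- by rewrite lee_fin.
apply: eq_integral => z _; rewrite big_ord_recl -EFinM; congr (_ * _)%:E.
by apply: eq_bigr => i _; rewrite tnthS.
Qed.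

End tuple_measure.

(** * Step functions on a lattice *)

Section step_functions.
Context (R : realType).
Local Notation lam m := (@lebesgue_tuple R m).

Definition cell (h c : R) (k : nat) : set R :=
  [set` `[(k%:R - c) * h, (k.+1%:R - c) * h[].

(** Index of the cell containing [a]. Truncation sends negative numbers to 0, hence the sign
    condition that accompanies it below. *)
Definition grid (h c a : R) : nat := Num.truncn (a / h + c).

(** Constant on each cube of side [h] with lower corner at a lattice point, and 0 outside the cubes
    with indices below [L]. The values [F] are indexed by plain sequences, so that they do not
    depend on [L]. *)
Definition step (h c : R) D L (F : seq nat -> R) (z : D.-tuple R) : R :=
  \sum_(x : D.-tuple 'I_L)
    F (map val x) * \prod_(i < D) \1_(cell h c (tnth x i)) (tnth z i).

Lemma cellE (h c : R) k a : 0 < h ->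
  (a \in cell h c k) = (0 <= a / h + c) && (grid h c a == k).
Proof.
move=> h0; rewrite /cell /grid.
apply/idP/idP; rewrite inE /= in_itv/=.
  rewrite -ler_pdivlMr// -ltr_pdivrMr// => /andP[ka ak].
  have ka' : k%:R <= a / h + c by rewrite -lerBlDr.
  have ak' : a / h + c < k.+1%:R by rewrite -ltrBrDr.
  rewrite (le_trans _ ka')// ?ler0n//=; apply/eqP/truncn_def.
  by rewrite ka'.
move=> /andP[a0 /eqP <-]; have /andP[ga ag] := truncn_itv a0.
by rewrite -ler_pdivlMr// -ltr_pdivrMr// lerBlDr ga ltrBrDr.
Qed.

Lemma measurable_step (h c : R) D L F :
  measurable_fun [set: D.-tuple R] (@step h c D L F).
Proof.
apply: measurable_sum => x; apply: measurable_funM => //.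
apply: (measurable_tnth_prod (f := fun i => \1_(cell h c (tnth x i)))) => i.
apply: measurable_indic; exact: measurable_itv.
Qed.

Lemma integral_step (h c : R) D L F : 0 < h -> (forall x, 0 <= F x) ->
  (\int[lam D]_z (@step h c D L F z)%:E =
   (h ^+ D * \sum_(x : D.-tuple 'I_L) F (map val x))%:E)%E.
Proof.
move=> h0 F0.
have mI (x : D.-tuple 'I_L) i : measurable_fun [set: R] (\1_(cell h c (tnth x i)) : R -> R).
  apply: measurable_indic; exact: measurable_itv.
under eq_integral do rewrite /step -sumEFin.
rewrite ge0_integral_sum//; last 2 first.
- move=> x; apply/measurable_EFinP; apply: measurable_funM => //.
  exact: (measurable_tnth_prod (mI x)).
- by move=> x z _; rewrite lee_fin mulr_ge0// prodr_ge0.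
rewrite mulr_sumr -sumEFin; apply: eq_bigr => x _.
under eq_integral do rewrite EFinM.
rewrite ge0_integralZl//; last 3 first.
- by apply/measurable_EFinP; exact: (measurable_tnth_prod (mI x)).
- by move=> z _; rewrite lee_fin prodr_ge0.
- by rewrite lee_fin.
rewrite (integral_tnth_prod (mI x))// mulrC EFinM; congr (_ * _)%E.
rewrite (eq_bigr (fun=> h%:E)) => [|i _].
  by rewrite prodEFin prodr_const card_ord.
rewrite integral_indic ?setIT//; last exact: measurable_itv.
have lt1 : (((tnth x i)%:R - c) * h < ((tnth x i).+1%:R - c) * h).
  by rewrite ltr_pM2r// ltrD2r ltr_nat.
have := @lebesgue_measure_itv R `[((tnth x i)%:R - c) * h, ((tnth x i).+1%:R - c) * h[.
rewrite /= lte_fin lt1 /cell => ->; rewrite -EFinB; congr _%:E.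
rewrite -natr1; ring.
Qed.

Lemma stepE (h c : R) D L F (z : D.-tuple R) : 0 < h ->
  step h c L F z =
    if [forall i, (0 <= tnth z i / h + c) && (grid h c (tnth z i) < L)%N]
    then F (map (grid h c) z) else 0.
Proof.
move=> h0; rewrite /step; case: ifPn => [/forallP zL|/forallPn[i zL]].
  pose x : D.-tuple 'I_L := [tuple Ordinal (proj2 (andP (zL i))) | i < D].
  have xz : map val x = map (grid h c) z.
    rewrite -[LHS]/(val (map_tuple val x)) -[RHS]/(val (map_tuple (grid h c) z)).
    congr val; apply: eq_from_tnth => i.
    by rewrite !tnth_map tnth_ord_tuple.
  rewrite (bigD1 x)//= big1 ?addr0 => [|i _]; last first.
    by rewrite indicE cellE// tnth_mktuple /= eqxx (proj1 (andP (zL i))).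
  rewrite xz mulr1 big1 ?addr0// => y yx.
  have /existsP[i yi] : [exists i, tnth y i != tnth x i].
    apply: contraR yx; rewrite negb_exists => /forallP yx.
    by apply/eqP/eq_from_tnth => i; apply/eqP; move: (yx i); rewrite negbK.
  rewrite (bigD1 i)//= indicE cellE//.
  move: yi; rewrite tnth_mktuple -val_eqE/= eq_sym => /negbTE ->.
  by rewrite andbF mul0r mulr0.
rewrite big1// => x _; rewrite (bigD1 i)//= indicE cellE//.
move: zL; case: (0 <= _) => //=; last by rewrite mul0r mulr0.
case: eqP => [->|_ _]; last by rewrite mul0r mulr0.
by rewrite ltn_ord.
Qed.

End step_functions.

(** * Gaussian integrals and convergence of lattice sums *)

Section riemann_sums.
Context (R : realType).
Local Notation mu := (@lebesgue_measure R).
Local Notation lam m := (@lebesgue_tuple R m).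

(** Read off from the normal density of variance [(2 * a)^-1], whose total mass is 1. *)
Lemma integral_gauss (a : R) : 0 < a ->
  (\int[mu]_x (expR (- (a * x ^+ 2)))%:E)%E = (Num.sqrt (pi / a))%:E.
Proof.
move=> a0; pose s : R := Num.sqrt (2 * a)^-1.
have s2 : s ^+ 2 = (2 * a)^-1.
  by rewrite sqr_sqrtr// invr_ge0 mulr_ge0// ltW.
have s0 : s != 0 by rewrite sqrtr_eq0 -ltNge invr_gt0 mulr_gt0.
have p0 : normal_peak s != 0 by rewrite gt_eqF// normal_peak_gt0.
transitivity (\int[mu]_x ((normal_peak s)^-1%:E * (normal_pdf 0 s x)%:E))%E.
  apply: eq_integral => x _; rewrite -EFinM normal_pdfE//; congr _%:E.
  rewrite mulKf// /normal_fun subr0 s2; congr expR.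
  by field; rewrite gt_eqF.
rewrite ge0_integralZl//; last 3 first.
- by apply/measurable_EFinP; exact: measurable_normal_pdf.
- by move=> x _; rewrite lee_fin normal_pdf_ge0.
- by rewrite lee_fin invr_ge0 normal_peak_ge0.
rewrite integral_normal_pdf mule1 /normal_peak invrK s2.
by congr (Num.sqrt _)%:E; field; rewrite gt_eqF.
Qed.

Lemma measurable_gauss (a : R) :
  measurable_fun [set: R] (fun x => expR (- (a * x ^+ 2))).
Proof.
apply: measurableT_comp => //; apply: measurableT_comp => //.
by apply: measurable_funM => //; exact: measurable_funX.
Qed.

Lemma integral_gauss_prod m (a : R) : 0 < a ->
  (\int[lam m]_z (\prod_(i < m) expR (- (a * tnth z i ^+ 2)))%:E)%E =
  (Num.sqrt (pi / a) ^+ m)%:E.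
Proof.
move=> a0.
rewrite (integral_tnth_prod (f := fun i x => expR (- (a * x ^+ 2))))//; last first.
  by move=> i; exact: measurable_gauss.
rewrite (eq_bigr (fun=> (Num.sqrt (pi / a))%:E)) => [|i _].
  by rewrite prodEFin prodr_const card_ord.
exact: integral_gauss.
Qed.

Lemma integrable_gauss_prod m (a C : R) : 0 < a ->
  (lam m).-integrable setT
    (fun z => (C * \prod_(i < m) expR (- (a * tnth z i ^+ 2)))%:E).
Proof.
move=> a0; under eq_fun do rewrite EFinM.
apply: integrableZl => //; apply/integrableP; split.
  apply/measurable_EFinP.
  by apply: (measurable_tnth_prod (f := fun i x => expR (- (a * x ^+ 2)))) => i;
    exact: measurable_gauss.
under eq_integral do rewrite gee0_abs ?lee_fin ?prodr_ge0//.
by rewrite integral_gauss_prod// ltry.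
Qed.

(** The lattice sums are integrals of step functions, so a single integrable [G] above all of them
    gives the limit, and the integrability of [H] as well. *)
Lemma step_cvg D (h c : nat -> R) (L : nat -> nat) (F : nat -> seq nat -> R)
    (H : D.-tuple R -> R) (G : D.-tuple R -> R) :
  (forall N, 0 < h N) -> (forall N x, 0 <= F N x) ->
  measurable_fun [set: D.-tuple R] H ->
  {ae lam D, forall z, step (h N) (c N) (L N) (F N) z @[N --> \oo] --> H z} ->
  (lam D).-integrable setT (EFin \o G) ->
  (forall N z, step (h N) (c N) (L N) (F N) z <= G z) ->
  (lam D).-integrable setT (EFin \o H) /\
  ((h N ^+ D * \sum_(x : D.-tuple 'I_(L N)) F N (map val x))%:E
    @[N --> \oo] --> \int[lam D]_z (H z)%:E)%E.
Proof.
move=> h0 F0 mH sH iG sG.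
have s0 N z : 0 <= step (h N) (c N) (L N) (F N) z.
  by apply: sumr_ge0 => x _; rewrite mulr_ge0// prodr_ge0.
have mf N : measurable_fun [set: D.-tuple R]
    (fun z => (step (h N) (c N) (L N) (F N) z)%:E).
  by apply/measurable_EFinP; exact: measurable_step.
have mE : measurable_fun [set: D.-tuple R] (EFin \o H) by exact/measurable_EFinP.
have cvH : {ae lam D, forall z, setT z ->
    (step (h N) (c N) (L N) (F N) z)%:E @[N --> \oo] --> (EFin \o H) z}.
  apply: filterS sH => z sH _.
  by apply: (cvg_comp _ EFin sH).
have dom : {ae lam D, forall z N, setT z ->
    (`|(step (h N) (c N) (L N) (F N) z)%:E| <= (EFin \o G) z)%E}.
  by apply: aeW => z N _; rewrite gee0_abs lee_fin.
have [iH _ cv] := dominated_convergence measurableT mf mE cvH iG dom.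
split; first exact: iH.
under eq_fun => N do rewrite -(integral_step (c N))//.
exact: cv.
Qed.

End riemann_sums.

(** * The volume of the interlacing patterns *)

Section box_integrals.
Context (R : realType).
Local Notation mu := (@lebesgue_measure R).
Local Notation lam m := (@lebesgue_tuple R m).

Lemma integral_deriv_poly (q : {poly R}) (a b : R) : a <= b ->
  (\int[mu]_(x in `[a, b]) (q^`().[x])%:E)%E = (q.[b] - q.[a])%:E.
Proof.
rewrite le_eqVlt => /orP[/eqP->|ab].
  by rewrite set_itv1 integral_set1 subrr.
rewrite (continuous_FTC2 (F := horner q))//.
- exact/continuous_subspaceT/continuous_horner.
- split.
  + by move=> x _; exact: derivable_horner.
  + exact/cvg_at_right_filter/continuous_horner.
  + exact/cvg_at_left_filter/continuous_horner.
- by move=> x _; rewrite derive1E; have [_ ->] := is_derive_poly q x.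
Qed.

Definition boxi m (a b : 'I_m -> R) (z : m.-tuple R) : R :=
  \prod_(i < m) \1_(`[a i, b i]%classic) (tnth z i).

Lemma boxiE m (a b : 'I_m -> R) z :
  boxi a b z = [forall i, a i <= tnth z i <= b i]%:R.
Proof.
rewrite /boxi; case: (boolP [forall _, _]) => [/forallP ab|/forallPn[i zi]] /=.
  by rewrite big1// => i _; rewrite indicE mem_set//= in_itv/=; exact: ab.
rewrite (bigD1 i)//= indicE memNset ?mul0r//= in_itv/=.
exact/negP.
Qed.

Lemma measurable_boxi m (a b : 'I_m -> R) :
  measurable_fun [set: m.-tuple R] (boxi a b).
Proof.
apply: (measurable_tnth_prod (f := fun i => \1_(`[a i, b i]%classic))) => i.
exact: measurable_indic.
Qed.

Lemma measurable_polysum (S : finType) m (c : S -> R)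
    (q : S -> 'I_m -> {poly R}) :
  measurable_fun [set: m.-tuple R]
    (fun z => \sum_s c s * \prod_(i < m) (q s i).[tnth z i]).
Proof.
apply: measurable_sum => s; apply: measurable_funM => //.
apply: (measurable_tnth_prod (f := fun i => horner (q s i))) => i.
exact: measurable_poly.
Qed.

(* The integrand is a signed sum, but every partial integral of it is again
   nonnegative, so that Tonelli's theorem suffices. *)
Lemma integral_boxi_polysum (S : finType) m (c : S -> R)
    (q : S -> 'I_m -> {poly R}) (a b : 'I_m -> R) :
  (forall i, a i <= b i) ->
  (forall z, (forall i, a i <= tnth z i <= b i) ->
    0 <= \sum_s c s * \prod_(i < m) (q s i)^`().[tnth z i]) ->
  (\int[lam m]_z (boxi a b z *
     \sum_s c s * \prod_(i < m) (q s i)^`().[tnth z i])%:E =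
   (\sum_s c s * \prod_(i < m) ((q s i).[b i] - (q s i).[a i]))%:E)%E.
Proof.
elim: m c q a b => [|m IHm] c q a b ab Phi0.
  have E z : (boxi a b z * \sum_s c s * \prod_(i < 0) (q s i)^`().[tnth z i])
      = \sum_s c s * \prod_(i < 0) ((q s i).[b i] - (q s i).[a i]).
    rewrite /boxi big_ord0 mul1r; apply: eq_bigr => s _.
    by rewrite !big_ord0.
  under eq_integral do rewrite E.
  by rewrite integral_cst//= /lebesgue_tuple diracE mem_set// mule1.
rewrite ge0_integral_tcons; last 2 first.
- apply/measurable_EFinP; apply: measurable_funM; first exact: measurable_boxi.
  exact: (measurable_polysum c (fun s i => (q s i)^`())).
- move=> z; rewrite lee_fin boxiE; case: (boolP [forall _, _]) => [/forallP zab|_]/=.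
    by rewrite mul1r Phi0.
  by rewrite mul0r.
pose K s : R := \prod_(i < m)
  ((q s (lift ord0 i)).[b (lift ord0 i)] - (q s (lift ord0 i)).[a (lift ord0 i)]).
pose P : {poly R} := \sum_s (c s * K s) *: q s ord0.
have PE x : P.[x] = \sum_s c s * K s * (q s ord0).[x].
  by rewrite horner_sum; apply: eq_bigr => s _; rewrite hornerZ.
have P'E x : P^`().[x] = \sum_s c s * K s * (q s ord0)^`().[x].
  rewrite linear_sum horner_sum; apply: eq_bigr => s _.
  by rewrite linearZ/= hornerZ.
(* For [x] in the first interval the induction hypothesis evaluates the inner integral as the
   derivative of [P] at [x]; otherwise it is 0. *)
transitivity (\int[mu]_x ((fun x => (P^`().[x])%:E) \_ (`[a ord0, b ord0]%classic)) x)%E.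
  apply: eq_integral => x _; rewrite patchE; case: ifPn; last first.
    rewrite notin_setE /= in_itv/= => xab.
    under eq_integral => z _.
      rewrite /boxi big_ord_recl/= indicE memNset/= ?in_itv//= mul0r mul0r.
      over.
    by rewrite integral0.
  rewrite inE /= in_itv/= => xab.
  have E z : \sum_s c s * \prod_(i < m.+1) (q s i)^`().[tnth (tcons (x, z)) i]
    = \sum_s (c s * (q s ord0)^`().[x]) *
        \prod_(i < m) (q s (lift ord0 i))^`().[tnth z i].
    apply: eq_bigr => s _; rewrite big_ord_recl mulrA; congr (_ * _).
    by apply: eq_bigr => i _; rewrite tnthS.
  under eq_integral => z _.
    rewrite /boxi big_ord_recl/= indicE mem_set/= ?in_itv//= mul1r E.
    under eq_bigr do rewrite tnthS.
    over.
  rewrite (IHm (fun s => c s * (q s ord0)^`().[x])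
             (fun s i => q s (lift ord0 i))
             (fun i => a (lift ord0 i)) (fun i => b (lift ord0 i)))//; last first.
    move=> z zab; rewrite -E; apply: Phi0 => i.
    by have [j ->|->] := unliftP ord0 i; [rewrite tnthS|].
  by rewrite P'E; congr _%:E; apply: eq_bigr => s _; rewrite mulrAC.
rewrite -integral_mkcond integral_deriv_poly// !PE -sumrB; congr _%:E.
by apply: eq_bigr => s _; rewrite big_ord_recl -mulrBr -mulrA [K s * _]mulrC.
Qed.

End box_integrals.

(** * Vandermonde integrals and splitting of coordinates *)

Section pattern_volume.
Context (R : realType).
Local Notation lam m := (@lebesgue_tuple R m).

(** Row by row, each monomial integrates over its own interval to a difference of powers divided by
    the exponent. The divisors multiply to n factorial, and the determinant of differences is
    [det_diff_vdm]. *)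
Lemma integral_interlace_vdm n (y : nat -> R) :
  (forall i, (1 <= i <= n)%N -> y i <= y i.+1) ->
  (\int[lam n]_z (boxi (fun i => y i.+1) (fun i => y i.+2) z *
     vdm n (fun i => nth 0 z i.-1))%:E = (vdm n.+1 y / n`!%:R)%:E)%E.
Proof.
move=> yh.
pose c (s : 'S_n) : R := (-1) ^+ s.
pose q (s : 'S_n) (i : 'I_n) : {poly R} := (s i).+1%:R^-1 *: 'X^((s i).+1).
have q'E s i x : (q s i)^`().[x] = x ^+ s i.
  rewrite /q derivZ derivXn/= hornerZ hornerMn hornerXn -(mulr_natl (x ^+ _)) mulKf//.
have E (z : n.-tuple R) : vdm n (fun i => nth 0 z i.-1)
    = \sum_s c s * \prod_(i < n) (q s i)^`().[tnth z i].
  rewrite vdm_det; apply: eq_bigr => s _; congr (_ * _); apply: eq_bigr => i _.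
  by rewrite mxE q'E (tnth_nth 0).
under eq_integral do rewrite E.
rewrite integral_boxi_polysum; last 2 first.
- by move=> i; apply: yh => /=; exact: ltn_ord.
- move=> z zy; rewrite -E; apply: vdm_ge0 => i /andP[i1 iN].
  have i1n : (i.-1 < n)%N by rewrite prednK// ltnW.
  have /andP[_ +] := zy (Ordinal i1n); have /andP[+ _] := zy (Ordinal iN).
  by rewrite !(tnth_nth 0)/= prednK// => + zi; exact: le_trans.
congr _%:E; rewrite -det_diff_vdm mulr_suml; apply: eq_bigr => s _.
rewrite -mulrA; congr (_ * _).
have -> : n`!%:R^-1 = \prod_(i < n) ((s i).+1%:R^-1 : R).
  rewrite -(reindex_inj (F := fun i : 'I_n => i.+1%:R^-1) (P := xpredT) (h := s))/=; last exact: perm_inj.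
  by rewrite prodfV fact_prod natr_prod big_add1 big_mkord.
rewrite -big_split/=; apply: eq_bigr => i _.
by rewrite mxE /q !hornerZ !hornerXn -mulrBr mulrC.
Qed.

Lemma measurable_cat_tuple m p :
  measurable_fun [set: m.-tuple R * p.-tuple R]
    (fun q => [tuple of q.1 ++ q.2] : (m + p).-tuple R).
Proof.
apply/measurable_fun_tnthP => i; rewrite -(splitK i).
case: (fintype.split i) => j /=.
- rewrite (_ : _ \o _ = (fun q : m.-tuple R * p.-tuple R => tnth q.1 j)).
    exact: (measurableT_comp (@measurable_tnth _ R m j) measurable_fst).
  by apply/funext => q /=; rewrite tnth_lshift.
- rewrite (_ : _ \o _ = (fun q : m.-tuple R * p.-tuple R => tnth q.2 j)).
    exact: (measurableT_comp (@measurable_tnth _ R p j) measurable_snd).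
  by apply/funext => q /=; rewrite tnth_rshift.
Qed.

Lemma ge0_integral_cat m p (f : (m + p).-tuple R -> \bar R) :
  measurable_fun [set: (m + p).-tuple R] f -> (forall z, 0 <= f z)%E ->
  (\int[lam (m + p)]_z f z =
   \int[lam m]_u \int[lam p]_v f [tuple of u ++ v])%E.
Proof.
elim: m f => [|m IHm] f mf f0.
  rewrite [RHS](_ : _ = \int[@dirac _ (0.-tuple R) [tuple] R]_u \int[lam p]_v f [tuple of u ++ v])%E//.
  rewrite integral_dirac//.
    rewrite diracE mem_set// mul1e.
    by apply: eq_integral => z _; congr f; exact/val_inj.
  rewrite (_ : (fun _ => _) = cst (\int[lam p]_v f [tuple of [tuple] ++ v])%E)//.
  by apply/funext => u; rewrite (tuple0 u).
rewrite (ge0_integral_tcons (m := m + p) mf)//.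
have mcat : measurable_fun [set: m.+1.-tuple R]
    (fun u => \int[lam p]_v f [tuple of u ++ v])%E.
  pose g (q : m.+1.-tuple R * p.-tuple R) := f [tuple of q.1 ++ q.2].
  apply: (measurable_fun_fubini_tonelli_F g); last by move=> q; exact: f0.
  exact: (measurableT_comp mf (@measurable_cat_tuple m.+1 p)).
rewrite ge0_integral_tcons//; last by move=> z; exact: integral_ge0.
apply: eq_integral => a _.
have mfa : measurable_fun [set: (m + p).-tuple R] (fun z => f (tcons (a, z))).
  apply: measurableT_comp mf _.
  exact: (measurable_cons (f := cst a) (g := id)).
rewrite (IHm _ mfa); last by move=> z; exact: f0.
apply: eq_integral => u _; apply: eq_integral => v _; congr f.
exact/val_inj.
Qed.

End pattern_volume.

Section pattern_volume_formula.
Context (R : realType).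
Local Notation lam m := (@lebesgue_tuple R m).

(** The condition of [Kset] for sequences instead of tuples: the dimension ['C(n.+2, 2)] can then be
    replaced by ['C(n.+1, 2) + n.+1] without casts. *)
Definition interlaced_below n (y : nat -> R) (w : seq R) : Prop :=
  let x k := if k == n then y else entry w k in
  forall k i, (1 <= i <= k)%N -> (k < n)%N ->
    x k.+1 i <= x k i <= x k.+1 i.+1.

Lemma measurable_entry m k i :
  measurable_fun [set: m.-tuple R] (fun z : m.-tuple R => entry z k i).
Proof.
rewrite /entry; have [lm|lm] := ltnP ('C(k, 2) + i.-1) m.
  rewrite (_ : (fun _ => _) = (@tnth _ R ^~ (Ordinal lm))).
    exact: measurable_tnth.
  by apply/funext => z; rewrite (tnth_nth 0).
rewrite (_ : (fun _ => _) = cst 0)//.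
by apply/funext => z; rewrite nth_default// size_tuple.
Qed.

Lemma measurable_interlaced_below n y m :
  measurable [set w : m.-tuple R | interlaced_below n y w].
Proof.
pose x (w : m.-tuple R) k := if k == n then y else entry w k.
have mx k i : measurable_fun [set: m.-tuple R] (fun w => x w k i).
  by rewrite /x; case: eqP => // _; exact: measurable_entry.
pose A k i := [set w : m.-tuple R | (1 <= i <= k)%N -> (k < n)%N ->
  x w k.+1 i <= x w k i <= x w k.+1 i.+1].
rewrite (_ : [set _ | _] = \bigcap_k \bigcap_i A k i); last first.
  apply/seteqP; split=> w /= h; first by move=> k _ i _; exact: h.
  by move=> k i; exact: (h k I i I).
apply: bigcapT_measurable => k; apply: bigcapT_measurable => i.
have [ik|ik] := boolP ((1 <= i <= k)%N && (k < n)%N); last first.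
  rewrite (_ : A k i = setT)//; apply/seteqP; split => // w _ /= i1 kn.
  by move: ik; rewrite i1 kn.
have /andP[i1 kn] := ik.
rewrite (_ : A k i = ([set: m.-tuple R] `&` [set w | x w k.+1 i <= x w k i])
   `&` ([set: m.-tuple R] `&` [set w | x w k i <= x w k.+1 i.+1])).
  by apply: measurableI; apply: measurable_fun_le.
rewrite !setTI; apply/seteqP; split => w /=; first by move=> /(_ i1 kn)/andP[].
by move=> [h1 h2] _ _; rewrite h1.
Qed.

Lemma entry_cat n (u : 'C(n, 2).-tuple R) (v : seq R) k i :
  (1 <= i <= k)%N -> (k <= n)%N ->
  entry (u ++ v) k i = if k == n then nth 0 v i.-1 else entry u k i.
Proof.
move=> /andP[i1 ik]; rewrite /entry nth_cat size_tuple leq_eqVlt.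
move=> /predU1P[->|kn]; first by rewrite eqxx ltnNge leq_addr/= addKn.
rewrite (ltn_eqF kn) ifT//; apply: (@leq_trans 'C(k.+1, 2)).
  by rewrite binS bin1 ltn_add2l prednK.
exact: leq_bin2l.
Qed.

Lemma interlaced_below_cat n y (u : 'C(n, 2).-tuple R) (v : n.-tuple R) :
  interlaced_below n.+1 y (u ++ v) <->
  (forall i : 'I_n, y i.+1 <= tnth v i <= y i.+2) /\
  interlaced_below n (fun i => nth 0 v i.-1) u.
Proof.
have E j l : (1 <= l <= j)%N -> (j <= n)%N -> entry (u ++ v) j l =
    (if j == n then (fun i => nth 0 v i.-1) else entry u j) l.
  by move=> lj jn; rewrite entry_cat//; case: eqP.
have inner k i : (1 <= i <= k)%N -> (k < n)%N ->
    (entry (u ++ v) k.+1 i <= entry (u ++ v) k i <= entry (u ++ v) k.+1 i.+1) =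
    let x k := if k == n then fun i => nth 0 v i.-1 else entry u k in
    (x k.+1 i <= x k i <= x k.+1 i.+1).
  move=> ik kn; have /andP[i1 ik'] := ik.
  by rewrite (E k.+1 i) ?i1 ?leqW// (E k i) ?(ltnW kn)// (E k.+1 i.+1).
have kneq k : (k < n)%N -> (k.+1 == n.+1) = false /\ (k == n.+1) = false.
  by move=> kn; rewrite !ltn_eqF// ltnS ltnW.
rewrite /interlaced_below; split=> [h|[h1 h2] k i ik].
  split=> [i|k i ik kn].
    have := h n i.+1; rewrite eqxx ltnS leqnn => /(_ (ltn_ord i) isT).
    by rewrite ltn_eqF// entry_cat ?eqxx/= ?(tnth_nth 0)//; exact: ltn_ord.
  have := h k i ik (ltnW kn); have [k1 k2] := kneq _ kn.
  by rewrite k1 k2 inner.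
rewrite ltnS leq_eqVlt => /predU1P[kn|kn].
  subst k; have /andP[i1 ik'] := ik.
  have iN : (i.-1 < n)%N by rewrite prednK.
  have := h1 (Ordinal iN); rewrite eqxx ltn_eqF//= entry_cat// eqxx prednK//.
  by rewrite (tnth_nth 0).
have := h2 k i ik kn; have [k1 k2] := kneq _ kn.
by rewrite k1 k2 inner.
Qed.

Lemma lebesgue_tuple_indic m (A : set (m.-tuple R)) : measurable A ->
  (lam m A = \int[lam m]_z (\1_A z)%:E)%E.
Proof. by move=> mA; rewrite integral_indic// setIT. Qed.

Lemma integral_tuple_cast m m' (F : seq R -> \bar R) : m = m' ->
  (\int[lam m]_z F z = \int[lam m']_z F z)%E.
Proof. by move=> ->. Qed.

Lemma measurable_vdm_nth n m :
  measurable_fun [set: m.-tuple R] (fun z => vdm n (fun i => nth 0 z i.-1)).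
Proof.
have me i : measurable_fun [set: m.-tuple R] (fun z : m.-tuple R => nth 0 z i).
  by have := @measurable_entry m 1 i.+1; rewrite /entry bin_small// add0n.
by apply: measurable_prod => j _; apply: measurable_prod => i _;
  exact: measurable_funB.
Qed.

Lemma box_sorted n (y : nat -> R) (z : n.-tuple R) :
  (forall i : 'I_n, y i.+1 <= tnth z i <= y i.+2) ->
  forall i, (1 <= i < n)%N -> nth 0 z i.-1 <= nth 0 z i.+1.-1.
Proof.
move=> zy i /andP[i1 iN]; have i1n : (i.-1 < n)%N by rewrite prednK// ltnW.
have /andP[_ +] := zy (Ordinal i1n); have /andP[+ _] := zy (Ordinal iN).
by rewrite !(tnth_nth 0)/= prednK// => + zi; exact: le_trans.
Qed.

(** The longest line [v] of a point of [Kset y] ranges over the box of consecutive intervals of [y].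
    By induction the shorter lines contribute a Vandermonde product in [v] over factorials, and
    [integral_interlace_vdm] integrates it. *)
Lemma lebesgue_Kset n (y : nat -> R) : (1 <= n)%N ->
  (forall i, (1 <= i < n)%N -> y i <= y i.+1) ->
  lam 'C(n, 2) (@Kset R n y) = (vdm n y / \prod_(1 <= k < n) (k`!)%:R)%:E.
Proof.
case: n => // n _; elim: n y => [|n IHn] y yh.
  rewrite (_ : Kset y = setT); last first.
    rewrite -subTset => w _ x k i /andP[i1 ik]; rewrite ltnS leqn0 => /eqP k0.
    by move: i1; rewrite k0 in ik; case: i ik.
  rewrite /vdm big_nat1 !big_geq// divr1.
  transitivity (@dirac _ (0.-tuple R) [tuple] R setT); first by [].
  by rewrite diracE mem_set.
pose F (w : seq R) : \bar R := (`[< interlaced_below n.+2 y w >])%:R%:E.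
pose IB m := [set w : m.-tuple R | interlaced_below n.+2 y w].
have FI m (w : m.-tuple R) : F w = (\1_(IB m) w)%:E.
  rewrite /F indicE; case: asboolP => h; first by rewrite mem_set.
  by rewrite memNset.
have FE m : measurable_fun [set: m.-tuple R] (F : m.-tuple R -> _).
  rewrite (_ : (fun _ => _) = (EFin \o \1_(IB m))).
    apply/measurable_EFinP; apply: measurable_indic.
    exact: measurable_interlaced_below.
  exact/funext/FI.
transitivity (\int[lam 'C(n.+2, 2)]_w F w)%E.
  rewrite lebesgue_tuple_indic; last first.
    exact: measurable_interlaced_below.
  by apply: eq_integral => w _; rewrite FI.
rewrite (integral_tuple_cast F (m' := 'C(n.+1, 2) + n.+1)); last by rewrite binS bin1.
have F0 w : (0 <= F w)%E by rewrite lee_fin.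
rewrite (ge0_integral_cat (f := F))//.
pose F2 (q : 'C(n.+1, 2).-tuple R * n.+1.-tuple R) := F (q.1 ++ q.2).
(* The listing puts shorter lines first; exchanging the integrals brings [v] outside. *)
rewrite (fubini_tonelli (m1 := lam _) (m2 := lam _) F2); last 2 first.
- exact: (measurableT_comp (FE _) (@measurable_cat_tuple R _ _)).
- by move=> q; exact: F0.
have yh' i : (1 <= i <= n.+1)%N -> y i <= y i.+1 by move=> h; exact: yh.
rewrite big_nat_recr// invfM mulrA mulrAC EFinM -integral_interlace_vdm//.
set b := boxi _ _; set K := \prod_(1 <= k < n.+1) _.
have K0 : 0 <= K^-1 by rewrite invr_ge0 prodr_ge0.
rewrite muleC -ge0_integralZl//; last 2 first.
- apply/measurable_EFinP; apply: measurable_funM; first exact: measurable_boxi.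
  exact: measurable_vdm_nth.
- move=> z _; rewrite lee_fin /b boxiE.
  case: (boolP [forall _, _]) => [/forallP zy|_]; last by rewrite mul0r.
  by rewrite mul1r; apply: vdm_ge0; exact: box_sorted zy.
apply: eq_integral => v _.
have [vy|vy] := boolP [forall i : 'I_n.+1, y i.+1 <= tnth v i <= y i.+2]; last first.
  rewrite /b boxiE (negbTE vy) mul0r mule0.
  under eq_integral => u _.
    rewrite /F2 /F asboolF; first over.
    by move=> /interlaced_below_cat[h _]; move/negP: vy; apply; exact/forallP.
  by rewrite integral0.
rewrite /b boxiE vy mul1r -EFinM mulrC -(IHn (fun i => nth 0 v i.-1)); last first.
  by move/forallP: vy; exact: box_sorted.
rewrite lebesgue_tuple_indic; last first.
  exact: measurable_interlaced_below.
apply: eq_integral => u _; rewrite /F2 /F /= indicE.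
have [h|h] := pselect (interlaced_below n.+1 (fun i => nth 0 v i.-1) u).
  rewrite mem_set// asboolT//; apply/interlaced_below_cat; split => //.
  exact/forallP.
rewrite memNset// asboolF// => /interlaced_below_cat[_].
exact: h.
Qed.

End pattern_volume_formula.

(** * Closed form of the limit density *)

Section density.
Context (R : realType).
Implicit Types (n : nat) (x : nat -> nat -> R).

(** The limit density after the volume has cancelled one Vandermonde factor and the factorials of
    [Zn]. Strict order is not imposed: the remaining factor vanishes at coincidences, so the two
    forms agree at every point. *)
Definition gtp_density n x : R :=
  (Num.sqrt (2 * pi) ^+ n)^-1 * expR (- \sum_(1 <= i < n.+1) (x n i ^+ 2 / 2)) *
  vdm n (x n) * \prod_(1 <= k < n) chi k (x k) (x k.+1).

Lemma chi_ge0 k (x y : nat -> R) : 0 <= chi k x y.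
Proof. by rewrite /chi; case: asboolP. Qed.

Lemma prod_chi_neq0 n x : \prod_(1 <= k < n) chi k (x k) (x k.+1) != 0 ->
  forall k, (1 <= k < n)%N -> forall i, (1 <= i <= k)%N ->
    x k.+1 i <= x k i <= x k.+1 i.+1.
Proof.
move=> chi0 k kn i ik; move: chi0.
rewrite (bigD1_seq k) ?mem_index_iota ?iota_uniq//= mulf_eq0 negb_or => /andP[+ _].
by rewrite /chi; case: asboolP => [h _|_]; [exact: h|rewrite eqxx].
Qed.

Lemma prod_chi_sorted n x : \prod_(1 <= k < n) chi k (x k) (x k.+1) != 0 ->
  forall i, (1 <= i < n)%N -> x n i <= x n i.+1.
Proof.
move=> chi0 i iN; have n1 : (1 <= n.-1 < n)%N by lia.
have in1 : (1 <= i <= n.-1)%N by lia.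
have := prod_chi_neq0 chi0 n1 in1; rewrite prednK; last by lia.
by move=> /andP[]; exact: le_trans.
Qed.

Lemma gtp_density_ge0 n x : (1 <= n)%N -> 0 <= gtp_density n x.
Proof.
move=> n1; rewrite /gtp_density.
have [->|chi0] := eqVneq (\prod_(1 <= k < n) chi k (x k) (x k.+1)) 0.
  by rewrite mulr0.
rewrite !mulr_ge0 ?invr_ge0 ?exprn_ge0 ?sqrtr_ge0 ?expR_ge0//; last first.
  by apply: prodr_ge0 => k _; exact: chi_ge0.
apply: vdm_ge0; exact: prod_chi_sorted.
Qed.

Lemma limit_densityE n (z : 'C(n.+1, 2).-tuple R) : (1 <= n)%N ->
  limit_density z = gtp_density n (entry z).
Proof.
move=> n1; rewrite /limit_density /gtp_density /mu1.
set C := \prod_(_ <= _ < _) chi _ _ _.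
have [->|chi0] := eqVneq C 0; first by rewrite mul0r !mulr0.
case: asboolP => [zh|zh]; last first.
  suff -> : vdm n (entry z n) = 0 by rewrite mulr0 !mul0r.
  have [i iN zi] : exists2 i, (1 <= i < n)%N & ~ (entry z n i < entry z n i.+1).
    by apply: contrapT => h; apply: zh => i iN; apply: contrapT => ?; apply: h; exists i.
  have /andP[i1 iN'] := iN.
  apply: (@vdm_coincide _ n _ i i.+1); rewrite ?i1 ?leqnn//.
  by apply/eqP; rewrite eq_le (prod_chi_sorted chi0)//= leNgt; exact/negP.
have V0 : vdm n (entry z n) != 0 by rewrite gt_eqF// vdm_gt0.
have -> : volK n (entry z n) =
    vdm n (entry z n) / \prod_(1 <= k < n) (k`!)%:R.
  by rewrite /volK lebesgue_Kset// => i iN; rewrite ltW// zh.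
have -> : \prod_(1 <= j < n.+1) \prod_(1 <= i < j)
    (entry z n j - entry z n i) ^+ 2 = vdm n (entry z n) ^+ 2.
  rewrite expr2 /vdm -big_split/=; apply: eq_bigr => j _.
  by rewrite -big_split/=.
have -> : Zn R n = Num.sqrt (2 * pi) ^+ n * \prod_(1 <= k < n) (k`!)%:R.
  rewrite /Zn; congr (_ * _); rewrite (mulrC n%:R) powRrM powR12_sqrt ?mulr_ge0 ?pi_ge0//.
  by rewrite powR_mulrn// sqrtr_ge0.
have F0 : \prod_(1 <= k < n) (k`!)%:R != 0 :> R.
  by rewrite gt_eqF// prodr_gt0// => k _; rewrite ltr0n fact_gt0.
have S0 : Num.sqrt (2 * pi) ^+ n != 0 :> R.
  by rewrite expf_neq0// gt_eqF// sqrtr_gt0 mulr_gt0// pi_gt0.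
by field; rewrite F0 S0 V0.
Qed.

End density.

(** * Local limit theorem for binomial weights *)

Section central_binomial.
Context (R : realType).
Implicit Types (M k : nat).

Definition binp M k : R := 'C(M, k)%:R / 2 ^+ M.

Lemma binp_ge0 M k : 0 <= binp M k.
Proof. by rewrite divr_ge0// exprn_ge0. Qed.

Lemma binp_gt0 M k : (k <= M)%N -> 0 < binp M k.
Proof. by move=> kM; rewrite divr_gt0 ?exprn_gt0// ltr0n bin_gt0. Qed.

Lemma binp_sub M k : (k <= M)%N -> binp M (M - k) = binp M k.
Proof. by move=> kM; rewrite /binp bin_sub. Qed.

Lemma sum_binp M : \sum_(k < M.+1) binp M k = 1.
Proof.
rewrite -mulr_suml -natr_sum.
have -> : (\sum_(k < M.+1) 'C(M, k) = 2 ^ M)%N.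
  rewrite -[2%N]/(1 + 1)%N expnDn; apply: eq_bigr => i _.
  by rewrite !exp1n !muln1.
by rewrite natrX divff// expf_neq0// pnatr_eq0.
Qed.

Lemma binp_succ M k : (k <= M)%N ->
  binp M k.+1 = binp M k * ((M%:R - k%:R) / k.+1%:R).
Proof.
move=> kM; rewrite mulrA; apply: (canRL (mulfK _)); first by rewrite pnatr_eq0.
rewrite /binp mulrAC [RHS]mulrAC; congr (_ / _).
by rewrite -natrM mulnC mul_bin_left natrM natrB// mulrC.
Qed.

(* With [u = (2 k + 1 - M) / (M + 1)] the ratio of two consecutive weights is
   [(1 - u) / (1 + u)]. *)
Lemma binp_ratio_ub (u : R) : 0 <= u < 1 -> (1 - u) / (1 + u) <= expR (- u).
Proof.
move=> /andP[u0 u1]; have u1' : 0 < 1 + u by rewrite ltr_wpDr.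
apply: le_trans (expR_ge1Dx (- u)).
rewrite ler_pdivrMr//; nra.
Qed.

(** Exact to first order, unlike the previous bound, but only for [u <= 1/2]. The previous one
    serves domination over the whole range, this one and its lower counterpart the pointwise
    limit. *)
Lemma binp_ratio_ub2 (u : R) : 0 <= u <= 2^-1 ->
  (1 - u) / (1 + u) <= expR (- (2 * u) + 4 * u ^+ 2).
Proof.
move=> /andP[u0 u1]; have u1' : 0 < 1 + u by rewrite ltr_wpDr.
apply: le_trans (expR_ge1Dx _).
rewrite ler_pdivrMr//; nra.
Qed.

Lemma binp_ratio_lb2 (u : R) : 0 <= u <= 2^-1 ->
  expR (- (2 * u) - 4 * u ^+ 2) <= (1 - u) / (1 + u).
Proof.
move=> /andP[u0 u1]; have u1' : 0 < 1 + u by rewrite ltr_wpDr.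
have u2 : 0 < 1 - u by rewrite subr_gt0 (le_lt_trans u1)// invf_lt1// ltr1n.
rewrite -[leLHS]invrK -expRN -[leRHS]invrK lef_pV2 ?posrE ?expR_gt0//; last first.
  by rewrite invr_gt0 divr_gt0.
apply: le_trans (expR_ge1Dx _).
by rewrite invf_div ler_pdivrMr//; nra.
Qed.

Definition dev M k : R := k%:R - M%:R / 2.

Lemma binp_step M k : (k < M)%N -> let u := (2 * dev M k + 1) / M.+1%:R in
  binp M k.+1 = binp M k * ((1 - u) / (1 + u)).
Proof.
move=> kM u; rewrite binp_succ; last exact: ltnW.
congr (_ * _); rewrite /u /dev -!natr1; field.
have M0 : M%:R + 1 != 0 :> R by rewrite natr1 pnatr_eq0.
have k0 : k%:R + 1 != 0 :> R by rewrite natr1 pnatr_eq0.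
rewrite k0 M0 andbT/=.
rewrite (_ : _ + _ = 2 * (k%:R + 1)); last by ring.
by rewrite mulf_neq0.
Qed.

Lemma dev_succ M k : dev M k.+1 ^+ 2 = dev M k ^+ 2 + (2 * dev M k + 1).
Proof. by rewrite /dev -(natr1 k); ring. Qed.

Lemma dev_ge M k m : (M <= k.*2.+1)%N -> (k <= m)%N -> 0 <= 2 * dev M m + 1.
Proof.
move=> Mk km; rewrite /dev mulrBr mulrCA divff// mulr1.
rewrite addrAC subr_ge0 -natrM natr1 ler_nat; lia.
Qed.

(** Telescoping: [2 * dev + 1] is the increment of [dev ^+ 2], so the exponents [u] add up to a
    difference of squares over [M.+1]. The condition on [k] keeps every [u] nonnegative. *)
Lemma binp_gauss_ub M k m : (M <= k.*2.+1)%N -> (k + m <= M)%N ->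
  binp M (k + m) <=
  binp M k * expR (- ((dev M (k + m) ^+ 2 - dev M k ^+ 2) / M.+1%:R)).
Proof.
move=> Mk; elim: m => [|m IHm] kmM.
  by rewrite addn0 subrr mul0r oppr0 expR0 mulr1.
have kmM' : (k + m < M)%N by rewrite -addnS.
pose u := (2 * dev M (k + m) + 1) / M.+1%:R : R.
rewrite addnS binp_step// -/u.
have M0 : 0 < M.+1%:R :> R by rewrite ltr0n.
have u0 : 0 <= u by rewrite divr_ge0// (dev_ge Mk)// leq_addr.
have u1 : u < 1.
  rewrite /u ltr_pdivrMr// mul1r /dev -(natr1 M).
  have : (k + m)%:R + 1 <= M%:R :> R by rewrite natr1 ler_nat.
  by lra.
apply: le_trans (ler_pM (binp_ge0 _ _) _ (IHm (ltnW kmM')) (binp_ratio_ub _)) _.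
- by rewrite divr_ge0//; [rewrite subr_ge0 ltW|rewrite addr_ge0].
- by rewrite u0 u1.
rewrite -mulrA -expRD dev_succ; apply: ler_wpM2l; first exact: binp_ge0.
by rewrite le_eqVlt; apply/orP; left; apply/eqP; congr expR; rewrite /u; field; rewrite nat1r pnatr_eq0.
Qed.

(** The number [v] bounds every [u] met on the way, so each of the [m] steps costs at most
    [4 * v ^+ 2] in the exponent. *)
Lemma binp_gauss_approx M k m (v : R) : (M <= k.*2.+1)%N -> (k + m <= M)%N ->
  v <= 2^-1 -> 2 * dev M (k + m) <= v * M.+1%:R ->
  expR (- (2 * (dev M (k + m) ^+ 2 - dev M k ^+ 2) / M.+1%:R) - 4 * v ^+ 2 * m%:R)
    <= binp M (k + m) / binp M k <=
  expR (- (2 * (dev M (k + m) ^+ 2 - dev M k ^+ 2) / M.+1%:R) + 4 * v ^+ 2 * m%:R).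
Proof.
move=> Mk + v1; elim: m => [|m IHm] kmM kv.
  have kM : (k <= M)%N by rewrite addn0 in kmM.
  rewrite addn0 subrr !(mulr0, mul0r, oppr0, addr0) expR0 divff ?lexx//.
  by rewrite gt_eqF// binp_gt0.
have kmM' : (k + m < M)%N by rewrite -addnS.
have M0 : 0 < M.+1%:R :> R by rewrite ltr0n.
have kv' : 2 * dev M (k + m) <= v * M.+1%:R.
  by apply: le_trans kv; rewrite /dev addnS -(natr1 (k + m)); lra.
have /andP[lb ub] := IHm (ltnW kmM') kv'.
pose u := (2 * dev M (k + m) + 1) / M.+1%:R : R.
rewrite addnS binp_step// [_ / binp M k]mulrAC -/u.
have u0 : 0 <= u by rewrite divr_ge0// (dev_ge Mk)// leq_addr.
have uv : u <= v.
  rewrite /u ler_pdivrMr// (le_trans _ kv)// /dev addnS -(natr1 (k + m)); lra.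
have u12 : 0 <= u <= 2^-1 by rewrite u0 (le_trans uv).
have u2v2 : u ^+ 2 <= v ^+ 2 by rewrite ler_sqr// nnegrE// (le_trans u0).
have E1 : 2 * (dev M (k + m).+1 ^+ 2 - dev M k ^+ 2) / M.+1%:R =
    2 * (dev M (k + m) ^+ 2 - dev M k ^+ 2) / M.+1%:R + 2 * u.
  by rewrite dev_succ /u; field; rewrite nat1r pnatr_eq0.
rewrite E1 -(natr1 m); move: lb ub; set e := _ / M.+1%:R => lb ub.
have vm : v ^+ 2 * (m%:R + 1) = v ^+ 2 * m%:R + v ^+ 2 by rewrite mulrDr mulr1.
rewrite -!(mulrA 4) vm; apply/andP; split.
  apply: le_trans (ler_pM (expR_ge0 _) (expR_ge0 _) lb (binp_ratio_lb2 u12)).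
  rewrite -(mulrA 4).
  by rewrite -expRD ler_expR; lra.
apply: le_trans (ler_pM _ _ ub (binp_ratio_ub2 u12)) _.
- by rewrite divr_ge0// binp_ge0.
- by rewrite divr_ge0//; lra.
rewrite -(mulrA 4).
by rewrite -expRD ler_expR; lra.
Qed.

End central_binomial.

Section local_limit.
Context (R : realType).
Implicit Types (M k : nat).

Lemma dev_sub M k : (k <= M)%N -> dev R M (M - k) = - dev R M k.
Proof. by move=> kM; rewrite /dev natrB//; lra. Qed.

Lemma dev_half M : dev R M M./2 ^+ 2 <= 4^-1.
Proof.
have E : M%:R = (odd M)%:R + M./2%:R * 2 :> R.
  by rewrite -[in LHS](odd_double_half M) natrD -muln2 natrM.
rewrite /dev E; case: (odd M); rewrite ?(mulr1n, mulr0n); nra.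
Qed.

Lemma half_le M : (M <= M./2.*2.+1)%N.
Proof. by rewrite -[leqLHS](odd_double_half M); case: odd => /=; lia. Qed.

(** The ratio estimates run upwards from the centre; symmetry of the binomial coefficients brings
    every [k] there. *)
Lemma dev_sym M k : (k <= M)%N -> exists2 m, (M./2 + m <= M)%N &
  binp R M k = binp R M (M./2 + m) /\
  dev R M (M./2 + m) = `|dev R M k|.
Proof.
move=> kM; have [h|h] := leqP M./2 k.
  (* For odd [M] the point [M./2] has deviation -1/2, so [k = M./2] has to be reflected as well. *)
  have := h; rewrite leq_eqVlt => /predU1P[hk|hk].
    exists (M - k - M./2)%N; first by lia.
    rewrite (_ : (M./2 + (M - k - M./2) = M - k)%N); last by lia.
    rewrite binp_sub// dev_sub//; split => //.
    rewrite ler0_norm// /dev subr_le0 ler_pdivlMr//.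
    by rewrite -natrM ler_nat; lia.
  exists (k - M./2)%N; first by lia.
  rewrite subnKC//; split => //.
  rewrite ger0_norm// /dev subr_ge0 ler_pdivrMr//.
  by rewrite -natrM ler_nat; have := half_le M; lia.
exists (M - k - M./2)%N; first by lia.
rewrite (_ : (M./2 + (M - k - M./2) = M - k)%N); last by lia.
rewrite binp_sub// dev_sub//; split => //.
rewrite ler0_norm// /dev subr_le0 ler_pdivlMr//.
by rewrite -natrM ler_nat; lia.
Qed.

(** The factor [expR 1] absorbs the deviation of the centre, whose square is at most 1/4. *)
Lemma binp_ub M k : binp R M k <=
  binp R M M./2 * (expR 1 * expR (- (dev R M k ^+ 2 / M.+1%:R))).
Proof.
have [kM|Mk] := leqP k M; last first.
  by rewrite /binp bin_small// mul0r mulr_ge0// ?binp_ge0// mulr_ge0// expR_ge0.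
have [m mM [-> devE]] := dev_sym kM.
apply: le_trans (binp_gauss_ub _ (half_le M) mM) _.
rewrite ler_wpM2l ?binp_ge0// -expRD ler_expR devE real_normK ?num_real//.
rewrite mulrBl opprB lerD2r ler_pdivrMr ?ltr0n// mul1r.
rewrite (le_trans (dev_half M))// -(natr1 M); have : 0 <= M%:R :> R by [].
by lra.
Qed.

(** The deviation is measured in units of half the square root of [M], and [v] is taken as
    [|x| * a]. At most [|x| / (2 * a) + 1] steps lead from the centre to [k] or its mirror image,
    which turns [4 * v ^+ 2 * m] into the stated error. The last [a ^+ 2] pays for the deviation of
    the centre. *)
Lemma binp_approx M k (a x : R) : (0 < M)%N -> a = (Num.sqrt M%:R)^-1 ->
  x = dev R M k * (2 * a) -> `|x| * a <= 2^-1 ->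
  expR (- (x ^+ 2 / 2 / (1 + a ^+ 2)) - (2 * `|x| ^+ 3 * a + 4 * x ^+ 2 * a ^+ 2))
    <= binp R M k / binp R M M./2 <=
  expR (- (x ^+ 2 / 2 / (1 + a ^+ 2)) + (2 * `|x| ^+ 3 * a + 4 * x ^+ 2 * a ^+ 2)
        + a ^+ 2).
Proof.
move=> M0 aE xE xa.
have sM0 : 0 < Num.sqrt M%:R :> R by rewrite sqrtr_gt0 ltr0n.
have a0 : 0 < a by rewrite aE invr_gt0.
have a2 : a ^+ 2 = M%:R^-1 by rewrite aE exprVn sqr_sqrtr.
have MR0 : 0 < M%:R :> R by rewrite ltr0n.
have ME : M%:R = (a ^+ 2)^-1 by rewrite a2 invrK.
have M1E : M.+1%:R = (1 + a ^+ 2) / a ^+ 2.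
  by rewrite -(natr1 M) ME; field; rewrite gt_eqF.
have D : dev R M k = x / (2 * a) by rewrite xE; field; rewrite gt_eqF.
have DN : `|dev R M k| = `|x| / (2 * a).
  by rewrite D normrM [X in _ * X]ger0_norm// invr_ge0 mulr_ge0// ltW.
have kM : (k <= M)%N.
  rewrite -(ler_nat R); have : dev R M k <= `|x| / (2 * a).
    by rewrite -DN ler_norm.
  have : `|x| / (2 * a) <= M%:R / 4.
    rewrite ME ler_pdivrMr ?mulr_gt0//.
    have -> : (a ^+ 2)^-1 / 4 * (2 * a) = (2 * a)^-1 by field; rewrite gt_eqF.
    by rewrite -[leRHS]mul1r ler_pdivlMr ?mulr_gt0//; lra.
  by rewrite /dev; lra.
have [m mM [-> devE]] := dev_sym kM.
have v1 : `|x| * a <= 2^-1 := xa.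
have kv : 2 * dev R M (M./2 + m) <= `|x| * a * M.+1%:R.
  rewrite devE DN M1E.
  rewrite (_ : 2 * (`|x| / (2 * a)) = `|x| / a); last by field; rewrite gt_eqF.
  rewrite (_ : `|x| * a * ((1 + a ^+ 2) / a ^+ 2) = `|x| / a + `|x| * a).
    by rewrite lerDl mulr_ge0// ltW.
  by field; rewrite gt_eqF.
have := binp_gauss_approx (half_le M) mM v1 kv.
rewrite devE real_normK ?num_real//.
have x0 : 0 <= `|x| by [].
set d := dev R M M./2.
have d0 : 0 <= d ^+ 2 by rewrite sqr_ge0.
have d4 : d ^+ 2 <= 4^-1 by exact: dev_half.
have mE : m%:R <= `|x| / (2 * a) + 1.
  rewrite -DN -devE /dev natrD.
  have : M./2%:R * 2 <= M%:R + 0 :> R by rewrite addr0 -natrM ler_nat; lia.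
  have : M%:R <= M./2%:R * 2 + 1 :> R.
    by rewrite -natrM natr1 ler_nat; have := half_le M; lia.
  lra.
have p1 : 0 < 1 + a ^+ 2 by rewrite ltr_wpDr ?sqr_ge0.
have E2 : 2 * (dev R M k ^+ 2 - d ^+ 2) / M.+1%:R =
    x ^+ 2 / 2 / (1 + a ^+ 2) - 2 * d ^+ 2 * (a ^+ 2 / (1 + a ^+ 2)).
  by rewrite D M1E; field; rewrite (gt_eqF a0) (gt_eqF p1).
have q1 : 0 <= a ^+ 2 / (1 + a ^+ 2) <= a ^+ 2.
  apply/andP; split; first by rewrite divr_ge0 ?sqr_ge0// ltW.
  by rewrite ler_pdivrMr// mulrDr mulr1 lerDl mulr_ge0 ?sqr_ge0.
have E3 : 4 * (`|x| * a) ^+ 2 * m%:R <= 2 * `|x| ^+ 3 * a + 4 * x ^+ 2 * a ^+ 2.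
  apply: le_trans (ler_wpM2l _ mE) _; first by rewrite mulr_ge0// sqr_ge0.
  rewrite le_eqVlt; apply/orP; left; apply/eqP.
  rewrite exprMn real_normK ?num_real// -[in LHS](real_normK (num_real x)).
  rewrite -[in RHS](real_normK (num_real x)).
  by field; rewrite gt_eqF.
move=> /andP[lb ub]; apply/andP; split.
  apply: le_trans lb; rewrite ler_expR E2.
  move: q1 => /andP[q0 q1]; have : 0 <= d ^+ 2 * (a ^+ 2 / (1 + a ^+ 2)) by rewrite mulr_ge0.
  by move: E3; lra.
apply: le_trans ub _; rewrite ler_expR E2.
move: q1 => /andP[q0 q1].
have : d ^+ 2 * (a ^+ 2 / (1 + a ^+ 2)) <= 4^-1 * a ^+ 2 by rewrite ler_pM.
have : 0 <= a ^+ 2 by rewrite sqr_ge0.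
by move: E3; lra.
Qed.

End local_limit.

(** * Limits of binomial ratios *)

Section local_limit_sequences.
Context (R : realType).

Lemma cvg_inv_sqrt_shift n :
  (Num.sqrt (N + n.+1)%:R)^-1 @[N --> \oo] --> (0 : R).
Proof.
have h : (Num.sqrt N.+1%:R)^-1 @[N --> \oo] --> (0 : R).
  rewrite (_ : (fun _ => _) = Num.sqrt \o (@harmonic R)).
    rewrite -[X in _ --> X](sqrtr0 R).
    apply: (cvg_comp _ Num.sqrt (@cvg_harmonic R)).
    exact: sqrt_continuous.
  by apply/funext => N /=; rewrite sqrtrV.
move: h; rewrite -(cvg_shiftn n) /=.
by rewrite (_ : (fun N => (Num.sqrt (N + n).+1%:R)^-1) =
  (fun N => (Num.sqrt (N + n.+1)%:R)^-1))//; apply/funext => N; rewrite addnS.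
Qed.

(** One form for both sides of a squeeze: [c = -1], [d = 0] below and [c = d = 1] above. *)
Lemma cvg_gauss_error (x a : nat -> R) (l c d : R) :
  x N @[N --> \oo] --> l -> a N @[N --> \oo] --> 0 ->
  expR (- (x N ^+ 2 / 2 / (1 + a N ^+ 2)) +
    (c * (2 * `|x N| ^+ 3 * a N + 4 * x N ^+ 2 * a N ^+ 2) + d * a N ^+ 2))
  @[N --> \oo] --> expR (- (l ^+ 2 / 2)).
Proof.
move=> xl a0.
have x2 : x N ^+ 2 @[N --> \oo] --> l ^+ 2 by rewrite expr2; exact: cvgM.
have a2 : a N ^+ 2 @[N --> \oo] --> 0 by rewrite -(mulr0 0); exact: cvgM.
have nx : `|x N| @[N --> \oo] --> `|l| by exact: cvg_norm.
have nx3 : `|x N| ^+ 3 @[N --> \oo] --> `|l| ^+ 3.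
  by rewrite !exprS !expr0 !mulr1; apply: cvgM => //; exact: cvgM.
have -> : - (l ^+ 2 / 2) = - (l ^+ 2 / 2 / (1 + 0)) +
    (c * (2 * `|l| ^+ 3 * 0 + 4 * l ^+ 2 * 0) + d * 0).
  by rewrite !(mulr0, addr0, divr1).
apply: (cvg_comp _ expR); last exact: continuous_expR.
have cc (r : R) : (fun=> r) x @[x --> \oo] --> r by exact: cvg_cst.
apply: cvgD; [apply: cvgN; apply: cvgM|apply: cvgD; apply: cvgM => //].
- exact: (cvgM x2 (cc _)).
- by apply: cvgV; [rewrite addr0|exact: (cvgD (cc _) a2)].
- by apply: cvgD; apply: cvgM => //; exact: (cvgM (cc _)).
Qed.

Lemma binp_ratio_cvg n (k : nat -> nat) (l : R) :
  dev R (N + n.+1) (k N) * (2 * (Num.sqrt (N + n.+1)%:R)^-1) @[N --> \oo] --> l ->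
  binp R (N + n.+1) (k N) / binp R (N + n.+1) (N + n.+1)./2 @[N --> \oo]
    --> expR (- (l ^+ 2 / 2)).
Proof.
set x := (x in x @ _ --> _) => xl.
pose a N : R := (Num.sqrt (N + n.+1)%:R)^-1.
have a0 : a N @[N --> \oo] --> 0 by exact: cvg_inv_sqrt_shift.
apply: squeeze_cvgr (cvg_gauss_error (-1) 0 xl a0) (cvg_gauss_error 1 1 xl a0).
have xa : `|x N| * a N @[N --> \oo] --> 0.
  by rewrite -(mulr0 `|l|); apply: cvgM => //; exact: cvg_norm.
near=> N.
have N0 : (0 < N + n.+1)%N by rewrite addnS.
have xaN : `|x N| * a N <= 2^-1.
  by near: N; apply: (cvgr_le _ xa); rewrite invr_gt0.
have /andP[lb ub] := binp_approx N0 erefl erefl xaN.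
have a20 : 0 <= a N ^+ 2 by rewrite sqr_ge0.
apply/andP; split; last first.
  by apply: le_trans ub _; rewrite ler_expR /a /x; lra.
by apply: le_trans lb; rewrite ler_expR /a /x; lra.
Unshelve. all: by end_near. Qed.

End local_limit_sequences.

(** * Rescaled lattice *)

Section rounding.
Context (R : realType).

(* The rescaled process at time [N.+1] lives on the lattice of mesh [mesh N]
   whose point of index [q] is [rval N q]. *)
Definition mesh (N : nat) : R := 2 / Num.sqrt N.+1%:R.
Definition center (N : nat) : R := N.+1%:R / 2.
Definition rnd N (a : R) : nat := grid (mesh N) (center N) a.
Definition rval N (q : nat) : R := (q%:R - center N) * mesh N.

Lemma sqrtS_gt0 N : 0 < Num.sqrt N.+1%:R :> R.
Proof. by rewrite sqrtr_gt0 ltr0n. Qed.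

Lemma sqrtS_ge1 N : 1 <= Num.sqrt N.+1%:R :> R.
Proof. by rewrite -[leLHS]sqrtr1 ler_sqrt ?ler1n. Qed.

Lemma mesh_gt0 N : 0 < mesh N.
Proof. by rewrite divr_gt0// sqrtS_gt0. Qed.

Lemma mesh_le2 N : mesh N <= 2.
Proof. by rewrite ler_pdivrMr ?sqrtS_gt0// ler_peMr// sqrtS_ge1. Qed.

Lemma mesh_cvg0 : mesh N @[N --> \oo] --> 0.
Proof.
rewrite -(mulr0 2); apply: cvgM; first exact: cvg_cst.
rewrite (_ : (fun N => _) = (fun N => (Num.sqrt (N + 1)%:R)^-1)).
  exact: cvg_inv_sqrt_shift.
by apply/funext => N; rewrite addn1.
Qed.

Lemma divr_mesh N (a : R) :
  a / mesh N + center N = Num.sqrt N.+1%:R * (a + Num.sqrt N.+1%:R) / 2.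
Proof.
have s0 := sqrtS_gt0 N; rewrite /center -[X in X / 2]sqr_sqrtr// /mesh.
by field; rewrite gt_eqF.
Qed.

Lemma rnd_in N (a : R) : `|a| <= Num.sqrt N.+1%:R ->
  0 <= a / mesh N + center N /\ (rnd N a < N.+2)%N.
Proof.
have s0 := sqrtS_gt0 N; rewrite ler_norml => /andP[a1 a2].
have p : 0 <= a / mesh N + center N.
  by rewrite divr_mesh divr_ge0//; apply: mulr_ge0; [exact: ltW|lra].
split => //; rewrite -(ltr_nat R) /rnd /grid; have /andP[+ _] := truncn_itv p.
move/le_lt_trans; apply; rewrite divr_mesh -(natr1 N.+1) -[X in _ < X + 1]sqr_sqrtr//.
apply: (@le_lt_trans _ _ (Num.sqrt N.+1%:R ^+ 2)); last by rewrite ltrDl.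
by rewrite ler_pdivrMr// expr2 -mulrA ler_pM2l//; lra.
Qed.

Lemma near_rnd_in (a : R) : \forall N \near \oo, `|a| <= Num.sqrt N.+1%:R.
Proof.
near=> N; rewrite -sqrtr_sqr ler_sqrt// (@le_trans _ _ N%:R)//.
  by near: N; exact: nbhs_infty_ger.
by rewrite ler_nat.
Unshelve. all: by end_near. Qed.

Lemma rval_rnd N (a : R) : 0 <= a / mesh N + center N ->
  a - mesh N <= rval N (rnd N a) <= a.
Proof.
move=> p; have h0 := mesh_gt0 N; rewrite /rval /rnd /grid.
have /andP[] := truncn_itv p; rewrite -(natr1 (Num.truncn _)) => h1 h2.
apply/andP; split.
  by rewrite -ler_pdivrMr// mulrBl divff ?gt_eqF//; lra.
by rewrite -ler_pdivlMr//; lra.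
Qed.

Lemma rval_rnd_cvg (a : R) : rval N (rnd N a) @[N --> \oo] --> a.
Proof.
apply: (@squeeze_cvgr _ _ _ _ (fun N => a - mesh N) (fun=> a)).
- by near=> N; apply: rval_rnd; have [] := @rnd_in N a; first by near: N; exact: near_rnd_in.
- by rewrite -[X in _ --> X]subr0; apply: cvgB; [exact: cvg_cst|exact: mesh_cvg0].
- exact: cvg_cst.
Unshelve. all: by end_near. Qed.

(** Carries a Gaussian bound from a lattice point to its whole cell: rounding moves [a] by at most
    2, and a squared sum is at most twice the sum of squares. *)
Lemma rval_rnd_sqr N (a : R) : 0 <= a / mesh N + center N ->
  a ^+ 2 <= 2 * rval N (rnd N a) ^+ 2 + 8.
Proof.
move=> /rval_rnd /andP[r1 r2]; have := mesh_le2 N; have := mesh_gt0 N.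
set r := rval _ _ in r1 r2 * => h0 h2.
have q1 : 0 <= (2 * r - a) ^+ 2 by rewrite sqr_ge0.
have q2 : (a - r) ^+ 2 <= 2 ^+ 2 by rewrite ler_sqr ?nnegrE//; lra.
by nra.
Qed.

(** The offset [o] between the centres of the lattice and of the binomial law is split off by
    [(u - o) ^+ 2 >= u ^+ 2 / 2 - o ^+ 2]. With [(N + n.+1).+1 <= N.+1 * n.+2] this gives the
    constant [8 * n.+2]. *)
Lemma binp_offset_ub N n k (r o : R) :
  dev R (N + n.+1) k = r * (Num.sqrt N.+1%:R / 2) - o ->
  binp R (N + n.+1) k <= binp R (N + n.+1) (N + n.+1)./2 *
    (expR (1 + o ^+ 2) * expR (- (r ^+ 2 / (8 * n.+2%:R)))).
Proof.
move=> dE; apply: le_trans (binp_ub _ _ _) _.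
rewrite ler_wpM2l ?binp_ge0// -!expRD ler_expR -addrA lerD2l.
have N1 : 0 < N.+1%:R :> R by [].
have s2 : Num.sqrt N.+1%:R ^+ 2 = N.+1%:R :> R by rewrite sqr_sqrtr.
have d2 : r ^+ 2 * N.+1%:R / 8 - o ^+ 2 <= dev R (N + n.+1) k ^+ 2.
  have -> : r ^+ 2 * N.+1%:R / 8 = (r * (Num.sqrt N.+1%:R / 2)) ^+ 2 / 2.
    by rewrite !exprMn s2; field.
  rewrite dE; set u := r * _; have : 0 <= (u - 2 * o) ^+ 2 by rewrite sqr_ge0.
  by nra.
have M1 : 1 <= (N + n.+1).+1%:R :> R by rewrite ler1n.
have M0 : 0 < (N + n.+1).+1%:R :> R by [].
rewrite -[leRHS]opprK lerN2 opprD opprK ler_pdivlMr//.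
apply: le_trans d2.
rewrite mulrDl mulNr.
have : o ^+ 2 <= o ^+ 2 * (N + n.+1).+1%:R by rewrite ler_peMr// sqr_ge0.
have : r ^+ 2 / (8 * n.+2%:R) * (N + n.+1).+1%:R <= r ^+ 2 * N.+1%:R / 8.
  rewrite -[leLHS]mulrA -[leRHS]mulrA; apply: ler_wpM2l; first exact: sqr_ge0.
  rewrite mulrC ler_pdivrMr ?mulr_gt0//.
  have : (N + n.+1).+1%:R <= N.+1%:R * n.+2%:R :> R.
    by rewrite -natrM ler_nat mulnS mulSn; lia.
  by lra.
by move=> h1 h2; rewrite addrC; exact: lerB.
Qed.

(** The weights divided by the central one sum to its inverse, since the total mass is 1, and
    converge to an unnormalised Gaussian; the limit is therefore the Gaussian integral. *)
Lemma binp_center_cvg1 :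
  mesh N / binp R (N + 1) (N + 1)./2 @[N --> \oo] --> Num.sqrt (2 * pi).
Proof.
pose F N (s : seq nat) : R := binp R (N + 1) (nth 0%N s 0) / binp R (N + 1) (N + 1)./2.
have c0 N : 0 < binp R (N + 1) (N + 1)./2.
  by apply: binp_gt0; rewrite -[leqRHS]odd_double_half; lia.
pose H (z : 1.-tuple R) : R := \prod_(i < 1) expR (- (2^-1 * tnth z i ^+ 2)).
(* [binp_offset_ub] with offset 0 has rate 1/16 and constant [expR 1]; passing to the cell halves
   the rate and adds 1/4 to the exponent of the constant. *)
pose G (z : 1.-tuple R) : R := expR 2 * \prod_(i < 1) expR (- (32^-1 * tnth z i ^+ 2)).
have FE N (z : 1.-tuple R) : F N (map (rnd N) z) =
    binp R (N + 1) (rnd N (tnth z ord0)) / binp R (N + 1) (N + 1)./2.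
  by rewrite /F (nth_map 0) ?size_tuple// (tnth_nth 0).
have devE N q : dev R (N + 1) q = rval N q * (Num.sqrt N.+1%:R / 2) - 0.
  rewrite /rval /dev /center /mesh addn1; field; rewrite gt_eqF// sqrtS_gt0//.
have [||||||_ cv] := @step_cvg R 1 mesh center (fun N => N.+2) F H G.
- exact: mesh_gt0.
- by move=> N s; rewrite divr_ge0// binp_ge0.
- apply: (measurable_tnth_prod (f := fun i x => expR (- (2^-1 * x ^+ 2)))) => i.
  exact: measurable_gauss.
- apply: aeW => z; rewrite /H big_ord1; set a := tnth z ord0.
  have E : \forall N \near \oo, F N (map (rnd N) z) = step (mesh N) (center N) N.+2 (F N) z.
    near=> N; rewrite stepE ?mesh_gt0// ifT//; apply/forallP => i.
    have [p q] : 0 <= tnth z i / mesh N + center N /\ (rnd N (tnth z i) < N.+2)%N.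
      by apply: rnd_in; rewrite (ord1 i); near: N; exact: near_rnd_in.
    by rewrite p.
  apply: (cvg_trans (near_eq_cvg E)); rewrite mulrC -/(_ / _).
  under eq_fun do rewrite FE.
  apply: (@binp_ratio_cvg _ 0).
  rewrite (_ : (fun N => _) = (fun N => rval N (rnd N a))); first exact: rval_rnd_cvg.
  apply/funext => N; rewrite devE subr0 addn1; field; rewrite gt_eqF// sqrtS_gt0//.
- exact: integrable_gauss_prod.
- move=> N z; rewrite stepE ?mesh_gt0//; case: ifPn => [/forallP zL|_]; last first.
    by rewrite mulr_ge0 ?expR_ge0// prodr_ge0// => i _; exact: expR_ge0.
  rewrite FE /G big_ord1 ler_pdivrMr// mulrC.
  apply: le_trans (binp_offset_ub (devE _ _)) _.
  rewrite ler_wpM2l ?binp_ge0// -!expRD ler_expR expr0n/= addr0.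
  have /andP[p _] := zL ord0.
  have := rval_rnd_sqr p; set r := rval _ _; set a := tnth _ _.
  by lra.
rewrite /H integral_gauss_prod ?invr_gt0// expr1 invrK mulrC in cv.
have SE N : mesh N ^+ 1 * \sum_(x : 1.-tuple 'I_N.+2) F N (map val x) =
    mesh N / binp R (N + 1) (N + 1)./2.
  rewrite expr1; congr (_ * _).
  rewrite (reindex (fun k : 'I_N.+2 => [tuple k])); last first.
    apply: onW_bij; exists (fun x => tnth x ord0) => [k|x].
      by rewrite (tnth_nth k).
    by apply: eq_from_tnth => i; rewrite (ord1 i) (tnth_nth (thead x)).
  rewrite /F /= -mulr_suml -[X in X / _](_ : 1 = _) ?mul1r//.
  by rewrite addn1 sum_binp.
under eq_fun do rewrite -SE.
by have /fine_cvgP[_ cv1] := cv; exact: cv1.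
Unshelve. all: by end_near. Qed.

Lemma shift_ratio_cvg a : (N + a).+1%:R / N.+1%:R @[N --> \oo] --> (1 : R).
Proof.
have -> : (fun N => (N + a).+1%:R / N.+1%:R) = (fun N => 1 + a%:R * N.+1%:R^-1 : R).
  by apply/funext => N; rewrite -addSn natrD mulrDl divff.
rewrite -[X in _ --> X](_ : 1 + a%:R * 0 = 1); last by rewrite mulr0 addr0.
apply: cvgD; first exact: cvg_cst.
by apply: cvgM; [exact: cvg_cst|exact: cvg_harmonic].
Qed.

Lemma sqrt_shift_ratio_cvg a :
  Num.sqrt ((N + a).+1%:R / N.+1%:R) @[N --> \oo] --> (1 : R).
Proof.
rewrite -[X in _ --> X]sqrtr1; apply: continuous_cvg; last exact: shift_ratio_cvg.
exact: sqrt_continuous.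
Qed.

Lemma binp_center_cvg n :
  mesh N / binp R (N + n.+1) (N + n.+1)./2 @[N --> \oo] --> Num.sqrt (2 * pi).
Proof.
have c1 := binp_center_cvg1; rewrite -(cvg_shiftn n) in c1.
have -> : (fun N => mesh N / binp R (N + n.+1) (N + n.+1)./2) =
    (fun N => mesh (N + n) / binp R (N + n + 1) (N + n + 1)./2 *
      Num.sqrt ((N + n).+1%:R / N.+1%:R)).
  apply/funext => N; rewrite -addnA addn1 /mesh sqrtrM ?ler0n// sqrtrV ?ler0n//.
  have c0 : binp R (N + n.+1) (N + n.+1)./2 != 0.
    by rewrite gt_eqF// binp_gt0// -[leqRHS]odd_double_half; lia.
  by field; rewrite c0 !gt_eqF// sqrtS_gt0.
by rewrite -[X in _ --> X]mulr1; apply: cvgM => //; exact: sqrt_shift_ratio_cvg.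
Qed.

End rounding.

(** * The rescaled law *)

Section scaled_line_law.
Context (R : realType).
Local Notation mesh := (mesh R).
Local Notation rval := (rval R).

(* At time [N.+1] the binomial coefficients in [krawt] are those of
   [N.+1 + n.-1 = N + n]. *)
Definition bfac N n q : R := (mesh N)^-1 * (2 ^- (N + n) * binz R (N + n) (q%:Z - 1)).

(** What is left of the factorials once each missing factor is replaced by [N.+1]; it tends to 1. *)
Definition krawt_scale N n : R :=
  \prod_(i < n) (N.+1%:R ^+ i * (N.+1 + n - i.+1)`!%:R / (N.+1 + n.-1)`!%:R).

Lemma bfac_ge0 N n q : 0 <= bfac N n q.
Proof.
rewrite mulr_ge0 ?invr_ge0 ?(ltW (mesh_gt0 _ _))// mulr_ge0 ?invr_ge0//.
by rewrite /binz; case: ifP.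
Qed.

Lemma bfacE N n q : bfac N n q = if q is q'.+1 then binp R (N + n) q' / mesh N else 0.
Proof.
rewrite /bfac /binz; case: q => [|q] /=; first by rewrite !mulr0.
by rewrite subn1/= mulrC /binp [2 ^- _ * _]mulrC.
Qed.

Lemma prod_pairs_const n (a : R) :
  \prod_(1 <= j < n.+1) \prod_(1 <= i < j) a = a ^+ 'C(n, 2).
Proof.
elim: n => [|n IHn]; first by rewrite big_nil expr0.
rewrite big_nat_recr//= IHn prodr_const_nat -exprD binS bin1; congr (_ ^+ _); lia.
Qed.

Lemma vdm_scale n (a : R) (y : nat -> R) :
  vdm n (fun i => y i * a) = a ^+ 'C(n, 2) * vdm n y.
Proof.
rewrite -prod_pairs_const /vdm -big_split/=; apply: eq_bigr => j _.
by rewrite -big_split/=; apply: eq_bigr => i _; rewrite -mulrBl mulrC.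
Qed.

Lemma sum_ord_bin2 n : (\sum_(i < n) i = 'C(n, 2))%N.
Proof.
by elim: n => [|n IHn]; rewrite ?big_ord0// big_ord_recr/= IHn binS bin1 addnC.
Qed.

(** Of the ['C(n.+1, 2) = n + 'C(n, 2)] inverse meshes, [n] go to the binomial factors. The others,
    as many again from rescaling the Vandermonde product, and the power of 2 due to replacing [N.+1]
    by [N + n] combine into powers of [N.+1 = (2 / mesh N) ^+ 2]. *)
Lemma krawt_scaled N n (q : nat -> nat) : (1 <= n)%N ->
  mesh N ^- 'C(n.+1, 2) * krawt R n N.+1 (fun i => (q i)%:Z) =
  krawt_scale N n * (\prod_(i < n) bfac N n (q i.+1)) * vdm n (fun i => rval N (q i)).
Proof.
move=> n1; have h0 := mesh_gt0 R N; have h0' := lt0r_neq0 h0.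
have vE : vdm n (fun i => rval N (q i)) =
    mesh N ^+ 'C(n, 2) * vdm n (fun i => ((q i)%:Z)%:~R : R).
  rewrite vdm_scale; congr (_ * _); rewrite /vdm; apply: eq_bigr => j _.
  by apply: eq_bigr => i _; ring.
have sE : \prod_(i < n) N.+1%:R ^+ i = (2 / mesh N) ^+ (2 * 'C(n, 2)) :> R.
  rewrite -expr_sum sum_ord_bin2 exprM /mesh invf_div mulrCA divff// mulr1.
  by rewrite sqr_sqrtr.
have n2 : (2 * 'C(n, 2) = n * n.-1)%N by rewrite -(mul_bin_diag n 1) bin1.
have tE : 2 ^- N.+1 ^+ n = 2 ^- (N + n) ^+ n * 2 ^+ (2 * 'C(n, 2)) :> R.
  rewrite n2 mulnC exprM -exprMn; congr (_ ^+ _).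
  have -> : (N + n = N.+1 + n.-1)%N by lia.
  by rewrite exprD invfM -mulrA mulVf ?mulr1// expf_neq0.
rewrite vE /krawt /krawt_scale /bfac !big_split/= !prodr_const card_ord.
rewrite (_ : N.+1 + n.-1 = N + n)%N; last by lia.
rewrite sE tE binS bin1.
move: (\prod_(i < n) binz _ _ _) (vdm _ _) (\prod_(i < n) _`!%:R) (2 ^- _ ^+ n) ((N + n)`!%:R^-1 ^+ n) => B V A C F.
move: (mesh N) h0' => h h0'.
rewrite addnC exprD invfM mul2n -addnn !exprD !expr_div_n !exprVn.
by field; rewrite !expf_neq0.
Qed.

Lemma fact_ratio_cvg n i : (i <= n)%N ->
  N.+1%:R ^+ i * (N.+1 + n - i)`!%:R / (N.+1 + n)`!%:R @[N --> \oo] --> (1 : R).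
Proof.
elim: i => [|i IHi] iN.
  under eq_fun do rewrite expr0 mul1r subn0 divff ?pnatr_eq0 -?lt0n ?fact_gt0//.
  exact: cvg_cst.
have -> : (fun N => N.+1%:R ^+ i.+1 * (N.+1 + n - i.+1)`!%:R / (N.+1 + n)`!%:R) =
    (fun N => N.+1%:R ^+ i * (N.+1 + n - i)`!%:R / (N.+1 + n)`!%:R *
      ((N + (n - i)).+1%:R / N.+1%:R)^-1) :> (nat -> R).
  apply/funext => N.
  rewrite exprS (_ : N.+1 + n - i = (N.+1 + n - i.+1).+1)%N; last by lia.
  rewrite factS natrM (_ : (N.+1 + n - i.+1).+1 = (N + (n - i)).+1)%N; last by lia.
  have f0 : (N.+1 + n)`!%:R != 0 :> R by rewrite pnatr_eq0 -lt0n fact_gt0.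
  have a0 : N.+1%:R != 0 :> R by [].
  have b0 : (N + (n - i)).+1%:R != 0 :> R by [].
  move: f0 a0 b0; move: (N.+1%:R : R) ((N + (n - i)).+1%:R : R) ((N.+1 + n)`!%:R : R).
  move=> a b f f0 a0 b0.
  by field; rewrite f0 a0 b0.
rewrite -[X in _ --> X](_ : 1 * 1^-1 = 1); last by rewrite invr1 mulr1.
apply: cvgM; first exact/IHi/ltnW.
by apply: cvgV; [exact: oner_neq0|exact: shift_ratio_cvg].
Qed.

(** The binomial argument is [q - 1] and its mean [(N + n.+1) / 2], while the lattice is centred at
    [N.+1 / 2]: the offset is [1 + n / 2]. *)
Lemma dev_pred N n q : (0 < q)%N ->
  dev R (N + n.+1) q.-1 = rval N q * (Num.sqrt N.+1%:R / 2) - n.+2%:R / 2.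
Proof.
case: q => // q _; have s0 := lt0r_neq0 (sqrtS_gt0 R N).
have -> : rval N q.+1 * (Num.sqrt N.+1%:R / 2) = q.+1%:R - N.+1%:R / 2.
  by rewrite /rval /center /mesh; field.
by rewrite /dev natrD/= -(natr1 N) -(natr1 n.+1) -(natr1 n) -(natr1 q); field.
Qed.

(** Keeps away from the index 0, where the predecessor in [dev_pred] would be truncated. *)
Lemma near_rnd_gt0 (a : R) : \forall N \near \oo, (0 < rnd N a)%N.
Proof.
near=> N; rewrite /rnd /grid truncn_gt0 divr_mesh.
have : `|(`|a| + 2)| <= Num.sqrt N.+1%:R by near: N; exact: near_rnd_in.
rewrite ger0_norm ?addr_ge0// => sa; have := sqrtS_ge1 R N.
have := ler_norm (- a); rewrite normrN => na s1.
rewrite ler_pdivlMr// -[leLHS]mulr1 mulrC ler_pM//; lra.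
Unshelve. all: by end_near. Qed.

Lemma cvg_bfac n a : bfac N n.+1 (rnd N a) @[N --> \oo] -->
  (Num.sqrt (2 * pi))^-1 * expR (- (a ^+ 2 / 2)).
Proof.
have q1 := near_rnd_gt0 a.
have c0 N : binp R (N + n.+1) (N + n.+1)./2 != 0.
  by rewrite gt_eqF// binp_gt0// -[leqRHS]odd_double_half; lia.
have s0 : Num.sqrt (2 * pi) != 0 :> R by rewrite gt_eqF// sqrtr_gt0 mulr_gt0// pi_gt0.
have E : \forall N \near \oo, (mesh N / binp R (N + n.+1) (N + n.+1)./2)^-1 *
   (binp R (N + n.+1) (rnd N a).-1 / binp R (N + n.+1) (N + n.+1)./2) = bfac N n.+1 (rnd N a).
  near=> N; rewrite bfacE; have : (0 < rnd N a)%N by near: N.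
  case: (rnd N a) => [//|q _] /=.
  by field; rewrite c0 gt_eqF// mesh_gt0.
apply: cvg_trans (near_eq_cvg E) _; apply: cvgM.
  by apply: cvgV => //; exact: binp_center_cvg.
apply: binp_ratio_cvg.
(* The shift of the centre and the change of scale from [N.+1] to [N + n.+1] both disappear in the
   limit. *)
have E2 : \forall N \near \oo,
    rval N (rnd N a) * (Num.sqrt ((N + n).+1%:R / N.+1%:R))^-1 -
      n.+2%:R * (Num.sqrt (N + n.+1)%:R)^-1 =
    dev R (N + n.+1) (rnd N a).-1 * (2 / Num.sqrt (N + n.+1)%:R).
  near=> N; rewrite dev_pred; last by near: N.
  rewrite -addnS sqrtrM ?ler0n// sqrtrV ?ler0n//.
  by field; rewrite addnS !gt_eqF// sqrtS_gt0.
apply: cvg_trans (near_eq_cvg E2) _.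
have {2}-> : a = a * 1^-1 - n.+2%:R * 0 by rewrite invr1 mulr1 mulr0 subr0.
apply: cvgB; apply: cvgM.
- exact: rval_rnd_cvg.
- by apply: cvgV; [exact: oner_neq0|exact: sqrt_shift_ratio_cvg].
- exact: cvg_cst.
- exact: cvg_inv_sqrt_shift.
Unshelve. all: by end_near. Qed.

Lemma bfac_ub n : exists2 C : R, 0 < C & forall N q,
  bfac N n.+1 q <= C * expR (- (rval N q ^+ 2 / (8 * n.+2%:R))).
Proof.
have s0 : Num.sqrt (2 * pi) != 0 :> R by rewrite gt_eqF// sqrtr_gt0 mulr_gt0// pi_gt0.
have cv : (mesh N / binp R (N + n.+1) (N + n.+1)./2)^-1 @[N --> \oo] -->
    (Num.sqrt (2 * pi))^-1 by apply: cvgV => //; exact: binp_center_cvg.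
have [A Au] := cvg_has_ub (cvgP _ cv).
pose o : R := n.+2%:R / 2.
have A0 : 0 <= A by apply: le_trans (normr_ge0 _) (Au _ _); exists 0%N.
exists ((A + 1) * expR (1 + o ^+ 2)); first by rewrite mulr_gt0 ?expR_gt0// ltr_wpDl.
move=> N q; have h0 := mesh_gt0 R N; rewrite bfacE; case: q => [|q].
  by rewrite !mulr_ge0 ?expR_ge0// addr_ge0.
have := binp_offset_ub (dev_pred N n (ltn0Sn q)); rewrite /= -/o => qu.
rewrite ler_pdivrMr//; apply: le_trans qu _; rewrite -(mulrA (A + 1)) [leRHS]mulrAC ler_wpM2r ?mulr_ge0 ?expR_ge0//.
rewrite -ler_pdivrMr//; have : (mesh N / binp R (N + n.+1) (N + n.+1)./2)^-1 <= A.
  by apply: le_trans (ler_norm _) (Au _ _); exists N.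
by rewrite invf_div => /le_trans; apply; rewrite lerDl.
Qed.

Lemma cvg_prod_ord n (f : nat -> 'I_n -> R) (l : 'I_n -> R) :
  (forall i, f N i @[N --> \oo] --> l i) ->
  \prod_(i < n) f N i @[N --> \oo] --> \prod_(i < n) l i.
Proof.
elim: n f l => [|n IHn] f l fl.
  by under eq_fun do rewrite big_ord0; rewrite big_ord0; exact: cvg_cst.
under eq_fun do rewrite big_ord_recl; rewrite big_ord_recl.
by apply: cvgM => //; apply: (IHn (fun N i => f N (lift ord0 i))).
Qed.

Lemma cvg_krawt_scale n : (1 <= n)%N -> krawt_scale N n @[N --> \oo] --> (1 : R).
Proof.
case: n => // n _; have -> : 1 = \prod_(i < n.+1) 1 :> R by rewrite big1.
apply: cvg_prod_ord => i; have := @fact_ratio_cvg n i (leq_ord i).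
by under eq_fun do rewrite -[(_ - i)%N]subSS -addnS.
Qed.

End scaled_line_law.

(** * Gaussian domination of the rescaled law *)

Section scaled_pmf.
Context (R : realType).
Local Notation mesh := (mesh R).
Local Notation rval := (rval R).
Implicit Types (n N k i : nat) (s : seq nat).

Definition lattice_pattern s k i : int := (nth 0%N s ('C(k, 2) + i.-1))%:Z.

(** By [aztec_pmf] at time [N.+1]: the probability of a pattern over the volume of a cell. *)
Definition scaled_pmf n N s : R := mesh N ^- 'C(n.+1, 2) *
  (`[< gt_upto n (lattice_pattern s) >]%:R * krawt R n N.+1 (lattice_pattern s n)).

Lemma scaled_pmf_ge0 n N s : (1 <= n)%N -> 0 <= scaled_pmf n N s.
Proof.
move=> n1; rewrite /scaled_pmf mulr_ge0 ?invr_ge0 ?exprn_ge0 ?(ltW (mesh_gt0 _ _))//.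
case: asboolP => [g|_]; last by rewrite mul0r.
by rewrite mul1r krawt_ge0// => i; exact: gt_upto_increasing.
Qed.

Lemma pattern_indexP n l : (l < 'C(n.+1, 2))%N ->
  exists k i, [/\ (1 <= i <= k)%N, (k <= n)%N & l = ('C(k, 2) + i.-1)%N].
Proof.
elim: n => [//|n IHn]; rewrite binS bin1 => ln.
have [/IHn[k [i [ik kn ->]]]|nl] := ltnP l 'C(n.+1, 2).
  by exists k, i; split => //; exact: leqW.
by exists n.+1, (l - 'C(n.+1, 2)).+1; split => //=; lia.
Qed.

Lemma pattern_index_lt n k i : (1 <= i <= k)%N -> (k <= n)%N ->
  ('C(k, 2) + i.-1 < 'C(n.+1, 2))%N.
Proof.
move=> ik kn; apply: (@leq_trans 'C(k.+1, 2)); last exact: leq_bin2l.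
by rewrite binS bin1; lia.
Qed.

Lemma increasing_uptoW n (y : nat -> int) a b : increasing_upto n y ->
  (1 <= a <= b)%N -> (b <= n)%N -> y a <= y b.
Proof.
move=> inc /andP[a1]; elim: b => [|b IHb]; first by case: a a1.
rewrite leq_eqVlt => /orP[/eqP -> //|ab] bn.
apply: le_trans (IHb ab (ltnW bn)) _; apply/ltW/inc.
by rewrite bn (leq_trans a1 ab).
Qed.

Lemma gt_upto_range n (x : nat -> nat -> int) k i : gt_upto n x ->
  (1 <= i <= k)%N -> (k <= n)%N -> x n 1%N <= x k i <= x n n.
Proof.
move=> g ik kn; have n1 : (0 < n)%N by lia.
have inc := gt_upto_increasing n1 g.
have [d nk] : exists d, n = (k + d)%N by exists (n - k)%N; lia.
elim: d k i nk ik {kn} => [|d IHd] k i nk ik.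
  have kn : k = n by lia.
  rewrite kn; rewrite kn in ik; case/andP: (ik) => i1 iN.
  by rewrite !(increasing_uptoW inc) ?i1 ?iN ?leqnn.
have kn : (1 <= k < n)%N by lia.
have /andP[h1 h2] := g k kn i ik.
have nk' : n = (k.+1 + d)%N by lia.
have ik1 : (1 <= i <= k.+1)%N by lia.
have ik2 : (1 <= i.+1 <= k.+1)%N by lia.
have /andP[h3 _] := IHd k.+1 i nk' ik1.
have /andP[_ h4] := IHd k.+1 i.+1 nk' ik2.
by rewrite (le_trans h3 h1) (le_trans (ltW h2) h4).
Qed.

Lemma ler_rval N p q : (p <= q)%N -> rval N p <= rval N q.
Proof. by move=> pq; rewrite ler_wpM2r ?(ltW (mesh_gt0 _ _))// lerD2r ler_nat. Qed.

(** Interlacing confines all entries between the first and the last of row [n], so each square is at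
    most the sum of those two. Gaussian decay in the last row thus controls the whole pattern. *)
Lemma gt_upto_sum_sqr n N s : gt_upto n (lattice_pattern s) ->
  \sum_(l < 'C(n.+1, 2)) rval N (nth 0%N s l) ^+ 2 <=
  (2 * 'C(n.+1, 2))%:R * \sum_(i < n) rval N (nth 0%N s ('C(n, 2) + i)) ^+ 2.
Proof.
move=> g; set S := \sum_(i < n) _.
have S1 (i : 'I_n) : rval N (nth 0%N s ('C(n, 2) + i)) ^+ 2 <= S.
  by rewrite /S (bigD1 i)//= lerDl sumr_ge0// => j _; exact: sqr_ge0.
apply: (@le_trans _ _ (\sum_(l < 'C(n.+1, 2)) (2 * S))); last first.
  by rewrite sumr_const card_ord -[_ *+ 'C(_, _)]mulr_natl mulrA -natrM mulnC.
apply: ler_sum => l _; have [k [i [ik kn ->]]] := pattern_indexP (ltn_ord l).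
have n1 : (0 < n)%N by lia.
have := gt_upto_range g ik kn; rewrite /lattice_pattern !lez_nat addn0 => /andP[h1 h2].
have n1' : (n.-1 < n)%N by lia.
have := S1 (Ordinal n1); have := S1 (Ordinal n1'); rewrite /= addn0.
have := ler_rval N h1; have := ler_rval N h2.
move: (rval _ _) (rval _ _) (rval _ _) => a b c cb ac b2 a2.
by have [c0|c0] := lerP 0 c; nra.
Qed.
(** Completing the square bounds each difference [u] by [(4 * e)^-1 + e * u ^+ 2]. Since [e] is
    free, the growth of the product can be made slower than any prescribed Gaussian decay. *)
Lemma vdm_le n (r : nat -> R) (e : R) : 0 < e ->
  (forall i j, (1 <= i < j)%N -> (j <= n)%N -> r i <= r j) ->
  vdm n r <= expR ('C(n, 2)%:R * ((4 * e)^-1 + 4 * e * \sum_(i < n) r i.+1 ^+ 2)).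
Proof.
move=> e0 inc; set S := \sum_(i < n) _.
have S1 i : (1 <= i <= n)%N -> r i ^+ 2 <= S.
  case: i => // i iN; rewrite /S (bigD1 (Ordinal iN))//= lerDl sumr_ge0// => j _.
  exact: sqr_ge0.
rewrite expRM_natl -prod_pairs_const /vdm.
rewrite big_seq [leRHS]big_seq; apply: ler_prod => j; rewrite mem_index_iota => jn.
rewrite !(@big_seq _ _ _ _ (index_iota 1 j)); apply/andP; split.
  apply: prodr_ge0 => i; rewrite mem_index_iota => ij.
  by rewrite subr_ge0 inc//; lia.
apply: ler_prod => i; rewrite mem_index_iota => ij.
have jn' : (j <= n)%N by lia.
rewrite subr_ge0 inc//=.
apply: le_trans (le_trans _ (expR_ge1Dx _)); last first.
- apply: (@le_trans _ _ ((4 * e)^-1 + 4 * e * S)); last by rewrite lerDr.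
  exact: lexx.
have Si := S1 i ltac:(lia); have Sj := S1 j ltac:(lia).
set u := r j - r i; have u2 : u ^+ 2 <= 4 * S.
  by have := sqr_ge0 (r j + r i); rewrite /u; nra.
have : 0 <= (2 * e * u - 1) ^+ 2 by exact: sqr_ge0.
have -> : (2 * e * u - 1) ^+ 2 = (4 * e) * (e * u ^+ 2 - u + (4 * e)^-1).
  by field; rewrite gt_eqF.
rewrite pmulr_rge0 ?mulr_gt0// => h.
have : e * u ^+ 2 <= e * (4 * S) by rewrite ler_pM2l.
by lra.
Qed.

Lemma scaled_pmf_ub n : (1 <= n)%N -> exists C a : R, 0 < a /\ forall N s,
  scaled_pmf n N s <=
    C * expR (- (a * \sum_(l < 'C(n.+1, 2)) rval N (nth 0%N s l) ^+ 2)).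
Proof.
case: n => // m n1; set n := m.+1.
have [C1 C10 bub] := bfac_ub R m.
have [B Bu] := cvg_has_ub (cvgP _ (@cvg_krawt_scale R _ n1)).
have Bu' N : krawt_scale R N n <= B.
  by apply: le_trans (ler_norm _) (Bu _ _); exists N.
have B0 : 0 <= B by apply: le_trans (normr_ge0 _) (Bu _ _); exists 0%N.
pose K : R := 8 * m.+2%:R; have K0 : 0 < K by rewrite mulr_gt0.
pose c : R := 'C(n, 2)%:R; have c0 : 0 <= c by [].
(* Makes [c * (4 * e) <= (2 * K)^-1], so that the Vandermonde product costs at most half of the
   decay [S / K]; the [+ 1] covers [c = 0]. *)
pose e := (8 * K * (c + 1))^-1.
have e0 : 0 < e by rewrite invr_gt0 !mulr_gt0// ltr_wpDl.
have D0 : 0 < 'C(n.+1, 2)%:R :> R by rewrite ltr0n bin_gt0.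
(* The other half of the decay, spread over all entries by [T <= 2 * 'C(n.+1, 2) * S], gives the
   rate. *)
exists (B * (C1 ^+ n * expR (c * (4 * e)^-1))), (4 * K * 'C(n.+1, 2)%:R)^-1.
split=> [|N s]; first by rewrite invr_gt0 !mulr_gt0.
set T := \sum_(l < _) _; rewrite /scaled_pmf; case: asboolP => [g|_]; last first.
  by rewrite mul0r mulr0 !mulr_ge0 ?exprn_ge0 ?expR_ge0// ltW.
rewrite mul1r.
pose q i := nth 0%N s ('C(n, 2) + i.-1).
have := @krawt_scaled R N n q n1; rewrite /q /lattice_pattern => ->.
rewrite -/q; pose S := \sum_(i < n) rval N (q i.+1) ^+ 2.
have TS : (4 * K * 'C(n.+1, 2)%:R)^-1 * T <= S / (2 * K).
  have := gt_upto_sum_sqr N g; rewrite -/T -/S => h.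
  rewrite mulrC ler_pdivrMr ?mulr_gt0//; apply: le_trans h _.
  by rewrite natrM le_eqVlt; apply/orP; left; apply/eqP; field; rewrite gt_eqF.
have rinc i j : (1 <= i < j)%N -> (j <= n)%N -> rval N (q i) <= rval N (q j).
  move=> ij jn; apply: ler_rval; have := @increasing_uptoW n (lattice_pattern s n) i j.
  rewrite /lattice_pattern lez_nat; apply=> //; last by lia.
  exact: (gt_upto_increasing n1 g).
have V := vdm_le e0 rinc; rewrite -/S -/c in V.
have V' : vdm n (fun i => rval N (q i)) <= expR (c * (4 * e)^-1) * expR (S / (2 * K)).
  apply: le_trans V _; rewrite -expRD ler_expR mulrDr lerD2l mulrA.
  rewrite [leRHS]mulrC ler_wpM2r ?sumr_ge0// => [i _|]; first exact: sqr_ge0.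
  rewrite /e; set k := c + 1; have k0 : 0 < k by rewrite ltr_wpDl.
  rewrite (_ : c * _ = c / k * (2 * K)^-1); last by field; rewrite !gt_eqF.
  apply: ler_piMl; first by rewrite invr_ge0 mulr_ge0// ltW.
  by rewrite ler_pdivrMr// mul1r lerDl.
have bP : \prod_(i < n) bfac R N n (q i.+1) <= C1 ^+ n * expR (- (S / K)).
  apply: (@le_trans _ _ (\prod_(i < n) (C1 * expR (- (rval N (q i.+1) ^+ 2 / K))))).
    by apply: ler_prod => i _; rewrite bfac_ge0/=; exact: bub.
  by rewrite big_split/= prodr_const card_ord -expR_sum sumrN mulr_suml.
have b0 : 0 <= \prod_(i < n) bfac R N n (q i.+1).
  by apply: prodr_ge0 => i _; exact: bfac_ge0.
have v0 : 0 <= vdm n (fun i => rval N (q i)).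
  by apply: vdm_ge0 => i /andP[i1 iN]; apply: rinc => //; rewrite i1 ltnSn.
have h0 : 0 <= krawt_scale R N n.
  by apply: prodr_ge0 => i _; rewrite mulr_ge0 ?invr_ge0.
apply: le_trans (ler_pM (mulr_ge0 h0 b0) v0 (ler_pM h0 b0 (Bu' N) bP) V') _.
have -> : B * (C1 ^+ n * expR (- (S / K))) * (expR (c / (4 * e)) * expR (S / (2 * K))) =
    B * (C1 ^+ n * expR (c / (4 * e))) * (expR (- (S / K)) * expR (S / (2 * K))) by ring.
apply: ler_wpM2l; first by rewrite !mulr_ge0 ?exprn_ge0 ?expR_ge0// ltW.
rewrite -expRD ler_expR lerNr opprD opprK; apply: le_trans TS _.
have -> : S / K = S / (2 * K) + S / (2 * K) by field; rewrite gt_eqF.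
by rewrite addrK.
Qed.

End scaled_pmf.

(** * Pointwise limit of the rescaled law *)

Section scaled_pmf_limit.
Context (R : realType).
Local Notation mesh := (mesh R).
Local Notation rval := (rval R).
Implicit Types (n N k i : nat).

Lemma near_rnd_lt (a b : R) : a < b -> \forall N \near \oo, (rnd N a < rnd N b)%N.
Proof.
move=> ab; have e0 : 0 < (b - a) / 2 by lra.
have ca := @rval_rnd_cvg R a; have cb := @rval_rnd_cvg R b.
near=> N; rewrite ltnNge; apply/negP => /(ler_rval R N).
have : `|a - rval N (rnd N a)| < (b - a) / 2 by near: N; exact: cvgr_dist_lt.
have : `|b - rval N (rnd N b)| < (b - a) / 2 by near: N; exact: cvgr_dist_lt.
by rewrite !ltr_norml => /andP[_ h1] /andP[h2 _]; lra.
Unshelve. all: by end_near. Qed.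

Lemma prod_chiE n (x : nat -> nat -> R) :
  \prod_(1 <= k < n) chi k (x k) (x k.+1) =
  `[< forall k, (1 <= k < n)%N -> forall i, (1 <= i <= k)%N ->
        x k.+1 i <= x k i <= x k.+1 i.+1 >]%:R.
Proof.
case: asboolP => [h|h].
  rewrite big_nat_cond big1// => k /andP[kn _].
  by rewrite /chi asboolT// => i ik; exact: h.
by apply/eqP; apply: contrapT => /negP/prod_chi_neq0.
Qed.

Lemma pattern_index_neq k i k' i' : (1 <= i <= k)%N -> (1 <= i' <= k')%N ->
  k != k' -> ('C(k, 2) + i.-1 != 'C(k', 2) + i'.-1)%N.
Proof.
wlog kk' : k i k' i' / (k < k')%N => [h ik ik' n|ik _ _].
  by have := n; rewrite neq_ltn => /orP[l|l]; [|rewrite eq_sym]; apply: h => //;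
    rewrite eq_sym.
have := @pattern_index_lt k'.-1 k i ik ltac:(lia).
by rewrite prednK; lia.
Qed.

(** Rounding eventually preserves the strict order of any two distinct coordinates, so strict and
    weak inequalities agree on both levels and the half-strict interlacing becomes the weak one. *)
Lemma near_gt_upto n (z : 'C(n.+1, 2).-tuple R) :
  (forall i j : 'I_'C(n.+1, 2), i != j -> tnth z i != tnth z j) ->
  \forall N \near \oo, `[< gt_upto n (lattice_pattern (map (rnd N) z)) >]%:R =
    \prod_(1 <= k < n) chi k (entry z k) (entry z k.+1).
Proof.
move=> dz.
have near_lt : \forall N \near \oo, forall i j : 'I_'C(n.+1, 2), tnth z i < tnth z j ->
    (rnd N (tnth z i) < rnd N (tnth z j))%N.
  apply: filter_forall => i; apply: filter_forall => j.
  have [ij|ij] := ltP (tnth z i) (tnth z j); last by apply: nearW.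
  by apply: filterS (near_rnd_lt ij).
near=> N; rewrite prod_chiE; congr ((nat_of_bool _)%:R); apply: asbool_equiv_eq.
have lt_rnd (i j : 'I_'C(n.+1, 2)) : i != j -> (rnd N (tnth z i) < rnd N (tnth z j))%N = (tnth z i < tnth z j).
  move=> ij; have lt : forall i j : 'I_'C(n.+1, 2), tnth z i < tnth z j ->
    (rnd N (tnth z i) < rnd N (tnth z j))%N by near: N.
  apply/idP/idP; last exact: lt.
  apply: contraTT; rewrite -leNgt -leqNgt le_eqVlt => /orP[|/lt/ltnW//].
  by rewrite (negbTE (dz _ _ _)) 1?eq_sym.
have lt_entry k i k' i' : (1 <= i <= k)%N -> (k <= n)%N ->
    (1 <= i' <= k')%N -> (k' <= n)%N -> k != k' ->
    (lattice_pattern (map (rnd N) z) k i < lattice_pattern (map (rnd N) z) k' i') =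
    (entry z k i < entry z k' i').
  move=> ik kn ik' kn' kk'; rewrite /lattice_pattern /entry ltz_nat.
  have l1 := pattern_index_lt ik kn; have l2 := pattern_index_lt ik' kn'.
  rewrite !(nth_map 0) ?size_tuple//.
  have := lt_rnd (Ordinal l1) (Ordinal l2); rewrite !(tnth_nth 0)/=; apply.
  by rewrite -val_eqE/= pattern_index_neq.
split=> g k kn i ik.
  have /andP[h1 h2] := g k kn i ik; apply/andP; split.
    by rewrite leNgt -lt_entry -?leNgt//; lia.
  by apply: ltW; rewrite -lt_entry//; lia.
have ne k' i' k'' i'' : (1 <= i' <= k')%N -> (k' <= n)%N ->
    (1 <= i'' <= k'')%N -> (k'' <= n)%N -> k' != k'' -> entry z k' i' != entry z k'' i''.
  move=> ik' kn' ik'' kn'' kk; rewrite /entry.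
  have l1 := pattern_index_lt ik' kn'; have l2 := pattern_index_lt ik'' kn''.
  have := dz (Ordinal l1) (Ordinal l2); rewrite !(tnth_nth 0)/=; apply.
  by rewrite -val_eqE/= pattern_index_neq.
have /andP[h1 h2] := g k kn i ik; apply/andP; split.
  by rewrite leNgt lt_entry -?leNgt//; lia.
by rewrite lt_entry ?lt_neqAle ?h2 ?andbT ?ne//; lia.
Unshelve. all: by end_near. Qed.

Lemma scaled_pmf_cvg n (z : 'C(n.+1, 2).-tuple R) : (1 <= n)%N ->
  (forall i j : 'I_'C(n.+1, 2), i != j -> tnth z i != tnth z j) ->
  scaled_pmf R n N (map (rnd N) z) @[N --> \oo] --> gtp_density n (entry z).
Proof.
move=> n1 dz; set X := \prod_(1 <= k < n) chi k (entry z k) (entry z k.+1).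
have E : \forall N \near \oo,
    X * (krawt_scale R N n * (\prod_(i < n) bfac R N n (rnd N (entry z n i.+1))) *
      vdm n (fun i => rval N (rnd N (entry z n i)))) =
    scaled_pmf R n N (map (rnd N) z).
  near=> N; rewrite /scaled_pmf.
  rewrite (_ : `[< _ >]%:R = X); last by near: N; exact: near_gt_upto.
  rewrite [RHS]mulrCA; congr (X * _).
  have qE i : (1 <= i <= n)%N ->
      nth 0%N (map (rnd N) z) ('C(n, 2) + i.-1) = rnd N (entry z n i).
    by move=> iN; rewrite (nth_map 0)// size_tuple pattern_index_lt.
  have := @krawt_scaled R N n (fun i => nth 0%N (map (rnd N) z) ('C(n, 2) + i.-1)) n1.
  rewrite /lattice_pattern => ->; congr (_ * _ * _).
    by apply: eq_bigr => i _; rewrite qE//= ltn_ord.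
  by apply: eq_vdm => i iN; rewrite qE.
apply: cvg_trans (near_eq_cvg E) _.
have -> : gtp_density n (entry z) =
    X * (1 * (\prod_(i < n) ((Num.sqrt (2 * pi))^-1 * expR (- (entry z n i.+1 ^+ 2 / 2)))) *
      vdm n (entry z n)).
  rewrite /gtp_density -/X mulrC mul1r big_split/= prodr_const card_ord exprVn.
  by rewrite -expR_sum sumrN big_add1 big_mkord.
apply: cvgM; first exact: cvg_cst.
apply: cvgM; first apply: cvgM; first exact: cvg_krawt_scale.
  apply: cvg_prod_ord => i; case: n n1 z dz X E i => // m *; exact: cvg_bfac.
under eq_fun do rewrite vdm_ord.
rewrite vdm_ord; apply: cvg_prod_ord => j.
apply: (@cvg_prod_ord R j (fun N (i : 'I_j) => rval N (rnd N (entry z n j.+1)) - rval N (rnd N (entry z n i.+1)))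
  (fun i : 'I_j => entry z n j.+1 - entry z n i.+1)) => i.
by apply: cvgB; exact: rval_rnd_cvg.
Unshelve. all: by end_near. Qed.
End scaled_pmf_limit.

(** * Limits of expectations as lattice sums *)

Section expectation_limit.
Context (R : realType).
Local Notation mesh := (mesh R).
Local Notation center := (center R).
Local Notation rval := (rval R).
Local Notation lam m := (@lebesgue_tuple R m).

Lemma measurable_gtp_density n :
  measurable_fun [set: 'C(n.+1, 2).-tuple R] (fun z => gtp_density n (entry z)).
Proof.
have me k i := @measurable_entry R 'C(n.+1, 2) k i.
apply: measurable_funM; first apply: measurable_funM; first apply: measurable_funM => //.
- apply: measurableT_comp => //; apply: measurableT_comp => //.
  apply: measurable_sum => i; apply: measurable_funM => //.
  exact: measurable_funX.
- apply: measurable_prod => j _; apply: measurable_prod => i _.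
  exact: measurable_funB.
- under eq_fun do rewrite prod_chiE.
  pose A := [set z : 'C(n.+1, 2).-tuple R | forall k, (1 <= k < n)%N -> forall i, (1 <= i <= k)%N ->
        entry z k.+1 i <= entry z k i <= entry z k.+1 i.+1].
  rewrite (_ : (fun z => _) = \1_A); last first.
    by apply/funext => z; rewrite indicE /A; congr ((nat_of_bool _)%:R).
  pose B k i := [set z : 'C(n.+1, 2).-tuple R | (1 <= k < n)%N && (1 <= i <= k)%N ->
    entry z k.+1 i <= entry z k i <= entry z k.+1 i.+1].
  apply: measurable_indic; rewrite (_ : A = \bigcap_k \bigcap_i B k i); last first.
    apply/seteqP; split=> z /= h; first by move=> k _ i _ /= /andP[kn]; exact: h.
    by move=> k kn i ik; apply: (h k I i I) => /=; rewrite kn.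
  apply: bigcapT_measurable => k; apply: bigcapT_measurable => i.
  have [ik|/negbTE ik] := boolP ((1 <= k < n)%N && (1 <= i <= k)%N); last first.
    by rewrite (_ : B k i = setT)//; apply/seteqP; split => // z _; rewrite /B /= ik.
  rewrite (_ : B k i =
      (setT `&` [set z : 'C(n.+1, 2).-tuple R | entry z k.+1 i <= entry z k i]) `&`
      (setT `&` [set z : 'C(n.+1, 2).-tuple R | entry z k i <= entry z k.+1 i.+1])).
    by apply: measurableI; apply: measurable_fun_le.
  rewrite !setTI; apply/seteqP; split => z /=; first by move=> /(_ ik)/andP[].
  by move=> [h1 h2] _; rewrite h1.
Qed.

Definition row_of_seq N m (s : seq nat) : 'rV[R]_m := \row_(i < m) rval N (nth 0%N s i).

Lemma cvg_row m (x : nat -> 'rV[R]_m) (l : 'rV[R]_m) :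
  (forall i, x N ord0 i @[N --> \oo] --> l ord0 i) -> x N @[N --> \oo] --> l.
Proof.
move=> xl; apply/cvg_ballP => e e0.
have : \forall N \near \oo, forall i, ball (l ord0 i) e (x N ord0 i).
  by apply: filter_forall => i; apply: cvg_ball.
by apply: filterS => N h; split=> // i j; rewrite (ord1 i); exact: h.
Qed.

Lemma cvg_row_of_seq m (z : m.-tuple R) :
  row_of_seq N m (map (rnd N) z) @[N --> \oo] --> row_of_tuple z.
Proof.
apply: cvg_row => i; rewrite mxE (tnth_nth 0).
under eq_fun do rewrite mxE (nth_map 0) ?size_tuple//.
exact: rval_rnd_cvg.
Qed.

Lemma near_stepE m (F : nat -> seq nat -> R) (L : nat -> nat) (z : m.-tuple R) :
  (forall N, N.+2 <= L N)%N ->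
  \forall N \near \oo, F N (map (rnd N) z) = step (mesh N) (center N) (L N) (F N) z.
Proof.
move=> lL; have : \forall N \near \oo, forall i, `|tnth z i| <= Num.sqrt N.+1%:R.
  by apply: filter_forall => i; exact: near_rnd_in.
apply: filterS => N zN; rewrite stepE ?mesh_gt0// ifT//; apply/forallP => i.
by have [-> q] := rnd_in (zN i); exact: leq_trans q (lL N).
Qed.

(** Continuity concerns row vectors and measurability tuples; a pointwise limit of step functions
    connects the two. *)
Lemma measurable_row_of_tuple m (f : 'rV[R]_m -> R) : continuous f ->
  measurable_fun [set: m.-tuple R] (fun z => f (row_of_tuple z)).
Proof.
move=> cf; pose h N := @step R (mesh N) (center N) m N.+2 (fun s => f (row_of_seq N m s)).
apply: (@measurable_fun_cvg _ _ R _ h) => [N|z _]; first exact: measurable_step.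
have E := near_stepE (fun N s => f (row_of_seq N m s)) (L := fun N => N.+2) z (fun N => leqnn _).
apply: cvg_trans (near_eq_cvg E) _.
apply: continuous_cvg; [exact: cf|exact: cvg_row_of_seq].
Qed.

(** Nonnegativity of [f] makes the step functions nonnegative; signed test functions are reached
    later by adding a constant. The range of indices is right because a particle at time [N.+1] is
    at most at [n + N.+1]. *)
Lemma scaled_pmf_expectation_cvg n (f : 'rV[R]_('C(n.+1, 2)) -> R) (M : R) :
  (1 <= n)%N -> continuous f -> (forall v, 0 <= f v <= M) ->
  let H (z : 'C(n.+1, 2).-tuple R) := gtp_density n (entry z) * f (row_of_tuple z) in
  (lam 'C(n.+1, 2)).-integrable setT (EFin \o H) /\
  ((mesh N ^+ 'C(n.+1, 2) * \sum_(x : 'C(n.+1, 2).-tuple 'I_((N + n).+2))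
     (scaled_pmf R n N (map val x) * f (row_of_seq N 'C(n.+1, 2) (map val x))))%:E
    @[N --> \oo] --> \int[lam 'C(n.+1, 2)]_z (H z)%:E)%E.
Proof.
move=> n1 cf fM H; pose D := 'C(n.+1, 2).
have [C [a [a0 ub]]] := scaled_pmf_ub R n1.
have M0 : 0 <= M by have /andP[/le_trans] := fM 0; apply.
have L2 N : (N.+2 <= (N + n).+2)%N by lia.
pose F N s := scaled_pmf R n N s * f (row_of_seq N D s).
have C0 : 0 <= C.
  have := le_trans (scaled_pmf_ge0 R 0 [::] n1) (ub 0%N [::]).
  by rewrite pmulr_lge0// expR_gt0.
(* By [t ^+ 2 <= 2 * r ^+ 2 + 8], passing from lattice point [r] to a point [t] of its cell halves
   the rate and costs [expR (4 * a)] per coordinate. *)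
pose G (z : D.-tuple R) := C * M * expR (4 * a *+ D) *
  \prod_(i < D) expR (- (a / 2 * tnth z i ^+ 2)).
apply: (@step_cvg R D mesh center (fun N => (N + n).+2)%N F H G).
- exact: mesh_gt0.
- move=> N s; have /andP[f0 _] := fM (row_of_seq N D s).
  by rewrite mulr_ge0// scaled_pmf_ge0.
- apply: measurable_funM; [exact: measurable_gtp_density|exact: measurable_row_of_tuple].
- have : {ae lam D, forall z, forall i j : 'I_D, i != j -> tnth z i != tnth z j}.
    apply: filter_forall => i; apply: filter_forall => j.
    have [->|ij] := eqVneq i j; first by apply: aeW.
    have : (lam D).-negligible [set z | tnth z i = tnth z j].
      by apply/negligibleP; [exact: measurable_tnth_eq|exact: lebesgue_tuple_diag].
    by apply: negligibleS => z /= /existsNP[_ /negP]; rewrite negbK => /eqP.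
  apply: filterS => z dz.
  have E := near_stepE F (L := fun N => ((N + n).+2)%N) z L2.
  apply: cvg_trans (near_eq_cvg E) _.
  apply: cvgM; first exact: scaled_pmf_cvg.
  by apply: continuous_cvg; [exact: cf|exact: cvg_row_of_seq].
- apply: integrable_gauss_prod; exact: divr_gt0.
- move=> N z; rewrite stepE ?mesh_gt0//; case: ifPn => [/forallP zL|_]; last first.
    by rewrite !mulr_ge0 ?expR_ge0// prodr_ge0// => i _; exact: expR_ge0.
  set s := map _ _; have /andP[f0 f1] := fM (row_of_seq N D s).
  apply: le_trans (ler_pM (scaled_pmf_ge0 R N s n1) f0 (ub N s) f1) _.
  rewrite /G mulrAC -!mulrA !ler_wpM2l//.
  rewrite -expR_sum -expRD ler_expR.
  have -> : 4 * a *+ D = \sum_(i < D) 4 * a by rewrite sumr_const card_ord.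
  rewrite -big_split/= mulr_sumr -sumrN; apply: ler_sum => i _.
  have /andP[p _] := zL i; have := rval_rnd_sqr p.
  have -> : nth 0%N s i = rnd N (tnth z i).
    by rewrite /s (nth_map 0) ?size_tuple// (tnth_nth 0).
  move: (rval _ _) => r; move: (tnth _ _) => t rt.
  have : 0 <= a * (2 * r ^+ 2 + 8 - t ^+ 2) by apply: mulr_ge0; [exact: ltW|rewrite subr_ge0].
  by lra.
Qed.

End expectation_limit.

(** * Weak convergence *)

Section expectation.
Context (R : realType) d (T : measurableType d) (P : probability T R).
Context (n : nat) (beta : nat -> nat -> nat -> {RV P >-> nat})
  (X : nat -> nat -> nat -> T -> int).
Hypothesis n1 : (1 <= n)%N.
Hypothesis iid : iid_fair_bits n beta.
Hypothesis process : aztec_process n beta X.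
Local Notation D := 'C(n.+1, 2).

Lemma nth_pattern_seq (U : Type) (u0 : U) m (x : nat -> nat -> U) k i :
  (1 <= i <= k)%N -> (k <= m)%N ->
  nth u0 (pattern_seq m x) ('C(k, 2) + i.-1) = x k i.
Proof.
move=> ik; elim: m => [|m IHm] km; first by lia.
rewrite pattern_seqS nth_cat (eqP (size_pattern_seq _ _)).
move: km; rewrite leq_eqVlt ltnS => /orP[/eqP kE|km].
  rewrite kE ifF ?addKn; last by lia.
  have i1 : (i.-1 < m.+1)%N by lia.
  by rewrite (nth_map 0%N) ?size_iota// nth_iota//; congr x; lia.
by rewrite pattern_index_lt// IHm.
Qed.

Lemma discrete_pattern t :
  discrete_measurable (fun w => pattern_seq n (fun k i => X k i t w)).
Proof.
have -> : (fun w => pattern_seq n (fun k i => X k i t w)) =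
    (fun w => [seq X p.1 p.2 t w | p <- [seq (k, i) | k <- iota 1 n, i <- iota 1 k]]).
  by apply/funext => w; rewrite map_allpairs.
apply: (@discrete_map _ _ _ _ (fun p => X p.1 p.2 t)) => p /allpairsPdep[k [i [kn ik ->]]] /=.
by apply: (discrete_X n1 process); move: kn ik; rewrite !mem_iota; lia.
Qed.

Lemma measurable_discrete_comp (U : countType) (V : T -> U) (g : U -> R) :
  discrete_measurable V -> measurable_fun [set: T] (g \o V).
Proof.
by move=> mV _ Y _; rewrite setTI comp_preimage; exact: discrete_preimage.
Qed.

Lemma rescaled_row N w (s : seq nat) : rows_from n X 0 N.+1 (lattice_pattern s) w ->
  row_of_tuple (rescaled R n X N.+1 w) = row_of_seq R N D s.
Proof.
move=> ws; apply/rowP => l; rewrite !mxE (tnth_nth 0).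
have [k [i [ik kn ->]]] := pattern_indexP (ltn_ord l).
rewrite nth_pattern_seq// ws// /lattice_pattern /rval /center /mesh.
by field; rewrite gt_eqF// sqrtS_gt0.
Qed.

Lemma ae_rows_from N : {ae P, forall w, exists x : D.-tuple 'I_(N + n).+2,
  rows_from n X 0 N.+1 (lattice_pattern (map val x)) w}.
Proof.
apply: filterS (ae_bits_ok iid) => w bw.
exists (map_tuple inord (pattern n (fun k i => `|X k i N.+1 w|%N))) => k i ik kn.
have /andP[_ kn'] := kn; have := aztec_bounds process bw N.+1 ik kn' => b.
rewrite /lattice_pattern /= -map_comp (nth_map 0%N); last first.
  by rewrite (eqP (size_pattern_seq _ _)) pattern_index_lt.
by rewrite nth_pattern_seq//= inordK; lia.
Qed.

Lemma rows_from_inj N w (x y : D.-tuple 'I_(N + n).+2) :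
  rows_from n X 0 N.+1 (lattice_pattern (map val x)) w ->
  rows_from n X 0 N.+1 (lattice_pattern (map val y)) w -> x = y.
Proof.
move=> wx wy; apply: eq_from_tnth => l; apply: val_inj.
have [k [i [ik kn lE]]] := pattern_indexP (ltn_ord l).
have := wx k i ik kn; rewrite wy// /lattice_pattern -lE => -[].
by rewrite !(nth_map ord0) ?size_tuple// -!tnth_nth.
Qed.

Lemma measurable_rescaled (f : 'rV[R]_D -> R) N :
  measurable_fun setT (fun w => f (row_of_tuple (rescaled R n X N w))).
Proof.
pose phi (s : seq int) := f (\row_(i < D)
  (((nth 0 s i)%:~R - 2^-1 * N%:R) / (2^-1 * Num.sqrt N%:R))).
rewrite (_ : (fun _ => _) =
    phi \o (fun w => pattern_seq n (fun k i => X k i N w))).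
  by apply: measurable_discrete_comp; exact: discrete_pattern.
apply/funext => w; congr f; apply/rowP => l; rewrite !mxE (tnth_nth 0).
have [k [i [ik kn ->]]] := pattern_indexP (ltn_ord l).
by rewrite !nth_pattern_seq.
Qed.

(** Almost surely exactly one lattice pattern describes the process, so the expectation is a finite
    sum; it is then multiplied and divided by the volume of a cell. *)
Lemma expectation_rescaled (f : 'rV[R]_D -> R) N : (forall v, 0 <= f v) ->
  ('E_P[fun w => f (row_of_tuple (rescaled R n X N.+1 w))] =
   (mesh R N ^+ D * \sum_(x : D.-tuple 'I_(N + n).+2)
     (scaled_pmf R n N (map val x) * f (row_of_seq R N D (map val x))))%:E)%E.
Proof.
move=> f0; pose A (x : D.-tuple 'I_(N + n).+2) :=
  rows_from n X 0 N.+1 (lattice_pattern (map val x)).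
have mA x : measurable (A x) by exact: (measurable_rows_from n1 process).
pose g w := \sum_(x : D.-tuple 'I_(N + n).+2) f (row_of_seq R N D (map val x)) * \1_(A x) w.
rewrite unlock (@ae_eq_integral _ _ _ _ _ (EFin \o g))//; last 3 first.
- by apply/measurable_EFinP; exact: measurable_rescaled.
- apply/measurable_EFinP; apply: measurable_sum => x; apply: measurable_funM => //.
- apply: filterS (ae_rows_from N) => w [x wx] _ /=; congr _%:E.
  rewrite /g (bigD1 x)//= big1 ?addr0 => [|y yx]; last first.
    rewrite indicE memNset ?mulr0// => wy.
    by move/eqP: yx; apply; exact: rows_from_inj wy wx.
  by rewrite indicE mem_set// mulr1 (rescaled_row wx).
rewrite /g /=; under eq_integral do rewrite -sumEFin.
rewrite ge0_integral_sum//; last 2 first.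
- by move=> x; apply/measurable_EFinP; apply: measurable_funM.
- by move=> x w _; rewrite lee_fin mulr_ge0.
rewrite mulr_sumr -sumEFin; apply: eq_bigr => x _.
under eq_integral do rewrite EFinM.
rewrite ge0_integralZl//; last 2 first.
- exact/measurable_EFinP.
- by rewrite lee_fin.
rewrite integral_indic// setIT.
rewrite [X in (_ * X)%E](aztec_pmf n1 iid process) -EFinM; congr _%:E.
have h0 : mesh R N ^+ D != 0 by rewrite expf_neq0// gt_eqF// mesh_gt0.
rewrite /scaled_pmf; set K := _ * krawt _ _ _ _.
by rewrite [RHS]mulrA [X in _ = X * _]mulrA mulfV// mul1r mulrC.
Qed.

End expectation.

(** * Probability measures given by a density *)

Section density_probability.
Context d (T : measurableType d) (R : realType).
Variables (mu : {sigma_finite_measure set T -> \bar R}) (f : T -> R).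
Hypothesis mf : measurable_fun setT f.
Hypothesis f0 : forall x, 0 <= f x.
Hypothesis f1 : (\int[mu]_x (f x)%:E = 1)%E.

Lemma density_probability : exists Q : probability T R,
  forall A, measurable A -> Q A = (\int[mu]_(x in A) (f x)%:E)%E.
Proof.
pose q (A : set T) : \bar R := (\int[mu]_(x in A) (f x)%:E)%E.
have q0 : q set0 = 0%E by rewrite /q integral_set0.
have q_ge0 A : (0 <= q A)%E by apply: integral_ge0 => x _; rewrite lee_fin.
have q_sig : semi_sigma_additive q.
  move=> /= F mF tF mUF.
  rewrite /q ge0_integral_bigcup//; last 2 first.
  - by apply/measurable_EFinP; exact: measurable_funTS.
  - by move=> x _; rewrite lee_fin.
  apply: is_cvg_ereal_nneg_natsum_cond => k _ _; exact: q_ge0.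
pose b := isMeasure.Build _ _ _ q q0 q_ge0 q_sig.
pose Q0 : {measure set T -> \bar R} := HB.pack q b.
have Q1 : Q0 setT = 1%E by exact: f1.
pose b1 := Measure_isProbability.Build _ _ _ Q0 Q1.
pose Q : probability T R := HB.pack (Q0 : set T -> \bar R) (Measure.on Q0) b1.
by exists Q.
Qed.

(** Having the same integrals over measurable sets, [f] and the Radon-Nikodym derivative agree
    almost everywhere, and the change of variables for the latter applies. *)
Lemma integral_density_probability (Q : probability T R) (g : T -> R) (M : R) :
  (forall A, measurable A -> Q A = (\int[mu]_(x in A) (f x)%:E)%E) ->
  measurable_fun setT g -> (forall x, `|g x| <= M) ->
  (\int[Q]_x (g x)%:E = \int[mu]_x (f x * g x)%:E)%E.
Proof.
move=> QE mg gM.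
have dom : Q `<< mu.
  apply/null_content_dominatesP => A mA muA0; rewrite QE//.
  by apply: null_set_integral => //; apply/measurable_EFinP; exact: measurable_funTS.
have iQ : Q.-integrable setT (EFin \o g).
  apply/integrableP; split; first exact/measurable_EFinP.
  apply: (@le_lt_trans _ _ (\int[Q]_x M%:E)%E).
    apply: ge0_le_integral => //.
    - by apply/measurable_EFinP; exact: measurableT_comp.
    - by move=> x _; rewrite lee_fin (le_trans _ (gM x)).
  rewrite integral_cst//.
  by rewrite [X in (_ * X)%E]probability_setT mule1 ltry.
rewrite -(Radon_Nikodym_change_of_variables dom measurableT iQ).
under [RHS]eq_integral do rewrite mulrC EFinM.
apply: ae_eq_integral => //.
- apply: emeasurable_funM; first exact/measurable_EFinP.
  by apply: (measurable_int mu); exact: Radon_Nikodym_integrable.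
- by apply/measurable_EFinP; exact: measurable_funM.
- apply: ae_eqe_mul2l; apply: integral_ae_eq => //.
  + exact: Radon_Nikodym_integrable.
  + exact/measurable_EFinP.
  + by move=> E _ mE; rewrite -Radon_Nikodym_integral//= QE.
Qed.

End density_probability.

Lemma expectation_bounded_shift d (T : measurableType d) (R : realType)
    (P : probability T R) (g : T -> R) (M : R) :
  measurable_fun setT g -> (forall x, `|g x| <= M) ->
  ('E_P[g] = 'E_P[fun x => (g x + M)%R] - M%:E)%E.
Proof.
move=> mg gM.
have ib (h : T -> R) (K : R) : measurable_fun setT h -> (forall x, `|h x| <= K) ->
    P.-integrable setT (EFin \o h).
  move=> mh hK; apply: measurable_bounded_integrable => //.
    by rewrite [X in (X < _)%E]probability_setT ltry.
  exists K; split; first exact: num_real.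
  by move=> x Kx y _ /=; apply: le_trans (hK y) _; exact: ltW.
rewrite unlock -[X in (_ - X)%E](_ : \int[P]_x (cst M%:E) x = M%:E)%E; last first.
  by rewrite integral_cst// [X in (_ * X)%E]probability_setT mule1.
rewrite -integralB//.
- by apply: eq_integral => x _; rewrite /= -EFinB addrK.
- apply: (ib (fun x => g x + M) (M + M)); first exact: measurable_funD.
  move=> x; apply: le_trans (ler_normD _ _) _; rewrite lerD//.
  by rewrite ger0_norm// (le_trans _ (gM x)).
- apply: (ib (cst M) `|M|) => //.
Qed.

Theorem theorem7p4 (R : realType) (d : measure_display) (T : measurableType d)
    (P : probability T R) (n : nat)
    (beta : nat -> nat -> nat -> {RV P >-> nat})
    (X : nat -> nat -> nat -> T -> int) :
  (1 <= n)%N ->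
  iid_fair_bits n beta ->
  aztec_process n beta X ->
  exists (d' : measure_display) (T' : measurableType d') (Q : probability T' R)
    (Lambda : {RV Q >-> 'C(n.+1, 2).-tuple R}),
    has_density Lambda (@limit_density R n) /\
    converges_weakly P Q (rescaled R n X) Lambda.
Proof.
move=> n1 iid process; pose D := 'C(n.+1, 2).
pose f (z : D.-tuple R) := gtp_density n (entry z).
have mf : measurable_fun setT f by exact: measurable_gtp_density.
have f0 z : 0 <= f z by exact: gtp_density_ge0.
have cvgE (g : 'rV[R]_D -> R) M : continuous g -> (forall v, 0 <= g v <= M) ->
    ('E_P[fun w => g (row_of_tuple (rescaled R n X N.+1 w))] @[N --> \oo] -->
     \int[@lebesgue_tuple R D]_z (f z * g (row_of_tuple z))%:E)%E.
  move=> cg gM; have [_ cv] := scaled_pmf_expectation_cvg n1 cg gM.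
  rewrite (_ : (fun N => _) = (fun N => (mesh R N ^+ D *
    \sum_(x : D.-tuple 'I_(N + n).+2) (scaled_pmf R n N (map val x) *
      g (row_of_seq R N D (map val x))))%:E)); first exact: cv.
  apply/funext => N; apply: (expectation_rescaled n1 iid process) => v.
  by have /andP[] := gM v.
have f1 : (\int[@lebesgue_tuple R D]_z (f z)%:E = 1)%E.
  have c1 : continuous (fun _ : 'rV[R]_D => 1 : R) by exact: cst_continuous.
  have cv : ('E_P[fun=> 1%R] @[_ --> \oo] -->
      \int[@lebesgue_tuple R D]_z (f z * 1)%:E)%E.
    by apply: (cvgE (fun=> 1) 1) => // v; rewrite ler01 lexx.
  under eq_integral do rewrite -[f _]mulr1.
  have := cvg_unique _ cv (cvg_cst _) => -> //.
  by rewrite unlock integral_cst// mul1e; exact: probability_setT.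
have [Q QE] := density_probability mf f0 f1.
(* The limit vector is the identity of the tuple space under the law [Q]. *)
pose L : {RV Q >-> D.-tuple R} :=
  HB.pack (idfun : D.-tuple R -> D.-tuple R)
    (isMeasurableFun.Build _ _ _ _ idfun (@measurable_id _ (D.-tuple R) setT)).
exists _, _, Q, L; split.
  move=> A mA; rewrite /distribution /pushforward /= preimage_id QE//.
  by apply: eq_integral => z _; rewrite limit_densityE.
move=> g cg [M gM].
have M0 : 0 <= M by exact: le_trans (gM 0).
(* The shift makes the bounded test function nonnegative; [M] is subtracted again at the end. *)
pose h v := g v + M.
have ch : continuous h by move=> v; apply: (@continuousD _ _ _ g (cst M)); [exact: cg|exact: cst_continuous].
have hM v : 0 <= h v <= M + M.
  by have := gM v; rewrite ler_norml => /andP[g1 g2]; rewrite /h; lra.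
have hM' v : `|h v| <= M + M by have /andP[h0 h1] := hM v; rewrite ger0_norm.
have EL : ('E_Q[fun z => h (row_of_tuple (L z))] =
    \int[@lebesgue_tuple R D]_z (f z * h (row_of_tuple z))%:E)%E.
  rewrite unlock; apply: (integral_density_probability mf (M := M + M) QE) => //.
  exact: measurable_row_of_tuple.
have EP N : ('E_P[fun w => g (row_of_tuple (rescaled R n X N.+1 w))] =
    'E_P[fun w => h (row_of_tuple (rescaled R n X N.+1 w))] - M%:E)%E.
  by apply: expectation_bounded_shift => //; exact: (measurable_rescaled n1 process).
have EQ : ('E_Q[fun z => g (row_of_tuple (L z))] =
    'E_Q[fun z => h (row_of_tuple (L z))] - M%:E)%E.
  by apply: expectation_bounded_shift => //; exact: measurable_row_of_tuple.
(* All estimates are at time [N.+1], where the scaling factor is nonzero; dropping the term [N = 0]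
   leaves the limit unchanged. *)
rewrite EQ EL -cvg_shiftS.
rewrite (_ : (fun N => _) = (fun N =>
    'E_P[fun w => h (row_of_tuple (rescaled R n X N.+1 w))] - M%:E)%E); last first.
  exact/funext.
apply: cvgeB; first by rewrite fin_num_adde_defl.
  exact: cvgE ch hM.
exact: cvg_cst.
Qed.
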